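(* Let $(V,Y_V,\mathbf 1,\rho_V)$ be a Möbius MOSVA and $(W,Y_W^L,\rho_W)$ a grading-restricted Möbius left $V$-module. On the graded dual $W'=\coprod_{n\in\mathbb C}W_{[n]}^*$ (graded by $W'_{[n]}=W_{[n]}^*$) define $Y_W'$ by $\langle Y_W'(u,x)w',w\rangle=\langle w',Y_W^o(u,x)w\rangle=\langle w',Y_W^L(e^{xL_V(1)}(-x^{-2})^{L_V(0)}u,x^{-1})w\rangle$ for $u\in V$, $w\in W$, $w'\in W'$, and define $\rho_W'(L_j)=L_W'(j)$ ($j=0,\pm1$) by $\langle L_W'(j)w',w\rangle=\langle w',L_W(-j)w\rangle$. Then $(W',Y_W',\rho_W')$ is a Möbius left $V^{op}$-module, where $V^{op}=(V,Y_V^s,\mathbf 1,\rho_V)$ is the opposite Möbius MOSVA.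
   Context: Conventions: $x$ formal variable, $z$'s complex; products and iterates of vertex operators paired with a dual vector denote the corresponding multiple complex series. A meromorphic open-string vertex algebra (MOSVA) is a $\mathbb Z$-graded vector space $V=\coprod_{n\in\mathbb Z}V_{(n)}$ with a linear map $Y_V:V\otimes V\to V[[x,x^{-1}]]$ and a vacuum $\mathbf 1\in V$ such that: (i) $V_{(n)}=0$ for $n$ sufficiently negative; with $\mathbf d_Vv=nv$ for $v\in V_{(n)}$, $[\mathbf d_V,Y_V(v,x)]=x\frac{d}{dx}Y_V(v,x)+Y_V(\mathbf d_Vv,x)$; (ii) $Y_V(\mathbf 1,x)=1_V$, $Y_V(u,x)\mathbf 1\in V[[x]]$ and $\lim_{x\to0}Y_V(u,x)\mathbf 1=u$; (iii) with $D_Vv=\lim_{x\to0}\frac{d}{dx}Y_V(v,x)\mathbf 1$, $\frac{d}{dx}Y_V(v,x)=Y_V(D_Vv,x)=[D_V,Y_V(v,x)]$; (iv) rationality: with $V'=\coprod_nV_{(n)}^*$, for all $u_1,\dots,u_n,v\in V$, $v'\in V'$, $\langle v',Y_V(u_1,z_1)\cdots Y_V(u_n,z_n)v\rangle$ converges absolutely for $|z_1|>\cdots>|z_n|>0$ to a rational function with only possible poles at $z_i=0$, $z_i=z_j$ ($i\ne j$), and $\langle v',Y_V(Y_V(u_1,z_1-z_2)u_2,z_2)v\rangle$ converges absolutely for $|z_2|>|z_1-z_2|>0$ to a rational function with only possible poles at $z_1=0,z_2=0,z_1=z_2$; (v) associativity: these two agree for $|z_1|>|z_2|>|z_1-z_2|>0$.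 The opposite MOSVA is $(V,Y_V^s,\mathbf 1)$ with $Y_V^s(u,x)v=e^{xD_V}Y_V(v,-x)u$. A Möbius MOSVA is a MOSVA with a representation $\rho_V$ of $\mathfrak{sl}(2)$ (basis $L_{-1},L_0,L_1$, $[L_0,L_{\pm1}]=\mp L_{\pm1}$, $[L_{-1},L_1]=-2L_0$) with $L_V(0)=\rho_V(L_0)=\mathbf d_V$, $L_V(-1)=\rho_V(L_{-1})=D_V$, $L_V(1)=\rho_V(L_1)$, and $[L_V(1),Y_V(u,x)]=Y_V(L_V(1)u,x)+2xY_V(L_V(0)u,x)+x^2Y_V(L_V(-1)u,x)$ for $u\in V$. If $(V,Y_V,\mathbf 1,\rho_V)$ is Möbius then so is $(V,Y_V^s,\mathbf 1,\rho_V)$. A left $V$-module is a $\mathbb C$-graded vector space $W=\coprod_{m\in\mathbb C}W_{[m]}$ with a linear map $Y_W^L:V\otimes W\to W[[x,x^{-1}]]$, an operator $\mathbf d_W$ of weight $0$ and an operator $D_W$ of weight $1$ such that: (i) $W_{[m]}=0$ when $\mathrm{Re}(m)$ is sufficiently negative; $\mathbf d_Ww=mw$ for $w\in W_{[m]}$; $[\mathbf d_W,Y_W^L(u,x)]=Y_W^L(\mathbf d_Vu,x)+x\frac{d}{dx}Y_W^L(u,x)$; (ii) $Y_W^L(\mathbf 1,x)=1_W$; (iii) $\frac{d}{dx}Y_W^L(u,x)=Y_W^L(D_Vu,x)=[D_W,Y_W^L(u,x)]$; (iv) rationality: with $W'=\coprod_mW_{[m]}^*$, for $u_1,\dots,u_n\in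 V$, $w\in W$, $w'\in W'$, $\langle w',Y_W^L(u_1,z_1)\cdots Y_W^L(u_n,z_n)w\rangle$ converges absolutely for $|z_1|>\cdots>|z_n|>0$ to a rational function with only possible poles at $z_i=0$ and $z_i=z_j$ ($i\neq j$), and $\langle w',Y_W^L(Y_V(u_1,z_1-z_2)u_2,z_2)w\rangle$ converges absolutely for $|z_2|>|z_1-z_2|>0$ to a rational function with only possible poles at $z_1=0,z_2=0,z_1=z_2$; (v) associativity: $\langle w',Y_W^L(u_1,z_1)Y_W^L(u_2,z_2)w\rangle=\langle w',Y_W^L(Y_V(u_1,z_1-z_2)u_2,z_2)w\rangle$ for $|z_1|>|z_2|>|z_1-z_2|>0$. It is grading-restricted if every $W_{[m]}$ is finite-dimensional. A Möbius left $V$-module $(W,Y_W^L,\rho_W)$ is a left $V$-module with a representation $\rho_W$ of $\mathfrak{sl}(2)$ on $W$ with $L_W(j)=\rho_W(L_j)$, $L_W(-1)=D_W$, such that for $u\in V$: $[L_W(0),Y_W^L(u,x)]=Y_W^L(L_V(0)u,x)+xY_W^L(L_V(-1)u,x)$, $[L_W(1),Y_W^L(u,x)]=Y_W^L(L_V(1)u,x)+2xY_W^L(L_V(0)u,x)+x^2Y_W^L(L_V(-1)u,x)$, and for every $w\in W_{[n]}$ there is $m\in\mathbb N$ with $(L_W(0)-n)^mw=0$; here $\mathbf d_W$ is the semisimple part of $L_W(0)$. The opposite vertex operator is $Y_W^o(u,x)=Y_W^L(e^{xL_V(1)}(-x^{-2})^{L_V(0)}u,x^{-1})$; for homogeneous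 $u$ this equals $\sum_{m\ge0}\frac{(-1)^{\mathrm{wt}\,u}}{m!}x^{m-2\mathrm{wt}\,u}Y_W^L(L_V(1)^mu,x^{-1})$, a finite sum. *)

(* Defs.v *)
From Stdlib Require Import Reals ZArith List Classical ClassicalEpsilon.
Import ListNotations.
Open Scope R_scope.

Definition Cplx : Type := (R * R)%type.
Definition C0 : Cplx := (0, 0).
Definition C1 : Cplx := (1, 0).
Definition RC (r : R) : Cplx := (r, 0).
Definition ZC (n : Z) : Cplx := RC (IZR n).
Definition Cre (z : Cplx) : R := fst z.
Definition Cadd (a b : Cplx) : Cplx := (fst a + fst b, snd a + snd b).
Definition Copp (a : Cplx) : Cplx := (- fst a, - snd a).
Definition Csub (a b : Cplx) : Cplx := Cadd a (Copp b).
Definition Cmul (a b : Cplx) : Cplx :=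
  (fst a * fst b - snd a * snd b, fst a * snd b + snd a * fst b).
Definition Cnorm (a : Cplx) : R := sqrt (fst a * fst a + snd a * snd a).
Definition Cinv (a : Cplx) : Cplx :=
  let d := fst a * fst a + snd a * snd a in (fst a / d, - snd a / d).
Definition Cdiv (a b : Cplx) : Cplx := Cmul a (Cinv b).
Fixpoint Cpow (z : Cplx) (n : nat) : Cplx :=
  match n with O => C1 | S m => Cmul z (Cpow z m) end.
Definition Cpowz (z : Cplx) (k : Z) : Cplx :=
  match k with
  | Z0 => C1
  | Zpos p => Cpow z (Pos.to_nat p)
  | Zneg p => Cinv (Cpow z (Pos.to_nat p))
  end.
Definition Csign (n : Z) : Cplx := if Z.even n then C1 else Copp C1.
Definition invfact (j : nat) : Cplx := RC (/ INR (fact j)).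
Definition Csum {X : Type} (l : list X) (f : X -> Cplx) : Cplx :=
  fold_right (fun x acc => Cadd (f x) acc) C0 l.

Record VSpace := {
  vcar :> Type;
  vzero : vcar;
  vadd : vcar -> vcar -> vcar;
  vscal : Cplx -> vcar -> vcar }.
Arguments vzero {_}.
Arguments vadd {_}.
Arguments vscal {_}.

Definition vsub {V : VSpace} (x y : V) : V := vadd x (vscal (Copp C1) y).
Definition vsum {V : VSpace} {X : Type} (l : list X) (f : X -> V) : V :=
  fold_right (fun x acc => vadd (f x) acc) vzero l.

Definition is_vspace (V : VSpace) : Prop :=
  (forall x y z : V, vadd x (vadd y z) = vadd (vadd x y) z) /\
  (forall x y : V, vadd x y = vadd y x) /\
  (forall x : V, vadd vzero x = x) /\
  (forall x : V, vadd x (vscal (Copp C1) x) = vzero) /\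
  (forall x : V, vscal C1 x = x) /\
  (forall (a b : Cplx) (x : V), vscal a (vscal b x) = vscal (Cmul a b) x) /\
  (forall (a : Cplx) (x y : V), vscal a (vadd x y) = vadd (vscal a x) (vscal a y)) /\
  (forall (a b : Cplx) (x : V), vscal (Cadd a b) x = vadd (vscal a x) (vscal b x)).

Definition is_lin {V W : VSpace} (f : V -> W) : Prop :=
  (forall x y, f (vadd x y) = vadd (f x) (f y)) /\
  (forall c x, f (vscal c x) = vscal c (f x)).
Definition is_linfun {V : VSpace} (f : V -> Cplx) : Prop :=
  (forall x y, f (vadd x y) = Cadd (f x) (f y)) /\
  (forall c x, f (vscal c x) = Cmul c (f x)).

(* Gradings  V = coprod_{n in I} V_n, given by the projections onto    *)
(* the V_n and, for each v, a finite list of degrees carrying v.       *)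
Record Grading (I : Type) (V : VSpace) := {
  gproj : I -> V -> V;
  gsupp : V -> list I }.
Arguments gproj {I V}.
Arguments gsupp {I V}.

Definition is_grading {I : Type} {V : VSpace} (g : Grading I V) : Prop :=
  (forall n, is_lin (gproj g n)) /\
  (forall n v, gproj g n (gproj g n v) = gproj g n v) /\
  (forall n m v, n <> m -> gproj g n (gproj g m v) = vzero) /\
  (forall v, NoDup (gsupp g v) /\ v = vsum (gsupp g v) (fun n => gproj g n v)).

Definition degop {I : Type} {V : VSpace} (emb : I -> Cplx) (g : Grading I V) (v : V) : V :=
  vsum (gsupp g v) (fun n => vscal (emb n) (gproj g n v)).

Definition gdual {I : Type} {V : VSpace} (g : Grading I V) (f : V -> Cplx) : Prop :=
  is_linfun f /\ exists S : list I, forall n v, ~ In n S -> f (gproj g n v) = C0.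

Definition abs_sum_to (n : nat) (a : list Z -> Cplx) (s : Cplx) : Prop :=
  (exists M : R, forall F : list (list Z), NoDup F ->
      Forall (fun k => length k = n) F ->
      fold_right Rplus 0 (map (fun k => Cnorm (a k)) F) <= M) /\
  (forall eps : R, eps > 0 -> exists F0 : list (list Z),
      Forall (fun k => length k = n) F0 /\
      forall F : list (list Z), NoDup F -> Forall (fun k => length k = n) F ->
        incl F0 F -> Cnorm (Csub (Csum F a) s) < eps).

Definition mpoly := list (Cplx * list nat).
Definition monom (zs : list Cplx) (es : list nat) : Cplx :=
  fold_right Cmul C1 (map (fun p => Cpow (fst p) (snd p)) (combine zs es)).
Definition peval (P : mpoly) (zs : list Cplx) : Cplx :=
  Csum P (fun p => Cmul (fst p) (monom zs (snd p))).

Fixpoint denom (N : nat) (zs : list Cplx) : Cplx :=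
  match zs with
  | [] => C1
  | z :: t => Cmul (Cpow z N)
                (Cmul (fold_right Cmul C1 (map (fun z' => Cpow (Csub z z') N) t))
                      (denom N t))
  end.

(* For zs (of length n) in [region], the series  sum_ks term zs ks
   converges absolutely to a rational function of zs whose only possible
   poles are at z_i = 0 and z_i = z_j. *)
Definition rational_series (n : nat) (region : list Cplx -> Prop)
    (term : list Cplx -> list Z -> Cplx) : Prop :=
  exists (P : mpoly) (N : nat), forall zs, length zs = n -> region zs ->
    abs_sum_to n (term zs) (Cdiv (peval P zs) (denom N zs)).

Fixpoint norm_chain (zs : list Cplx) : Prop :=
  match zs with
  | [] => True
  | [z] => Cnorm z > 0
  | z :: ((z' :: _) as t) => Cnorm z > Cnorm z' /\ norm_chain t
  end.
Definition iter_region (zs : list Cplx) : Prop :=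
  match zs with
  | [z1; z2] => Cnorm z2 > Cnorm (Csub z1 z2) /\ Cnorm (Csub z1 z2) > 0
  | _ => False
  end.
Definition assoc_region (z1 z2 : Cplx) : Prop :=
  Cnorm z1 > Cnorm z2 /\ Cnorm z2 > Cnorm (Csub z1 z2) /\ Cnorm (Csub z1 z2) > 0.

(* Vertex operators are given by their coefficients:
   Y(u,x) w = sum_{k in Z} (Y u w k) x^{-k-1}. *)
Fixpoint opprod {A W : VSpace} (Y : A -> W -> Z -> W) (us : list A) (ks : list Z)
    (w : W) : W :=
  match us, ks with
  | u :: us', k :: ks' => Y u (opprod Y us' ks' w) k
  | _, _ => w
  end.
Fixpoint zfac (zs : list Cplx) (ks : list Z) : Cplx :=
  match zs, ks with
  | z :: zs', k :: ks' => Cmul (Cpowz z (- k - 1)%Z) (zfac zs' ks')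
  | _, _ => C1
  end.
(* terms of <w', Y(u_1,z_1) ... Y(u_n,z_n) w> *)
Definition prod_term {A W : VSpace} (Y : A -> W -> Z -> W) (us : list A) (w : W)
    (f : W -> Cplx) (zs : list Cplx) (ks : list Z) : Cplx :=
  Cmul (f (opprod Y us ks w)) (zfac zs ks).
(* terms of <w', Y(YA(u_1, z_1 - z_2) u_2, z_2) w> *)
Definition iter_term {A W : VSpace} (YA : A -> A -> Z -> A) (YW : A -> W -> Z -> W)
    (u1 u2 : A) (w : W) (f : W -> Cplx) (zs : list Cplx) (ks : list Z) : Cplx :=
  match zs, ks with
  | [z1; z2], [k; m] =>
      Cmul (f (YW (YA u1 u2 k) w m))
           (Cmul (Cpowz (Csub z1 z2) (- k - 1)%Z) (Cpowz z2 (- m - 1)%Z))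
  | _, _ => C0
  end.

Definition rat_assoc {I : Type} {A W : VSpace} (YA : A -> A -> Z -> A)
    (YW : A -> W -> Z -> W) (gW : Grading I W) : Prop :=
  forall f : W -> Cplx, gdual gW f ->
    (forall (us : list A) (w : W),
        rational_series (length us) norm_chain (prod_term YW us w f)) /\
    (forall (u1 u2 : A) (w : W),
        rational_series 2 iter_region (iter_term YA YW u1 u2 w f)) /\
    (forall (u1 u2 : A) (w : W) (z1 z2 s1 s2 : Cplx), assoc_region z1 z2 ->
        abs_sum_to 2 (prod_term YW [u1; u2] w f [z1; z2]) s1 ->
        abs_sum_to 2 (iter_term YA YW u1 u2 w f [z1; z2]) s2 ->
        s1 = s2).

Definition is_bilin_op {A W : VSpace} (Y : A -> W -> Z -> W) : Prop :=
  (forall w k, is_lin (fun u => Y u w k)) /\ (forall u k, is_lin (fun w => Y u w k)).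

Record VAData := {
  va_sp : VSpace;
  va_gr : Grading Z va_sp;
  va_Y : va_sp -> va_sp -> Z -> va_sp;
  va_one : va_sp }.

Definition va_d (V : VAData) : va_sp V -> va_sp V := degop ZC (va_gr V).
(* D_V v = lim_{x->0} d/dx Y(v,x)1 = coefficient v_{-2} 1 *)
Definition va_D (V : VAData) (v : va_sp V) : va_sp V := va_Y V v (va_one V) (-2)%Z.

Definition is_MOSVA (V : VAData) : Prop :=
  let Y := va_Y V in let one := va_one V in let d := va_d V in let D := va_D V in
  is_vspace (va_sp V) /\ is_grading (va_gr V) /\ is_bilin_op Y /\
  (exists N : Z, forall n v, (n < N)%Z -> gproj (va_gr V) n v = vzero) /\
  (forall u v k, vsub (d (Y u v k)) (Y u (d v) k)
                 = vadd (vscal (ZC (- k - 1)) (Y u v k)) (Y (d u) v k)) /\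
  (forall v k, Y one v k = if Z.eq_dec k (-1) then v else vzero) /\
  (forall u k, (0 <= k)%Z -> Y u one k = vzero) /\
  (forall u, Y u one (-1)%Z = u) /\
  (forall v w k, Y (D v) w k = vscal (ZC (- k)) (Y v w (k - 1)%Z)) /\
  (forall v w k, vsub (D (Y v w k)) (Y v (D w) k) = vscal (ZC (- k)) (Y v w (k - 1)%Z)) /\
  rat_assoc Y Y (va_gr V).

Record SL2 (V : VSpace) := { Lm1 : V -> V; L0 : V -> V; L1 : V -> V }.
Arguments Lm1 {V}.
Arguments L0 {V}.
Arguments L1 {V}.

Definition is_sl2 {V : VSpace} (r : SL2 V) : Prop :=
  is_lin (Lm1 r) /\ is_lin (L0 r) /\ is_lin (L1 r) /\
  (forall v, vsub (L0 r (L1 r v)) (L1 r (L0 r v)) = vscal (Copp C1) (L1 r v)) /\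
  (forall v, vsub (L0 r (Lm1 r v)) (Lm1 r (L0 r v)) = Lm1 r v) /\
  (forall v, vsub (Lm1 r (L1 r v)) (L1 r (Lm1 r v)) = vscal (ZC (-2)) (L0 r v)).

Definition is_mobius_MOSVA (V : VAData) (r : SL2 (va_sp V)) : Prop :=
  let Y := va_Y V in
  is_MOSVA V /\ is_sl2 r /\
  (forall v, L0 r v = va_d V v) /\ (forall v, Lm1 r v = va_D V v) /\
  (forall u w k, vsub (L1 r (Y u w k)) (Y u (L1 r w) k)
     = vadd (Y (L1 r u) w k)
            (vadd (vscal (ZC 2) (Y (L0 r u) w (k + 1)%Z)) (Y (Lm1 r u) w (k + 2)%Z))).

Definition fsum {V : VSpace} (f : nat -> V) : V :=
  match excluded_middle_informative
          (exists N : nat, forall j, (N <= j)%nat -> f j = vzero) with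
  | left H => vsum (seq 0 (proj1_sig (constructive_indefinite_description _ H))) f
  | right _ => vzero
  end.

(* Y^s(u,x)v = e^{x D_V} Y(v,-x) u ; coefficient of x^{-m-1}:
   sum_{j>=0} (-1)^{m+j+1}/j! D_V^j (v_{m+j} u) *)
Definition opp_Y (V : VAData) (u v : va_sp V) (m : Z) : va_sp V :=
  fsum (fun j : nat =>
    vscal (Cmul (Csign (m + Z.of_nat j + 1)%Z) (invfact j))
          (Nat.iter j (va_D V) (va_Y V v u (m + Z.of_nat j)%Z))).

Definition opp_VA (V : VAData) : VAData :=
  {| va_sp := va_sp V; va_gr := va_gr V; va_Y := opp_Y V; va_one := va_one V |}.

Record ModData (V : VAData) := {
  m_sp : VSpace;
  m_gr : Grading Cplx m_sp;
  m_Y : va_sp V -> m_sp -> Z -> m_sp;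
  m_D : m_sp -> m_sp }.
Arguments m_sp {V}.
Arguments m_gr {V}.
Arguments m_Y {V}.
Arguments m_D {V}.

Definition m_d {V : VAData} (M : ModData V) : m_sp M -> m_sp M :=
  degop (fun z : Cplx => z) (m_gr M).

Definition is_left_module (V : VAData) (M : ModData V) : Prop :=
  let Y := m_Y M in let g := m_gr M in let d := m_d M in let D := m_D M in
  is_vspace (m_sp M) /\ is_grading g /\ is_bilin_op Y /\ is_lin D /\
  (exists N : R, forall m w, Cre m < N -> gproj g m w = vzero) /\
  (forall m w, gproj g m w = w -> gproj g (Cadd m C1) (D w) = D w) /\
  (forall u w k, vsub (d (Y u w k)) (Y u (d w) k)
                 = vadd (Y (va_d V u) w k) (vscal (ZC (- k - 1)) (Y u w k))) /\
  (forall w k, Y (va_one V) w k = if Z.eq_dec k (-1) then w else vzero) /\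
  (forall u w k, Y (va_D V u) w k = vscal (ZC (- k)) (Y u w (k - 1)%Z)) /\
  (forall u w k, vsub (D (Y u w k)) (Y u (D w) k) = vscal (ZC (- k)) (Y u w (k - 1)%Z)) /\
  rat_assoc (va_Y V) Y g.

Definition grading_restricted {V : VAData} (M : ModData V) : Prop :=
  forall m : Cplx, exists bs : list (m_sp M), forall w, gproj (m_gr M) m w = w ->
    exists cs : list Cplx, length cs = length bs /\
      w = vsum (combine cs bs) (fun p => vscal (fst p) (snd p)).

Definition is_mobius_module (V : VAData) (rV : SL2 (va_sp V)) (M : ModData V)
    (rW : SL2 (m_sp M)) : Prop :=
  let Y := m_Y M in
  is_left_module V M /\ is_sl2 rW /\ (forall w, Lm1 rW w = m_D M w) /\
  (forall u w k, vsub (L0 rW (Y u w k)) (Y u (L0 rW w) k)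
     = vadd (Y (L0 rV u) w k) (Y (Lm1 rV u) w (k + 1)%Z)) /\
  (forall u w k, vsub (L1 rW (Y u w k)) (Y u (L1 rW w) k)
     = vadd (Y (L1 rV u) w k)
            (vadd (vscal (ZC 2) (Y (L0 rV u) w (k + 1)%Z)) (Y (Lm1 rV u) w (k + 2)%Z))) /\
  (forall (n : Cplx) w, gproj (m_gr M) n w = w ->
     exists m : nat, Nat.iter m (fun x => vsub (L0 rW x) (vscal n x)) w = vzero) /\
  (* d_W is the semisimple part of L_W(0) *)
  (forall w, L0 rW (m_d M w) = m_d M (L0 rW w)) /\
  (forall w, exists m : nat, Nat.iter m (fun x => vsub (L0 rW x) (m_d M x)) w = vzero).

(* opposite vertex operator Y^o(u,x) = Y_W^L(e^{x L_V(1)} (-x^{-2})^{L_V(0)} u, x^{-1});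
   coefficient of x^{-p-1}:
   sum_{n in supp u} sum_{m>=0} (-1)^n/m! (L_V(1)^m u_n)_{2n-p-m-2} w *)
Definition Yo (V : VAData) (rV : SL2 (va_sp V)) (M : ModData V)
    (u : va_sp V) (w : m_sp M) (p : Z) : m_sp M :=
  vsum (gsupp (va_gr V) u) (fun n : Z =>
    fsum (fun m : nat =>
      vscal (Cmul (Csign n) (invfact m))
            (m_Y M (Nat.iter m (L1 rV) (gproj (va_gr V) n u)) w
                 (2 * n - p - Z.of_nat m - 2)%Z))).

(* Main.v *)
(** Everything on [W'] is computed in [W] by transposing [Y^o].  The degree, vacuum and
    sl(2) axioms reduce to commutators of [L(j)] with the modes of [Y^o].

    A product of [Y'] at [z_1, ..., z_n] is a finite combination of monomials in the [z_i]
    and products of [Y_W] at [1/z_n, ..., 1/z_1]; inversion exchanges the regions of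
    convergence and preserves the allowed poles.

    For the iterate, put [x_0 = z_1 - z_2].  Conjugating [Y_V] by [e^{z_1 L(1)}] gives formally
    [Y^o(Y^s(u_1, x_0) u_2, z_2) = Y_W(Y_V(v_2, 1/z_2 - 1/z_1) v_1, 1/z_1)] with
    [v_i = e^{z_i L(1)} (-z_i^{-2})^{L(0)} u_i], where [z_1 = z_2 + x_0] is expanded in powers of
    [x_0].  For homogeneous data both sides are single Laurent series in [x_0 / z_2] and differ
    by the factor [(1 + x_0/z_2)^Q] for an integer [Q] and a monomial, so convergence,
    rationality and associativity for [Y'] follow from those for [Y_W] at [(1/z_2, 1/z_1)].
    Grading-restrictedness makes every functional in the double dual an evaluation at a
    vector of [W], and makes [L(0) - n] nilpotent on [W_[n]]. *)

From Stdlib Require Import Reals ZArith List Classical ClassicalEpsilon.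
From Stdlib Require Import Lra Lia Ring Field FunctionalExtensionality.
From Stdlib Require Import Sorting.Sorted Permutation.
Require Import Defs.
Import ListNotations.
Open Scope R_scope.

(** * Complex numbers and finite sums *)

(** The obstacle is that the identity for the iterate is formal: expanding powers of z_1 = z_2 + x_0
    rearranges a double series, while absolute convergence is demanded of the rearranged one.
    Homogeneity removes the difficulty. Against a functional concentrated in one degree, the modes
    k, m of an iterate contribute only on one line k + m = const with k bounded above, so only power
    series in y = x_0/z_2 have to be handled, and |z_2| > |x_0| is exactly |y| < 1. Two binomial
    expansions overlap in Y^o(Y^s(u_1, x_0) u_2, z_2): one comes from e^{x_0 D} in Y^s, the other
    from moving e^{z L(1)} past Y_V. A Vandermonde identity merges them, and the merged exponent
    depends on k and m through k + m alone. Being constant on the line, it becomes the single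
    exponent Q. The degrees of W are complex, yet Q is an integer: a matrix coefficient between two
    degrees that do not differ by an integer vanishes identically. *)

Lemma Cplx_ext (a b : Cplx) : fst a = fst b -> snd a = snd b -> a = b.
Proof. destruct a, b; simpl; intros; subst; reflexivity. Qed.

Lemma sum_sq_neq0 (a : Cplx) : a <> C0 -> fst a * fst a + snd a * snd a <> 0.
Proof.
  intros H E. apply H. destruct a as [x y]; simpl in E.
  assert (x = 0) by nra. assert (y = 0) by nra. subst; reflexivity.
Qed.

Lemma Cplx_field : field_theory C0 C1 Cadd Cmul Csub Copp Cdiv Cinv (@eq Cplx).
Proof.
  split; [split| | |].
  all: try (intros; apply Cplx_ext; simpl; unfold Cdiv, Cmul; simpl; ring).
  - intros E. injection E. lra.
  - intros p Hp. apply sum_sq_neq0 in Hp.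
    apply Cplx_ext; simpl; field; exact Hp.
Qed.
Add Field Cplx_Field : Cplx_field.

Lemma C1_neq_C0 : C1 <> C0.
Proof. intros E. injection E. lra. Qed.

Lemma Cmul_neq0 (a b : Cplx) : a <> C0 -> b <> C0 -> Cmul a b <> C0.
Proof.
  intros Ha Hb E. apply Hb.
  transitivity (Cmul (Cinv a) (Cmul a b)); [field; auto|].
  rewrite E; ring.
Qed.

Lemma Csub_neq0 (a b : Cplx) : a <> b -> Csub a b <> C0.
Proof.
  intros H E. apply H. transitivity (Cadd (Csub a b) b); [ring|rewrite E; ring].
Qed.

Lemma Cinv_neq0 (a : Cplx) : a <> C0 -> Cinv a <> C0.
Proof.
  intros Ha E. apply C1_neq_C0.
  transitivity (Cmul a (Cinv a)); [field; auto|rewrite E; ring].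
Qed.

Lemma Cinv_inj (a b : Cplx) : a <> C0 -> b <> C0 -> Cinv a = Cinv b -> a = b.
Proof.
  intros Ha Hb E.
  transitivity (Cmul (Cmul a (Cinv b)) b); [field; auto|].
  rewrite <- E. field; auto.
Qed.

Lemma Cnorm_ge0 a : 0 <= Cnorm a.
Proof. apply sqrt_pos. Qed.

Lemma Cnorm_sq a : Cnorm a * Cnorm a = fst a * fst a + snd a * snd a.
Proof. apply sqrt_sqrt. nra. Qed.

Lemma Cnorm_C0 : Cnorm C0 = 0.
Proof. unfold Cnorm; simpl. replace (0*0+0*0) with 0 by ring. apply sqrt_0. Qed.

Lemma Cnorm_C1 : Cnorm C1 = 1.
Proof. unfold Cnorm; simpl. replace (1*1+0*0) with 1 by ring. apply sqrt_1. Qed.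

Lemma Cnorm_gt0 a : a <> C0 -> 0 < Cnorm a.
Proof.
  intros H. apply sqrt_lt_R0. assert (E := sum_sq_neq0 a H). nra.
Qed.

Lemma Cnorm_gt0_neq a : 0 < Cnorm a -> a <> C0.
Proof. intros H E. subst. rewrite Cnorm_C0 in H. lra. Qed.

Lemma Cnorm_mul a b : Cnorm (Cmul a b) = Cnorm a * Cnorm b.
Proof. unfold Cnorm. rewrite <- sqrt_mult_alt by nra. f_equal. simpl. ring. Qed.

Lemma Cnorm_opp a : Cnorm (Copp a) = Cnorm a.
Proof. unfold Cnorm. f_equal. simpl. ring. Qed.

Lemma Cnorm_sub_sym a b : Cnorm (Csub a b) = Cnorm (Csub b a).
Proof. rewrite <- Cnorm_opp. f_equal. ring. Qed.

Lemma Cnorm_triang a b : Cnorm (Cadd a b) <= Cnorm a + Cnorm b.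
Proof.
  assert (Ha := Cnorm_sq a). assert (Hb := Cnorm_sq b). assert (Hc := Cnorm_sq (Cadd a b)).
  assert (Pa := Cnorm_ge0 a). assert (Pb := Cnorm_ge0 b). assert (Pc := Cnorm_ge0 (Cadd a b)).
  simpl in Hc.
  (* Cauchy-Schwarz, by Lagrange's identity: the squares of the two sides differ by the square of
     the determinant of [a] and [b]. *)
  assert (fst a * fst b + snd a * snd b <= Cnorm a * Cnorm b).
  { apply Rsqr_incr_0_var; [|nra]. unfold Rsqr.
    replace (Cnorm a * Cnorm b * (Cnorm a * Cnorm b))
      with ((Cnorm a * Cnorm a) * (Cnorm b * Cnorm b)) by ring.
    rewrite Ha, Hb. apply Rminus_le.
    replace (_ - _) with (- ((fst a * snd b - snd a * fst b) * (fst a * snd b - snd a * fst b)))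
      by ring.
    assert (H := Rle_0_sqr (fst a * snd b - snd a * fst b)). unfold Rsqr in H. lra. }
  apply Rsqr_incr_0_var; [unfold Rsqr; nra|lra].
Qed.

Lemma Cnorm_inv a : a <> C0 -> Cnorm (Cinv a) = / Cnorm a.
Proof.
  intros Ha. assert (H := Cnorm_gt0 a Ha).
  apply (Rmult_eq_reg_l (Cnorm a)); [|lra].
  rewrite <- Cnorm_mul, Rinv_r by lra.
  rewrite <- Cnorm_C1. f_equal. field; auto.
Qed.

Lemma Cnorm_fst a : Rabs (fst a) <= Cnorm a.
Proof.
  rewrite <- (sqrt_Rsqr_abs (fst a)). apply sqrt_le_1_alt. unfold Rsqr. nra.
Qed.

Lemma Cnorm_snd a : Rabs (snd a) <= Cnorm a.
Proof.
  rewrite <- (sqrt_Rsqr_abs (snd a)). apply sqrt_le_1_alt. unfold Rsqr. nra.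
Qed.

(** * Integer powers *)

Lemma Cpow_add z m n : Cpow z (m + n) = Cmul (Cpow z m) (Cpow z n).
Proof. induction m; simpl; [|rewrite IHm]; ring. Qed.

Lemma Cpow_neq0 z n : z <> C0 -> Cpow z n <> C0.
Proof. intros H; induction n; simpl; [apply C1_neq_C0|apply Cmul_neq0; auto]. Qed.

Ltac cfield := field; repeat split;
  repeat first [assumption | exact C1_neq_C0 | apply Cpow_neq0 | apply Cinv_neq0
               | apply Cmul_neq0].

Lemma Cpow_mul a b n : Cpow (Cmul a b) n = Cmul (Cpow a n) (Cpow b n).
Proof. induction n; simpl; [|rewrite IHn]; ring. Qed.

Lemma Cpow_inv a n : a <> C0 -> Cpow (Cinv a) n = Cinv (Cpow a n).
Proof.
  intros Ha; induction n; simpl; [field; apply C1_neq_C0|].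
  rewrite IHn. field. split; auto. apply Cpow_neq0; auto.
Qed.

Lemma Cpowz_nat z n : Cpowz z (Z.of_nat n) = Cpow z n.
Proof. destruct n; auto. cbn [Z.of_nat Cpowz]. rewrite SuccNat2Pos.id_succ. reflexivity. Qed.

Lemma Cpowz_negnat z n : Cpowz z (- Z.of_nat n) = Cinv (Cpow z n).
Proof.
  destruct n; [simpl; field; apply C1_neq_C0|].
  cbn [Z.of_nat Z.opp Cpowz]. rewrite SuccNat2Pos.id_succ. reflexivity.
Qed.

(** An integer exponent written as a difference of two naturals reduces the laws of [Cpowz] to those
    of [Cpow], without cases on signs. *)
Lemma Cpowz_diff z m n : z <> C0 ->
  Cpowz z (Z.of_nat m - Z.of_nat n) = Cmul (Cpow z m) (Cinv (Cpow z n)).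
Proof.
  intros Hz. destruct (Nat.le_ge_cases n m) as [H|H].
  - replace (Z.of_nat m - Z.of_nat n)%Z with (Z.of_nat (m - n)) by lia.
    rewrite Cpowz_nat. replace m with (m - n + n)%nat at 2 by lia.
    rewrite Cpow_add. field. apply Cpow_neq0; auto.
  - replace (Z.of_nat m - Z.of_nat n)%Z with (- Z.of_nat (n - m))%Z by lia.
    rewrite Cpowz_negnat. replace n with (n - m + m)%nat at 2 by lia.
    rewrite Cpow_add. field. split; apply Cpow_neq0; auto.
Qed.

Lemma Z_diff_nat (a : Z) : exists m n, a = (Z.of_nat m - Z.of_nat n)%Z.
Proof. exists (Z.to_nat a), (Z.to_nat (- a)). lia. Qed.

Lemma Cpowz_add z a b : z <> C0 -> Cpowz z (a + b) = Cmul (Cpowz z a) (Cpowz z b).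
Proof.
  intros Hz. destruct (Z_diff_nat a) as (m & n & ->), (Z_diff_nat b) as (p & q & ->).
  replace (Z.of_nat m - Z.of_nat n + (Z.of_nat p - Z.of_nat q))%Z
    with (Z.of_nat (m + p) - Z.of_nat (n + q))%Z by lia.
  rewrite !Cpowz_diff by auto. rewrite !Cpow_add. field.
  split; apply Cpow_neq0; auto.
Qed.

Lemma Cpowz_neq0 z a : z <> C0 -> Cpowz z a <> C0.
Proof.
  intros Hz. destruct (Z_diff_nat a) as (m & n & ->). rewrite Cpowz_diff by auto.
  apply Cmul_neq0; [|apply Cinv_neq0]; apply Cpow_neq0; auto.
Qed.

Lemma Cpowz_opp z a : z <> C0 -> Cpowz z (- a) = Cinv (Cpowz z a).
Proof.
  intros Hz. assert (H := Cpowz_add z a (- a) Hz).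
  rewrite Z.add_opp_diag_r in H. simpl in H.
  transitivity (Cmul (Cinv (Cpowz z a)) (Cmul (Cpowz z a) (Cpowz z (- a)))).
  - field. apply Cpowz_neq0; auto.
  - rewrite <- H. field. apply Cpowz_neq0; auto.
Qed.

Lemma Cpowz_mul x y a : x <> C0 -> y <> C0 ->
  Cpowz (Cmul x y) a = Cmul (Cpowz x a) (Cpowz y a).
Proof.
  intros Hx Hy. assert (Hxy := Cmul_neq0 x y Hx Hy).
  destruct (Z_diff_nat a) as (m & n & ->). rewrite !Cpowz_diff by auto.
  rewrite !Cpow_mul. field. split; apply Cpow_neq0; auto.
Qed.

Lemma Cpowz_inv x a : x <> C0 -> Cpowz (Cinv x) a = Cpowz x (- a).
Proof.
  intros Hx. assert (Hx' := Cinv_neq0 x Hx). rewrite Cpowz_opp by auto.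
  destruct (Z_diff_nat a) as (m & n & ->). rewrite !Cpowz_diff by auto.
  rewrite !Cpow_inv by auto. cfield.
Qed.

Lemma Cpowz_succ z a : z <> C0 -> Cpowz z (a + 1) = Cmul (Cpowz z a) z.
Proof. intros H; rewrite Cpowz_add by auto. simpl. ring. Qed.

Lemma RC_add a b : RC (a + b) = Cadd (RC a) (RC b).
Proof. apply Cplx_ext; simpl; ring. Qed.
Lemma RC_mul a b : RC (a * b) = Cmul (RC a) (RC b).
Proof. apply Cplx_ext; simpl; ring. Qed.
Lemma ZC_add a b : ZC (a + b) = Cadd (ZC a) (ZC b).
Proof. unfold ZC. rewrite plus_IZR. apply RC_add. Qed.
Lemma ZC_mul a b : ZC (a * b) = Cmul (ZC a) (ZC b).
Proof. unfold ZC. rewrite mult_IZR. apply RC_mul. Qed.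
Lemma ZC_opp a : ZC (- a) = Copp (ZC a).
Proof. unfold ZC. rewrite opp_IZR. apply Cplx_ext; simpl; ring. Qed.
Lemma ZC_sub a b : ZC (a - b) = Csub (ZC a) (ZC b).
Proof. unfold Z.sub. rewrite ZC_add, ZC_opp. ring. Qed.
Lemma ZC_0 : ZC 0 = C0. Proof. reflexivity. Qed.
Lemma ZC_1 : ZC 1 = C1. Proof. reflexivity. Qed.
Lemma ZC_inj a b : ZC a = ZC b -> a = b.
Proof. intros E. injection E. apply eq_IZR. Qed.
Lemma ZC_neq0 a : a <> 0%Z -> ZC a <> C0.
Proof. intros H E. apply H, ZC_inj. rewrite E; reflexivity. Qed.

Lemma Csign_succ a : Csign (a + 1) = Copp (Csign a).
Proof. unfold Csign. rewrite Z.even_add. destruct (Z.even a); simpl; ring. Qed.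

Lemma Csign_pred a : Csign (a - 1) = Copp (Csign a).
Proof.
  assert (H := Csign_succ (a - 1)). replace (a - 1 + 1)%Z with a in H by ring.
  rewrite H; ring.
Qed.

Lemma Csign_add a b : Csign (a + b) = Cmul (Csign a) (Csign b).
Proof. unfold Csign. rewrite Z.even_add. destruct (Z.even a), (Z.even b); simpl; ring. Qed.

Lemma invfact_0 : invfact 0 = C1.
Proof. apply Cplx_ext; simpl; field. Qed.

Lemma invfact_S j : Cmul (ZC (Z.of_nat j + 1)) (invfact (S j)) = invfact j.
Proof.
  unfold invfact, ZC. rewrite <- RC_mul. f_equal.
  change (fact (S j)) with (S j * fact j)%nat. rewrite mult_INR.
  replace (IZR (Z.of_nat j + 1)) with (INR (S j))
    by (rewrite INR_IZR_INZ; f_equal; lia).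
  field. split; [apply INR_fact_neq_0|apply not_0_INR; lia].
Qed.

(** * Finite sums *)

Section Csums.
Context {X : Type}.
Implicit Types (l : list X) (f g : X -> Cplx).

Lemma Csum_ext l f g : (forall x, In x l -> f x = g x) -> Csum l f = Csum l g.
Proof.
  induction l as [|x l IH]; simpl; intros H; auto. rewrite H, IH by auto. reflexivity.
Qed.

Lemma Csum_0 l f : (forall x, In x l -> f x = C0) -> Csum l f = C0.
Proof.
  induction l as [|x l IH]; simpl; intros H; auto. rewrite H, IH by auto. ring.
Qed.

Lemma Csum_add l f g : Csum l (fun x => Cadd (f x) (g x)) = Cadd (Csum l f) (Csum l g).
Proof. induction l; simpl; [|rewrite IHl]; ring. Qed.

Lemma Csum_scal l c f : Csum l (fun x => Cmul c (f x)) = Cmul c (Csum l f).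
Proof. induction l; simpl; [|rewrite IHl]; ring. Qed.

Lemma Csum_opp l f : Csum l (fun x => Copp (f x)) = Copp (Csum l f).
Proof. induction l; simpl; [|rewrite IHl]; ring. Qed.

Lemma Csum_app l1 l2 f : Csum (l1 ++ l2) f = Cadd (Csum l1 f) (Csum l2 f).
Proof. induction l1; simpl; [|rewrite IHl1]; ring. Qed.

Lemma Csum_perm l1 l2 f : Permutation l1 l2 -> Csum l1 f = Csum l2 f.
Proof. induction 1; simpl; try congruence. ring. Qed.

Lemma Csum_map {Y} (l : list Y) (h : Y -> X) f :
  Csum (map h l) f = Csum l (fun y => f (h y)).
Proof. induction l; simpl; congruence. Qed.

Lemma Csum_swap {Y} l (m : list Y) (f : X -> Y -> Cplx) :
  Csum l (fun x => Csum m (f x)) = Csum m (fun y => Csum l (fun x => f x y)).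
Proof.
  induction l; simpl; [induction m; simpl; [|rewrite <- IHm]; ring|].
  rewrite IHl. clear. induction m; simpl; [|rewrite <- IHm]; ring.
Qed.

Lemma Csum_filter l f (b : X -> bool) :
  (forall x, In x l -> b x = false -> f x = C0) -> Csum (filter b l) f = Csum l f.
Proof.
  induction l as [|x l IH]; simpl; intros H; auto.
  destruct (b x) eqn:E; simpl; rewrite IH by auto; auto.
  rewrite (H x) by auto. ring.
Qed.

End Csums.

Lemma Csum_prod {X Y} (l : list X) (m : list Y) (f : X * Y -> Cplx) :
  Csum (list_prod l m) f = Csum l (fun x => Csum m (fun y => f (x, y))).
Proof.
  induction l; simpl; auto. rewrite Csum_app, Csum_map, IHl. reflexivity.
Qed.

Lemma Csum_seq_S n (f : nat -> Cplx) : Csum (seq 0 (S n)) f = Cadd (Csum (seq 0 n) f) (f n).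
Proof. rewrite seq_S, Csum_app. simpl. ring. Qed.

Lemma Csum_seq_front n (f : nat -> Cplx) :
  Csum (seq 0 (S n)) f = Cadd (f 0%nat) (Csum (seq 0 n) (fun j => f (S j))).
Proof. cbn [seq Csum fold_right]. rewrite <- seq_shift. fold (Csum (map S (seq 0 n)) f).
  rewrite Csum_map. reflexivity. Qed.

Lemma Csum_seq_app m n (f : nat -> Cplx) :
  Csum (seq 0 (m + n)) f
  = Cadd (Csum (seq 0 m) f) (Csum (seq 0 n) (fun j => f (m + j)%nat)).
Proof.
  induction n; [rewrite Nat.add_0_r; simpl; ring|].
  rewrite Nat.add_succ_r, !Csum_seq_S, IHn. ring.
Qed.

(** The triangle j + q < n is summed along its antidiagonals r = j + q; this turns the product of
    two truncated expansions into convolutions. *)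
Lemma Csum_seq_triangle n (f : nat -> nat -> Cplx) :
  Csum (seq 0 n) (fun j => Csum (seq 0 (n - j)) (f j))
  = Csum (seq 0 n) (fun r => Csum (seq 0 (S r)) (fun j => f j (r - j)%nat)).
Proof.
  induction n; auto.
  rewrite (Csum_seq_S n (fun r => Csum (seq 0 (S r)) (fun j => f j (r - j)%nat))).
  rewrite <- IHn. clear IHn.
  rewrite Csum_seq_S. rewrite (Csum_seq_S n (fun j => f j (n - j)%nat)).
  replace (S n - n)%nat with 1%nat by lia. rewrite Nat.sub_diag.
  rewrite (Csum_ext (seq 0 n) _ (fun j => Cadd (Csum (seq 0 (n - j)) (f j)) (f j (n - j)%nat))).
  - rewrite Csum_add. simpl. ring.
  - intros j Hj. apply in_seq in Hj. replace (S n - j)%nat with (S (n - j)) by lia.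
    apply Csum_seq_S.
Qed.

(** Both ranges contain the whole support 0 <= z < n of [G]. It serves to replace the exponent m of
    [L(1)] by the excess m - c over what two vectors have already received. *)
Lemma Csum_seq_shift (c n M : nat) (G : Z -> Cplx) :
  (c + n <= M)%nat ->
  (forall z, (z < 0 \/ Z.of_nat n <= z)%Z -> G z = C0) ->
  Csum (seq 0 M) (fun m => G (Z.of_nat m - Z.of_nat c)%Z)
  = Csum (seq 0 n) (fun q => G (Z.of_nat q)).
Proof.
  intros HM HG. replace M with (c + (n + (M - c - n)))%nat by lia.
  rewrite Csum_seq_app, Csum_0.
  2:{ intros x Hx. apply in_seq in Hx. apply HG. lia. }
  rewrite Csum_seq_app.
  rewrite (Csum_0 (seq 0 (M - c - n))).
  2:{ intros x Hx. apply HG. lia. }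
  rewrite (Csum_ext (seq 0 n) _ (fun q => G (Z.of_nat q))); [ring|].
  intros x _. f_equal. lia.
Qed.

(** * Unordered summation *)

Definition eq_dec_classic {X : Type} (x y : X) : {x = y} + {x <> y} :=
  excluded_middle_informative (x = y).

Definition pbool {X : Type} (P : X -> Prop) (x : X) : bool :=
  if excluded_middle_informative (P x) then true else false.

Lemma pbool_true {X} (P : X -> Prop) x : pbool P x = true <-> P x.
Proof. unfold pbool. destruct excluded_middle_informative; split; congruence || tauto. Qed.

Lemma pbool_false {X} (P : X -> Prop) x : pbool P x = false <-> ~ P x.
Proof. unfold pbool. destruct excluded_middle_informative; split; congruence || tauto. Qed.

Lemma incl_Permutation {X} (F0 F : list X) :
  NoDup F0 -> incl F0 F -> exists G, Permutation F (F0 ++ G).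
Proof.
  revert F; induction F0 as [|x F0 IH]; intros F H I; [exists F; reflexivity|].
  inversion_clear H as [|? ? Hx Hn].
  destruct (in_split x F (I x (or_introl eq_refl))) as (l1 & l2 & ->).
  destruct (IH (l1 ++ l2)) as [G HG]; auto.
  - intros y Hy. assert (In y (l1 ++ x :: l2)) by (apply I; right; auto).
    apply in_app_iff in H. apply in_app_iff. destruct H as [|[|]]; auto. subst; contradiction.
  - exists G. simpl. rewrite <- HG. symmetry; apply Permutation_middle.
Qed.

Definition Rsum {X : Type} (F : list X) (r : X -> R) : R := fold_right Rplus 0 (map r F).

Section Rsums.
Context {X : Type}.
Implicit Types (F : list X) (r : X -> R).

Lemma Rsum_app F G r : Rsum (F ++ G) r = Rsum F r + Rsum G r.
Proof. unfold Rsum. induction F; simpl; [|rewrite IHF]; ring. Qed.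

Lemma Rsum_perm F G r : Permutation F G -> Rsum F r = Rsum G r.
Proof. unfold Rsum. induction 1; simpl; lra. Qed.

Lemma Rsum_le F r r' : (forall x, In x F -> r x <= r' x) -> Rsum F r <= Rsum F r'.
Proof.
  unfold Rsum. induction F as [|x F IH]; simpl; intros H; [lra|].
  assert (r x <= r' x) by auto. assert (fold_right Rplus 0 (map r F) <= fold_right Rplus 0 (map r' F)); auto.
  lra.
Qed.

Lemma Rsum_add F r r' : Rsum F (fun x => r x + r' x) = Rsum F r + Rsum F r'.
Proof. unfold Rsum. induction F; simpl; [|rewrite IHF]; ring. Qed.

Lemma Rsum_scal F c r : Rsum F (fun x => c * r x) = c * Rsum F r.
Proof. unfold Rsum. induction F; simpl; [|rewrite IHF]; ring. Qed.

Lemma Rsum_ge0 F r : (forall x, In x F -> 0 <= r x) -> 0 <= Rsum F r.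
Proof.
  intros H. replace 0 with (Rsum F (fun _ => 0)); [apply Rsum_le; auto|].
  unfold Rsum. clear; induction F; simpl; lra.
Qed.

Lemma Rsum_incl F0 F r : NoDup F0 -> incl F0 F -> (forall x, In x F -> 0 <= r x) ->
  Rsum F0 r <= Rsum F r.
Proof.
  intros H I Hr. destruct (incl_Permutation F0 F H I) as [G HG].
  rewrite (Rsum_perm _ _ _ HG), Rsum_app.
  assert (0 <= Rsum G r); [|lra].
  apply Rsum_ge0. intros x Hx. apply Hr.
  apply (Permutation_in x (Permutation_sym HG)). apply in_app_iff; auto.
Qed.

Lemma Csum_RC F r : Csum F (fun x => RC (r x)) = RC (Rsum F r).
Proof. unfold Rsum. induction F; simpl; [reflexivity|rewrite RC_add]. f_equal; auto. Qed.

Lemma Rsum_map {Y} (l : list Y) (h : Y -> X) r : Rsum (map h l) r = Rsum l (fun y => r (h y)).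
Proof. unfold Rsum. rewrite map_map. reflexivity. Qed.

End Rsums.

(** The predicate [P] carves the index set out of [X], so that series over integer lists of fixed
    length can be compared with series over [nat] by restriction, extension by zero and
    bijection. *)
Definition asum {X : Type} (P : X -> Prop) (a : X -> Cplx) (s : Cplx) : Prop :=
  (exists M : R, forall F : list X, NoDup F -> Forall P F ->
      Rsum F (fun k => Cnorm (a k)) <= M) /\
  (forall eps : R, eps > 0 -> exists F0 : list X, Forall P F0 /\
      forall F : list X, NoDup F -> Forall P F -> incl F0 F ->
        Cnorm (Csub (Csum F a) s) < eps).

Lemma abs_sum_to_asum n a s :
  abs_sum_to n a s <-> asum (fun k => length k = n) a s.
Proof. reflexivity. Qed.

Section Asum.
Context {X : Type}.
Implicit Types (P : X -> Prop) (a b : X -> Cplx) (s t : Cplx).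

Lemma asum_ext P a b s : (forall x, P x -> a x = b x) -> asum P a s -> asum P b s.
Proof.
  intros E [[M HM] H]. split.
  - exists M. intros F N A. rewrite Forall_forall in A.
    eapply Rle_trans; [|apply (HM F N)]; [|rewrite Forall_forall; auto].
    apply Rsum_le. intros x Hx. rewrite E by auto. lra.
  - intros eps He. destruct (H eps He) as (F0 & A0 & HF). exists F0; split; auto.
    intros F N A I. assert (A' := A). rewrite Forall_forall in A'.
    rewrite <- (Csum_ext F a b) by auto. auto.
Qed.

Lemma Forall_nodup_app P (F G : list X) :
  Forall P F -> Forall P G -> Forall P (nodup eq_dec_classic (F ++ G)).
Proof.
  intros A B. rewrite Forall_forall in *. intros x Hx.
  apply nodup_In, in_app_iff in Hx. destruct Hx; auto.
Qed.

Lemma asum_unique P a s t : asum P a s -> asum P a t -> s = t.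
Proof.
  intros [_ H1] [_ H2]. apply NNPP; intros N.
  assert (D := Cnorm_gt0 _ (Csub_neq0 s t N)).
  set (d := Cnorm (Csub s t)) in *.
  destruct (H1 (d / 2)) as (F1 & A1 & B1); [lra|].
  destruct (H2 (d / 2)) as (F2 & A2 & B2); [lra|].
  set (F := nodup eq_dec_classic (F1 ++ F2)).
  assert (NF : NoDup F) by apply NoDup_nodup.
  assert (PF : Forall P F) by (apply Forall_nodup_app; auto).
  assert (I1 : incl F1 F) by (intros x Hx; apply nodup_In, in_app_iff; auto).
  assert (I2 : incl F2 F) by (intros x Hx; apply nodup_In, in_app_iff; auto).
  specialize (B1 F NF PF I1). specialize (B2 F NF PF I2).
  assert (T := Cnorm_triang (Csub s (Csum F a)) (Csub (Csum F a) t)).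
  rewrite (Cnorm_sub_sym s) in T.
  replace (Cadd (Csub s (Csum F a)) (Csub (Csum F a) t)) with (Csub s t) in T by ring.
  fold d in T. lra.
Qed.

Lemma asum_0 P : asum P (fun _ => C0) C0.
Proof.
  assert (Z : Cnorm (Csub C0 C0) = 0) by (replace (Csub C0 C0) with C0 by ring; apply Cnorm_C0).
  split.
  - exists 0. intros F _ _. unfold Rsum. rewrite Cnorm_C0.
    clear Z; induction F; simpl; lra.
  - intros eps He. exists []. split; [constructor|]. intros F _ _ _.
    rewrite Csum_0, Z by auto. lra.
Qed.

Lemma asum_add P a b s t :
  asum P a s -> asum P b t -> asum P (fun x => Cadd (a x) (b x)) (Cadd s t).
Proof.
  intros [[M HM] H] [[M' HM'] H']. split.
  - exists (M + M'). intros F N A. specialize (HM F N A). specialize (HM' F N A).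
    eapply Rle_trans; [apply Rsum_le; intros; apply Cnorm_triang|].
    rewrite Rsum_add. lra.
  - intros eps He.
    destruct (H (eps / 2)) as (F1 & A1 & B1); [lra|].
    destruct (H' (eps / 2)) as (F2 & A2 & B2); [lra|].
    exists (F1 ++ F2). split; [apply Forall_app; auto|].
    intros F N A I. specialize (B1 F N A). specialize (B2 F N A).
    rewrite Csum_add.
    replace (Csub _ _) with (Cadd (Csub (Csum F a) s) (Csub (Csum F b) t)) by ring.
    eapply Rle_lt_trans; [apply Cnorm_triang|].
    assert (Cnorm (Csub (Csum F a) s) < eps / 2)
      by (apply B1; intros x Hx; apply I, in_app_iff; auto).
    assert (Cnorm (Csub (Csum F b) t) < eps / 2)
      by (apply B2; intros x Hx; apply I, in_app_iff; auto).
    lra.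
Qed.

Lemma asum_scal P c a s : asum P a s -> asum P (fun x => Cmul c (a x)) (Cmul c s).
Proof.
  intros [[M HM] H]. assert (Pc := Cnorm_ge0 c). split.
  - exists (Cnorm c * M). intros F N A. specialize (HM F N A).
    apply Rle_trans with (Cnorm c * Rsum F (fun k => Cnorm (a k))); [|nra].
    rewrite <- Rsum_scal. apply Rsum_le. intros. rewrite Cnorm_mul. lra.
  - intros eps He.
    assert (0 < / (Cnorm c + 1)) by (apply Rinv_0_lt_compat; lra).
    destruct (H (eps * / (Cnorm c + 1))) as (F0 & A0 & B0); [nra|].
    exists F0. split; auto. intros F N A I. specialize (B0 F N A I).
    rewrite Csum_scal.
    replace (Csub _ _) with (Cmul c (Csub (Csum F a) s)) by ring.
    rewrite Cnorm_mul. assert (Pd := Cnorm_ge0 (Csub (Csum F a) s)).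
    apply Rle_lt_trans with ((Cnorm c) * (eps * / (Cnorm c + 1))); [nra|].
    apply Rlt_le_trans with ((Cnorm c + 1) * (eps * / (Cnorm c + 1))); [nra|].
    right. field. lra.
Qed.

Lemma asum_restrict P P' a s :
  (forall x, P' x -> P x) -> (forall x, P x -> ~ P' x -> a x = C0) ->
  asum P a s -> asum P' a s.
Proof.
  intros S Z [[M HM] H]. split.
  - exists M. intros F N A. apply HM; auto. eapply Forall_impl; eauto.
  - intros eps He. destruct (H eps He) as (F0 & A0 & B0).
    exists (filter (pbool P') F0). split.
    { apply Forall_forall. intros x Hx. apply filter_In in Hx. apply pbool_true, Hx. }
    intros F N A I.
    (* [G] is the part of [F0] missing from [F]. It lies outside [P'], where [a] vanishes, so
       [F ++ G] has the same sum as [F] while containing [F0]. *)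
    set (G := filter (fun x => negb (pbool (fun y => In y F) x)) (nodup eq_dec_classic F0)).
    assert (HG : forall x, In x G -> In x F0 /\ ~ In x F).
    { intros x Hx. apply filter_In in Hx as [Hx Hb]. apply nodup_In in Hx. split; auto.
      apply Bool.negb_true_iff, pbool_false in Hb; auto. }
    rewrite Forall_forall in A, A0.
    replace (Csum F a) with (Csum (F ++ G) a).
    + apply B0.
      * apply NoDup_app; auto; [apply NoDup_filter, NoDup_nodup|].
        intros x Hx Hg. apply HG in Hg. tauto.
      * apply Forall_forall. intros x Hx. apply in_app_iff in Hx as [Hx|Hx]; auto.
        apply A0, HG, Hx.
      * intros x Hx. apply in_app_iff. destruct (classic (In x F)); auto. right.
        apply filter_In. split; [apply nodup_In; auto|].
        apply Bool.negb_true_iff, pbool_false; auto.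
    + rewrite Csum_app, (Csum_0 G); [ring|]. intros x Hx. apply HG in Hx as [Hx Hn].
      apply Z; auto. intros HP'. apply Hn, I, filter_In. split; auto. apply pbool_true; auto.
Qed.

Lemma asum_extend P P' a s :
  (forall x, P' x -> P x) -> (forall x, P x -> ~ P' x -> a x = C0) ->
  asum P' a s -> asum P a s.
Proof.
  intros S Z [[M HM] H].
  assert (Q : forall F, NoDup F -> Forall P F ->
            NoDup (filter (pbool P') F) /\ Forall P' (filter (pbool P') F)).
  { intros F N A. split; [apply NoDup_filter; auto|].
    apply Forall_forall. intros x Hx. apply filter_In in Hx. apply pbool_true, Hx. }
  assert (Z' : forall F, Forall P F -> forall x, In x F -> pbool P' x = false -> a x = C0).
  { intros F A x Hx Hb. rewrite Forall_forall in A. apply Z; auto.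
    apply pbool_false; auto. }
  split.
  - exists M. intros F N A. destruct (Q F N A) as [N' A'].
    eapply Rle_trans; [right|apply (HM _ N' A')].
    assert (E : forall f : X -> R, (forall x, In x F -> pbool P' x = false -> f x = 0) ->
              Rsum F f = Rsum (filter (pbool P') F) f).
    { clear; intros f. unfold Rsum. induction F as [|x F IH]; simpl; intros H; auto.
      rewrite IH by auto. destruct (pbool P' x) eqn:E; simpl; auto. rewrite (H x) by auto. lra. }
    apply E. intros x Hx Hb. rewrite (Z' F A x Hx Hb). apply Cnorm_C0.
  - intros eps He. destruct (H eps He) as (F0 & A0 & B0). exists F0.
    split; [eapply Forall_impl; eauto|]. intros F N A I. destruct (Q F N A) as [N' A'].
    rewrite <- (Csum_filter F a (pbool P') (Z' F A)). apply B0; auto.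
    intros x Hx. apply filter_In. split; auto. apply pbool_true.
    rewrite Forall_forall in A0; auto.
Qed.

Lemma asum_bij {Y} P (Q : Y -> Prop) (phi : Y -> X) (psi : X -> Y) a s :
  (forall y, Q y -> P (phi y)) -> (forall x, P x -> Q (psi x)) ->
  (forall y, Q y -> psi (phi y) = y) -> (forall x, P x -> phi (psi x) = x) ->
  asum P a s -> asum Q (fun y => a (phi y)) s.
Proof.
  intros H1 H2 H3 H4 [[M HM] H].
  assert (K : forall F, NoDup F -> Forall Q F -> NoDup (map phi F) /\ Forall P (map phi F)).
  { intros F N A. rewrite Forall_forall in A. split.
    - apply NoDup_map_NoDup_ForallPairs; auto. intros x y Hx Hy E.
      rewrite <- (H3 x), <- (H3 y), E; auto.
    - apply Forall_forall. intros x Hx. apply in_map_iff in Hx as (y & <- & Hy). auto. }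
  split.
  - exists M. intros F N A. destruct (K F N A) as [N' A'].
    specialize (HM _ N' A'). rewrite Rsum_map in HM. exact HM.
  - intros eps He. destruct (H eps He) as (F0 & A0 & B0). exists (map psi F0).
    rewrite Forall_forall in A0. split.
    { apply Forall_forall. intros x Hx. apply in_map_iff in Hx as (y & <- & Hy). auto. }
    intros F N A I. destruct (K F N A) as [N' A'].
    rewrite <- Csum_map. apply B0; auto.
    intros x Hx. rewrite <- (H4 x) by auto. apply in_map, I, in_map, Hx.
Qed.

(** The sum is the supremum of the finite partial sums. *)
Lemma asum_exists_nonneg P (r : X -> R) :
  (forall x, P x -> 0 <= r x) ->
  (exists M, forall F, NoDup F -> Forall P F -> Rsum F r <= M) ->
  exists s, asum P (fun x => RC (r x)) s.
Proof.
  intros Hr [M HM].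
  destruct (completeness (fun y => exists F, NoDup F /\ Forall P F /\ y = Rsum F r))
    as [s [Hub Hlub]].
  - exists M. intros y (F & N & A & ->). auto.
  - exists 0, []. repeat split; constructor.
  - assert (NR : forall y, 0 <= y -> Cnorm (RC y) = y).
    { intros y Hy. unfold Cnorm, RC; simpl. replace (y*y+0*0) with (y*y) by ring.
      apply sqrt_square; auto. }
    exists (RC s). split.
    + exists M. intros F N A. eapply Rle_trans; [|apply (HM F N A)].
      rewrite Forall_forall in A.
      apply Rsum_le. intros x Hx. rewrite NR by auto. lra.
    + intros eps He.
      assert (exists F, NoDup F /\ Forall P F /\ s - eps < Rsum F r) as (F0 & N0 & A0 & B0).
      { apply NNPP; intros C. assert (s <= s - eps); [|lra].
        apply Hlub. intros y (F & N & A & ->). apply Rnot_lt_le. intros L.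
        apply C. exists F; auto. }
      exists F0. split; auto. intros F N A I.
      assert (U : Rsum F r <= s) by (apply Hub; exists F; auto).
      rewrite Forall_forall in A.
      assert (L := Rsum_incl F0 F r N0 I (fun x Hx => Hr x (A x Hx))).
      rewrite Cnorm_sub_sym, Csum_RC.
      replace (Csub (RC s) (RC (Rsum F r))) with (RC (s - Rsum F r))
        by (apply Cplx_ext; simpl; ring).
      rewrite NR; lra.
Qed.

Lemma asum_exists P a :
  (exists M, forall F, NoDup F -> Forall P F -> Rsum F (fun x => Cnorm (a x)) <= M) ->
  exists s, asum P a s.
Proof.
  intros [M HM].
  assert (K : forall r : X -> R, (forall x, r x <= Cnorm (a x)) ->
            exists s, asum P (fun x => RC (Rmax 0 (r x))) s).
  { intros r Hr. apply asum_exists_nonneg; [intros; apply Rmax_l|].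
    exists M. intros F N A. eapply Rle_trans; [|apply (HM F N A)].
    apply Rsum_le. intros x _. apply Rmax_lub; auto. apply Cnorm_ge0. }
  assert (Hf := fun x => Cnorm_fst (a x)). assert (Hs := fun x => Cnorm_snd (a x)).
  assert (Ab := fun y => Rle_abs y). assert (Ab' := fun y => Rle_abs (- y)).
  destruct (K (fun x => fst (a x))) as [s1 K1]; [intros; eapply Rle_trans; eauto|].
  destruct (K (fun x => - fst (a x))) as [s2 K2];
    [intros; eapply Rle_trans; [apply Ab|rewrite Rabs_Ropp; auto]|].
  destruct (K (fun x => snd (a x))) as [s3 K3]; [intros; eapply Rle_trans; eauto|].
  destruct (K (fun x => - snd (a x))) as [s4 K4];
    [intros; eapply Rle_trans; [apply Ab|rewrite Rabs_Ropp; auto]|].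
  eexists. eapply asum_ext.
  2:{ apply asum_add; [apply asum_add; [apply asum_add; [exact K1|]|]|];
      apply asum_scal; [exact K2|exact K3|exact K4]. }
  (* The coefficients -i, i and -1 of the negative imaginary, positive imaginary and negative real
     parts. *)
  instantiate (1 := (0, -1)). instantiate (1 := (0, 1)). instantiate (1 := (-1, 0)).
  intros x _. apply Cplx_ext; simpl; unfold Rmax; repeat destruct Rle_dec; lra.
Qed.

End Asum.

(** * Binomial series *)

Lemma asum_nat_shift (a : nat -> Cplx) s : asum (fun _ => True) a s ->
  asum (fun _ => True) (fun n => match n with O => C0 | S m => a m end) s.
Proof.
  intros H. apply asum_extend with (P' := fun n => (0 < n)%nat); auto.
  - intros [|n] _ Hn; auto. exfalso; apply Hn; lia.
  - assert (Q := asum_bij (fun _ => True) (fun n => (0 < n)%nat) Nat.pred S a s).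
    eapply asum_ext; [|apply Q; auto; try (intros; lia)].
    intros [|n] Hn; [lia|reflexivity].
Qed.

(* The recursion reads [(1 - tau * shift) beta = alpha], so once [beta] is known to be
   summable its sum is forced and no Cauchy product is needed. *)
Lemma asum_nat_geometric (alpha beta : nat -> Cplx) (tau s : Cplx) :
  Cnorm tau < 1 -> asum (fun _ => True) alpha s ->
  beta 0%nat = alpha 0%nat ->
  (forall n, beta (S n) = Cadd (alpha (S n)) (Cmul tau (beta n))) ->
  asum (fun _ => True) beta (Cdiv s (Csub C1 tau)).
Proof.
  intros Ht Ha H0 HS.
  assert (Tne : Csub C1 tau <> C0).
  { apply Csub_neq0. intros E. rewrite <- E, Cnorm_C1 in Ht. lra. }
  assert (Tr : forall F : list nat, Forall (fun _ => True) F)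
    by (intros; apply Forall_forall; auto).
  destruct (asum_exists (fun _ => True) beta) as [s' Hs'].
  { destruct Ha as [[M HM] _].
    assert (PT := Cnorm_ge0 tau).
    assert (B : forall N, Rsum (seq 0 N) (fun n => Cnorm (beta n)) <= M / (1 - Cnorm tau)).
    { intros N.
      (* Taking norms in the recursion bounds the partial sums of [beta] by those of [alpha] plus
         |tau| times themselves; since |tau| < 1 this can be solved for them. *)
      assert (E : Rsum (seq 0 N) (fun n => Cnorm (beta n))
        <= Rsum (seq 0 N) (fun n => Cnorm (alpha n))
           + Cnorm tau * Rsum (seq 0 N) (fun n => Cnorm (beta n))).
      { assert (E : forall n r, Rsum (seq 0 (S n)) r = Rsum (seq 0 n) r + r n).
        { intros n r. rewrite seq_S, Rsum_app. unfold Rsum at 2; simpl. ring. }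
        clear - PT H0 HS E. destruct N as [|N]; [unfold Rsum; simpl; lra|].
        assert (Q : Rsum (seq 0 (S N)) (fun n => Cnorm (beta n))
          <= Rsum (seq 0 (S N)) (fun n => Cnorm (alpha n))
             + Cnorm tau * Rsum (seq 0 N) (fun n => Cnorm (beta n))).
        { induction N as [|N IHN]; [unfold Rsum; simpl; rewrite H0; lra|].
          rewrite (E (S N)), (E (S N) (fun n => Cnorm (alpha n))), HS.
          rewrite (E N (fun n => Cnorm (beta n))) at 2.
          assert (T := Cnorm_triang (alpha (S N)) (Cmul tau (beta N))).
          rewrite Cnorm_mul in T. lra. }
        assert (P := Cnorm_ge0 (beta N)).
        rewrite (E N (fun n => Cnorm (beta n))) in *. nra. }
      specialize (HM (seq 0 N) (seq_NoDup _ _) (Tr _)).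
      apply Rmult_le_reg_r with (1 - Cnorm tau); [lra|].
      unfold Rdiv. rewrite Rmult_assoc, Rinv_l by lra. lra. }
    exists (M / (1 - Cnorm tau)). intros F N _.
    eapply Rle_trans; [|apply (B (S (list_max F)))].
    apply Rsum_incl; auto; [|intros; apply Cnorm_ge0].
    intros x Hx. apply in_seq. split; [lia|].
    assert (L := proj1 (list_max_le F (list_max F)) (Nat.le_refl _)).
    rewrite Forall_forall in L. specialize (L x Hx). lia. }
  assert (Sh := asum_nat_shift _ _ (asum_scal _ tau _ _ Hs')).
  assert (E : s' = Cadd s (Cmul tau s')).
  { apply (asum_unique _ _ _ _ Hs').
    eapply asum_ext; [|apply asum_add; [exact Ha|exact Sh]].
    intros [|n] _; simpl; [rewrite H0; ring|rewrite HS; reflexivity]. }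
  replace (Cdiv s (Csub C1 tau)) with s'; auto.
  replace s with (Cmul s' (Csub C1 tau)); [field; auto|].
  transitivity (Csub (Cadd s (Cmul tau s')) (Cmul tau s')); [rewrite <- E|]; ring.
Qed.

(** The coefficient of y^j in (1 + y)^a, for an integer a of either sign. *)
Fixpoint gbin (a : Z) (j : nat) : Cplx :=
  match j with
  | O => C1
  | S i => Cmul (Cmul (ZC (a - Z.of_nat i)) (Cinv (ZC (Z.of_nat i + 1)))) (gbin a i)
  end.

(** Extended by zero to negative lower indices, so that Pascal's rule and absorption hold for every
    integer [z]. *)
Definition gbz (a z : Z) : Cplx := if Z_lt_dec z 0 then C0 else gbin a (Z.to_nat z).

Lemma gbin_S a j :
  Cmul (ZC (Z.of_nat j + 1)) (gbin a (S j)) = Cmul (ZC (a - Z.of_nat j)) (gbin a j).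
Proof. simpl. field. apply ZC_neq0. lia. Qed.

Lemma gbin_pascal a j : gbin (a + 1) (S j) = Cadd (gbin a (S j)) (gbin a j).
Proof.
  assert (ND : forall j, ZC (Z.of_nat j + 1) <> C0) by (intros; apply ZC_neq0; lia).
  induction j.
  - cbn [gbin]. change (Z.of_nat 0) with 0%Z. change (ZC (0 + 1)) with C1.
    rewrite !Z.sub_0_r, ZC_add, ZC_1. cfield.
  - assert (CC : forall x y, Cmul (ZC (Z.of_nat (S j) + 1)) x = Cmul (ZC (Z.of_nat (S j) + 1)) y -> x = y).
    { intros x y E. transitivity (Cmul (Cinv (ZC (Z.of_nat (S j) + 1))) (Cmul (ZC (Z.of_nat (S j) + 1)) x)).
      - field; auto.
      - rewrite E; field; auto. }
    apply CC. rewrite gbin_S, IHj.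
    transitivity (Cadd (Cmul (ZC (Z.of_nat (S j) + 1)) (gbin a (S (S j))))
       (Cmul (ZC (Z.of_nat (S j) + 1)) (gbin a (S j)))); [|ring].
    rewrite gbin_S.
    replace (Z.of_nat (S j)) with (Z.of_nat j + 1)%Z by lia.
    transitivity (Cadd (Cmul (ZC (a - Z.of_nat j)) (gbin a (S j)))
      (Cmul (ZC (a - Z.of_nat j)) (gbin a j))).
    + replace (a + 1 - (Z.of_nat j + 1))%Z with (a - Z.of_nat j)%Z by lia. ring.
    + rewrite <- gbin_S. rewrite !ZC_sub, !ZC_add. rewrite ZC_1. ring.
Qed.

Lemma gbin_0 j : gbin 0 (S j) = C0.
Proof.
  induction j; [simpl; rewrite ZC_0; ring|].
  change (gbin 0 (S (S j))) with (Cmul (Cmul (ZC (0 - Z.of_nat (S j))) (Cinv (ZC (Z.of_nat (S j) + 1)))) (gbin 0 (S j))).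
  rewrite IHj. ring.
Qed.

Lemma gbz_neg a z : (z < 0)%Z -> gbz a z = C0.
Proof. unfold gbz. destruct Z_lt_dec; auto; lia. Qed.

Lemma gbz_nat a j : gbz a (Z.of_nat j) = gbin a j.
Proof. unfold gbz. destruct Z_lt_dec; [lia|]. rewrite Nat2Z.id; auto. Qed.

Lemma gbz_0 a : gbz a 0 = C1.
Proof. apply (gbz_nat a 0). Qed.

Lemma gbz_absorb a z : Cmul (ZC z) (gbz a z) = Cmul (ZC (a - z + 1)) (gbz a (z - 1)).
Proof.
  destruct (Z.lt_trichotomy z 0) as [H|[->|H]].
  - rewrite !gbz_neg by lia. ring.
  - rewrite (gbz_neg a (0 - 1)) by lia. rewrite ZC_0. ring.
  - replace z with (Z.of_nat (Z.to_nat (z - 1)) + 1)%Z by lia.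
    set (j := Z.to_nat (z - 1)).
    replace (Z.of_nat j + 1 - 1)%Z with (Z.of_nat j) by lia.
    replace (gbz a (Z.of_nat j + 1)) with (gbin a (S j))
      by (rewrite <- gbz_nat; f_equal; lia).
    rewrite gbin_S, gbz_nat. do 2 f_equal. lia.
Qed.

Lemma gbz_pascal a z : gbz (a + 1) z = Cadd (gbz a z) (gbz a (z - 1)).
Proof.
  destruct (Z.lt_trichotomy z 0) as [H|[->|H]].
  - rewrite !gbz_neg by lia. ring.
  - rewrite (gbz_neg a (0 - 1)) by lia. rewrite !gbz_0. ring.
  - replace z with (Z.of_nat (S (Z.to_nat (z - 1)))) by lia.
    set (j := Z.to_nat (z - 1)).
    replace (Z.of_nat (S j) - 1)%Z with (Z.of_nat j) by lia.
    rewrite !gbz_nat. apply gbin_pascal.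
Qed.

(** The coefficient of t^r in (1 + t)^b (1 - t/(1 + t))^a = (1 + t)^(b - a). Pascal's rule gives
    both sides the same recursion in [a], with a correction term of order [r] already known; it is
    run upwards and downwards from a = 0. *)
Lemma gbin_vandermonde r a b :
  Csum (seq 0 (S r))
    (fun j => Cmul (Csign (Z.of_nat j)) (Cmul (gbin a j) (gbin (b - Z.of_nat j) (r - j))))
  = gbin (b - a) r.
Proof.
  revert a b. induction r as [|r IH]; [intros; simpl; unfold Csign; simpl; ring|].
  set (F := fun a b r => Csum (seq 0 (S r))
    (fun j => Cmul (Csign (Z.of_nat j)) (Cmul (gbin a j) (gbin (b - Z.of_nat j) (r - j))))).
  change (forall a b, F a b r = gbin (b - a) r) in IH.
  enough (G : forall a b, F a b (S r) = gbin (b - a) (S r)) by exact G.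
  assert (R : forall a b, F (a + 1)%Z b (S r) = Csub (F a b (S r)) (F a (b - 1)%Z r)).
  { intros a b. unfold F. rewrite (Csum_seq_front (S r)), (Csum_seq_front (S r)).
    transitivity (Cadd (Cmul (Csign (Z.of_nat 0)) (Cmul (gbin (a + 1) 0) (gbin (b - Z.of_nat 0) (S r - 0))))
      (Cadd (Csum (seq 0 (S r)) (fun j => Cmul (Csign (Z.of_nat (S j)))
             (Cmul (gbin a (S j)) (gbin (b - Z.of_nat (S j)) (S r - S j)))))
         (Csum (seq 0 (S r)) (fun j => Copp (Cmul (Csign (Z.of_nat j))
             (Cmul (gbin a j) (gbin (b - 1 - Z.of_nat j) (r - j)))))))).
    - f_equal. rewrite <- Csum_add. apply Csum_ext. intros j _.
      rewrite gbin_pascal. replace (Z.of_nat (S j)) with (Z.of_nat j + 1)%Z by lia.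
      rewrite Csign_succ. replace (b - (Z.of_nat j + 1))%Z with (b - 1 - Z.of_nat j)%Z by lia.
      replace (S r - S j)%nat with (r - j)%nat by lia. ring.
    - rewrite Csum_opp. cbn [gbin]. ring. }
  assert (P : forall a b, gbin (b - a) (S r) = Cadd (gbin (b - (a + 1)) (S r)) (gbin (b - 1 - a) r)).
  { intros a b. replace (b - a)%Z with (b - (a + 1) + 1)%Z by lia. rewrite gbin_pascal.
    do 2 f_equal. lia. }
  intros a. induction a as [|a Ha|a Ha] using Z.peano_ind; intros b.
  - unfold F. rewrite Csum_seq_front, Csum_0.
    + replace (Z.of_nat 0) with 0%Z by reflexivity. rewrite Nat.sub_0_r.
      unfold Csign. cbn [Z.even gbin]. cbn [gbin]. rewrite !Z.sub_0_r. ring.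
    + intros j _. rewrite gbin_0. ring.
  - unfold Z.succ. rewrite R, Ha, IH, P. ring.
  - assert (E := R (Z.pred a) b). replace (Z.pred a + 1)%Z with a in E by lia.
    rewrite Ha, IH in E. rewrite P. replace (Z.pred a + 1)%Z with a by lia.
    rewrite E. ring.
Qed.

(** Multiplication of a power series by (1 + y)^Q without a Cauchy product. Passing from Q to Q + 1
    adds the shifted series multiplied by y; passing from Q to Q - 1 solves the same relation
    backwards, which is the geometric recursion with tau = - y. *)
Lemma asum_binomial_series (b : nat -> Cplx) (y s : Cplx) (Q : Z) :
  Cnorm y < 1 -> asum (fun _ => True) (fun n => Cmul (b n) (Cpow y n)) s ->
  asum (fun _ => True)
    (fun n => Cmul (Csum (seq 0 (S n)) (fun r => Cmul (gbin Q r) (b (n - r)%nat))) (Cpow y n))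
    (Cmul (Cpowz (Cadd C1 y) Q) s).
Proof.
  intros Hy Hs.
  assert (Y1 : Cadd C1 y <> C0).
  { intros E. replace y with (Copp C1) in Hy.
    - rewrite Cnorm_opp, Cnorm_C1 in Hy. lra.
    - transitivity (Csub y (Cadd C1 y)); [ring|rewrite E; ring]. }
  set (A := fun Q n => Csum (seq 0 (S n)) (fun r => Cmul (gbin Q r) (b (n - r)%nat))).
  assert (A0 : forall Q, A Q 0%nat = b 0%nat) by (intros; unfold A; simpl; ring).
  assert (AS : forall Q n, A (Q + 1)%Z (S n) = Cadd (A Q (S n)) (A Q n)).
  { intros q n. unfold A. rewrite !(Csum_seq_front (S n)).
    rewrite (Csum_ext (seq 0 (S n)) (fun j => Cmul (gbin (q + 1) (S j)) (b (S n - S j)%nat))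
       (fun j => Cadd (Cmul (gbin q (S j)) (b (S n - S j)%nat)) (Cmul (gbin q j) (b (n - j)%nat)))).
    - rewrite Csum_add. cbn [gbin]. ring.
    - intros j _. rewrite gbin_pascal. replace (S n - S j)%nat with (n - j)%nat by lia. ring. }
  enough (G : asum (fun _ => True) (fun n => Cmul (A Q n) (Cpow y n))
                (Cmul (Cpowz (Cadd C1 y) Q) s)) by exact G.
  induction Q as [|Q IH|Q IH] using Z.peano_ind.
  - replace (Cmul (Cpowz (Cadd C1 y) 0) s) with s by (simpl; ring).
    eapply asum_ext; [|exact Hs]. intros n _. simpl. f_equal.
    unfold A. rewrite Csum_seq_front, Csum_0; [rewrite Nat.sub_0_r; cbn [gbin]; ring|].
    intros j _. rewrite gbin_0. ring.
  - unfold Z.succ. rewrite Cpowz_succ by auto.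
    replace (Cmul (Cmul (Cpowz (Cadd C1 y) Q) (Cadd C1 y)) s)
      with (Cadd (Cmul (Cpowz (Cadd C1 y) Q) s) (Cmul y (Cmul (Cpowz (Cadd C1 y) Q) s))) by ring.
    eapply asum_ext; [|apply asum_add; [exact IH|apply asum_nat_shift, asum_scal, IH]].
    intros [|n] _; cbn beta iota; [rewrite !A0; ring|].
    rewrite AS. simpl. ring.
  - assert (G := asum_nat_geometric _ (fun n => Cmul (A (Z.pred Q) n) (Cpow y n)) (Copp y) _
        (eq_ind_r (fun r => r < 1) Hy (Cnorm_opp y)) IH).
    replace (Cmul (Cpowz (Cadd C1 y) (Z.pred Q)) s)
      with (Cdiv (Cmul (Cpowz (Cadd C1 y) Q) s) (Csub C1 (Copp y))).
    + apply G; [rewrite !A0; reflexivity|]. intros n.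
      assert (E := AS (Z.pred Q) n). replace (Z.pred Q + 1)%Z with Q in E by lia.
      rewrite E. simpl. ring.
    + replace (Csub C1 (Copp y)) with (Cadd C1 y) by ring.
      replace Q with (Z.pred Q + 1)%Z at 1 by lia. rewrite Cpowz_succ by auto.
      field. exact Y1.
Qed.

(** * Rational functions with poles on the diagonals *)

(** The numerators in [Cinv] vanish at 0, so the inverse of 0 is 0 and multiplicativity of [Cinv]
    holds without side conditions. *)
Lemma Cinv_C0 : Cinv C0 = C0.
Proof. apply Cplx_ext; simpl; unfold Rdiv; ring. Qed.

Lemma Cinv_mul a b : Cinv (Cmul a b) = Cmul (Cinv a) (Cinv b).
Proof.
  destruct (classic (a = C0)) as [->|Ha].
  { replace (Cmul C0 b) with C0 by ring. rewrite Cinv_C0. ring. }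
  destruct (classic (b = C0)) as [->|Hb].
  { replace (Cmul a C0) with C0 by ring. rewrite Cinv_C0. ring. }
  field; auto.
Qed.

Definition Cprod (l : list Cplx) : Cplx := fold_right Cmul C1 l.

Lemma Cprod_app l m : Cprod (l ++ m) = Cmul (Cprod l) (Cprod m).
Proof. unfold Cprod. induction l; simpl; [|rewrite IHl]; ring. Qed.

Lemma Cprod_Cpow {X} (l : list X) f n :
  Cprod (map (fun x => Cpow (f x) n) l) = Cpow (Cprod (map f l)) n.
Proof.
  unfold Cprod. induction l; simpl; [clear; induction n; simpl; [|rewrite <- IHn]; ring|].
  rewrite IHl, Cpow_mul. reflexivity.
Qed.

Lemma Cprod_neq0 l : Forall (fun x => x <> C0) l -> Cprod l <> C0.
Proof. induction 1; simpl; [apply C1_neq_C0|apply Cmul_neq0; auto]. Qed.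

(** Listing [C0] among the points lets one [NoDup] exclude both z_i = 0 and z_i = z_j: the
    complement of the allowed poles. *)
Definition nondeg (zs : list Cplx) : Prop := NoDup (C0 :: zs).

Lemma denom_pow N zs : denom N zs = Cpow (denom 1 zs) N.
Proof.
  induction zs as [|z zs IH]; cbn [denom].
  - induction N; simpl; [|rewrite <- IHN]; ring.
  - rewrite IH. fold (Cprod (map (fun z' => Cpow (Csub z z') N) zs)).
    fold (Cprod (map (fun z' => Cpow (Csub z z') 1) zs)).
    rewrite (Cprod_Cpow zs (fun z' => Csub z z')), (Cprod_Cpow zs (fun z' => Csub z z')).
    rewrite !Cpow_mul. do 2 f_equal; [|f_equal]; f_equal; simpl; ring.
Qed.

Lemma denom_neq0 N zs : nondeg zs -> denom N zs <> C0.
Proof.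
  intros H. rewrite denom_pow. apply Cpow_neq0. induction zs as [|z zs IH]; simpl.
  - apply C1_neq_C0.
  - unfold nondeg in H. inversion_clear H as [|? ? H0 H1]. inversion_clear H1 as [|? ? H2 H3].
    apply Cmul_neq0; [|apply Cmul_neq0].
    + apply Cmul_neq0; [|apply C1_neq_C0]. intros E. apply H0. left; auto.
    + apply Cprod_neq0, Forall_forall. intros x Hx. apply in_map_iff in Hx as (y & <- & Hy).
      apply Cmul_neq0; [|apply C1_neq_C0]. apply Csub_neq0. intros ->; auto.
    + apply IH. constructor; auto. intros Hi; apply H0; right; auto.
Qed.

Section PolyRat.
Variable n : nat.
Implicit Types F G : list Cplx -> Cplx.

Definition polyfun F : Prop :=
  exists P, forall zs, length zs = n -> F zs = peval P zs.

(** Agreement with an admissible fraction away from the poles. As a property of functions it is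
    closed under the operations below, so numerators never have to be computed. *)
Definition ratfun F : Prop :=
  exists P N, forall zs, length zs = n -> nondeg zs ->
    F zs = Cdiv (peval P zs) (denom N zs).

Lemma polyfun_ext F G : (forall zs, length zs = n -> F zs = G zs) -> polyfun F -> polyfun G.
Proof. intros E [P HP]. exists P. intros zs H. rewrite <- E by auto. auto. Qed.

Lemma ratfun_ext F G :
  (forall zs, length zs = n -> nondeg zs -> F zs = G zs) -> ratfun F -> ratfun G.
Proof. intros E (P & N & HP). exists P, N. intros zs H D. rewrite <- E by auto. auto. Qed.

Lemma monom_nil zs : monom zs [] = C1.
Proof. destruct zs; reflexivity. Qed.

Lemma polyfun_const c : polyfun (fun _ => c).
Proof. exists [(c, [])]. intros zs _. unfold peval. simpl. rewrite monom_nil. ring. Qed.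

Lemma polyfun_add F G : polyfun F -> polyfun G -> polyfun (fun zs => Cadd (F zs) (G zs)).
Proof.
  intros [P HP] [Q HQ]. exists (P ++ Q). intros zs H. unfold peval. rewrite Csum_app.
  rewrite HP, HQ by auto. reflexivity.
Qed.

Fixpoint addl (a b : list nat) : list nat :=
  match a, b with
  | [], _ => b
  | _, [] => a
  | x :: a', y :: b' => (x + y)%nat :: addl a' b'
  end.

Lemma monom_addl zs a b : monom zs (addl a b) = Cmul (monom zs a) (monom zs b).
Proof.
  revert a b. induction zs as [|z zs IH]; intros [|x a] [|y b]; unfold monom; simpl; try ring.
  fold (monom zs (addl a b)) (monom zs a) (monom zs b). rewrite IH, Cpow_add. ring.
Qed.

Lemma polyfun_mul F G : polyfun F -> polyfun G -> polyfun (fun zs => Cmul (F zs) (G zs)).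
Proof.
  intros [P HP] [Q HQ].
  exists (map (fun pq => (Cmul (fst (fst pq)) (fst (snd pq)), addl (snd (fst pq)) (snd (snd pq))))
            (list_prod P Q)).
  intros zs H. rewrite HP, HQ by auto. unfold peval. rewrite Csum_map, Csum_prod.
  transitivity (Csum P (fun p => Cmul (Csum Q (fun q => Cmul (fst q) (monom zs (snd q))))
                                     (Cmul (fst p) (monom zs (snd p))))).
  - rewrite Csum_scal. ring.
  - apply Csum_ext. intros p _.
    transitivity (Cmul (Cmul (fst p) (monom zs (snd p)))
      (Csum Q (fun q => Cmul (fst q) (monom zs (snd q))))); [ring|].
    rewrite <- Csum_scal. apply Csum_ext. intros q _. simpl. rewrite monom_addl. ring.
Qed.

Lemma polyfun_coord i : polyfun (fun zs => nth i zs C0).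
Proof.
  destruct (Nat.lt_ge_cases i n) as [Hi|Hi].
  - exists [(C1, repeat 0%nat i ++ [1%nat])]. intros zs H.
    unfold peval; simpl. rewrite <- H in Hi. clear H.
    transitivity (monom zs (repeat 0%nat i ++ [1%nat])); [|ring].
    revert zs Hi. induction i; intros [|z zs] Hi; simpl in *; try lia; unfold monom; simpl.
    + destruct zs; simpl; ring.
    + fold (monom zs (repeat 0%nat i ++ [1%nat])). rewrite <- IHi by lia. ring.
  - apply polyfun_ext with (fun _ => C0); [|apply polyfun_const].
    intros zs H. rewrite nth_overflow; auto; lia.
Qed.

Lemma polyfun_Cprod (l : list (list Cplx -> Cplx)) :
  Forall polyfun l -> polyfun (fun zs => Cprod (map (fun g => g zs) l)).
Proof.
  induction 1 as [|g l Hg _ IH]; [apply (polyfun_const C1)|].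
  apply (polyfun_mul g (fun zs => Cprod (map (fun h => h zs) l))); auto.
Qed.

Lemma polyfun_pow F N : polyfun F -> polyfun (fun zs => Cpow (F zs) N).
Proof. intros H; induction N; [apply (polyfun_const C1)|apply (polyfun_mul F); auto]. Qed.

End PolyRat.

Lemma polyfun_tl n F : polyfun n F -> polyfun (S n) (fun zs => F (tl zs)).
Proof.
  intros [P HP]. exists (map (fun p => (fst p, 0%nat :: snd p)) P).
  intros [|z zs] H; [discriminate|]. simpl in *. rewrite HP by lia.
  unfold peval. rewrite Csum_map. apply Csum_ext. intros p _. simpl.
  unfold monom at 2; simpl. fold (monom zs (snd p)). ring.
Qed.

(** The linear factors z_i and z_i - z_j, i < j, of [denom 1], kept as a list so that any one of
    them can be split off. *)
Fixpoint denom_factors (n : nat) : list (list Cplx -> Cplx) :=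
  match n with
  | O => []
  | S m => (fun zs => nth 0 zs C0) ::
           map (fun j zs => Csub (nth 0 zs C0) (nth (S j) zs C0)) (seq 0 m) ++
           map (fun g zs => g (tl zs)) (denom_factors m)
  end.

Lemma denom_factors_poly n : Forall (polyfun n) (denom_factors n).
Proof.
  induction n; simpl; constructor; [apply polyfun_coord|]. apply Forall_app; split.
  - apply Forall_forall. intros g Hg. apply in_map_iff in Hg as (j & <- & _).
    apply polyfun_ext with (fun zs => Cadd (nth 0 zs C0) (Cmul (Copp C1) (nth (S j) zs C0))).
    + intros; ring.
    + apply polyfun_add; [|apply polyfun_mul; [apply polyfun_const|]]; apply polyfun_coord.
  - apply Forall_forall. intros g Hg. apply in_map_iff in Hg as (h & <- & Hh).
    apply polyfun_tl. rewrite Forall_forall in IHn; auto.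
Qed.

Lemma map_nth_seq (zs : list Cplx) : map (fun j => nth j zs C0) (seq 0 (length zs)) = zs.
Proof.
  induction zs as [|z zs IH]; auto. cbn [length seq map]. rewrite <- seq_shift, map_map.
  simpl. f_equal. exact IH.
Qed.

Lemma denom_factorsE n zs : length zs = n ->
  denom 1 zs = Cprod (map (fun g => g zs) (denom_factors n)).
Proof.
  revert zs; induction n; intros [|z zs] H; try discriminate; [reflexivity|].
  injection H as H. cbn [denom denom_factors map]. rewrite map_app, !map_map. simpl.
  fold (Cprod (map (fun z' => Cmul (Csub z z') C1) zs)).
  change (fold_right Cmul C1) with Cprod. rewrite Cprod_app, <- IHn by auto.
  replace (map (fun x => Csub z (nth x zs C0)) (seq 0 n))
    with (map (fun z' => Cmul (Csub z z') C1) zs); [ring|].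
  rewrite <- (map_nth_seq zs) at 1. rewrite map_map, H. apply map_ext. intros; ring.
Qed.

Section Rat.
Variable n : nat.
Implicit Types F G : list Cplx -> Cplx.

Lemma polyfun_denom N : polyfun n (denom N).
Proof.
  apply polyfun_ext with
    (fun zs => Cpow (Cprod (map (fun g => g zs) (denom_factors n))) N).
  - intros zs H. rewrite denom_pow, (denom_factorsE n) by auto. reflexivity.
  - apply polyfun_pow, polyfun_Cprod, denom_factors_poly.
Qed.

Lemma ratfun_frac F N :
  polyfun n F -> ratfun n (fun zs => Cdiv (F zs) (denom N zs)).
Proof. intros [P HP]. exists P, N. intros zs H _. rewrite HP; auto. Qed.

Lemma ratfun_poly F : polyfun n F -> ratfun n F.
Proof.
  intros H. apply ratfun_ext with (fun zs => Cdiv (F zs) (denom 0 zs)).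
  - intros zs _ _. rewrite denom_pow. simpl. cfield.
  - apply ratfun_frac; auto.
Qed.

Lemma ratfun_const c : ratfun n (fun _ => c).
Proof. apply ratfun_poly, polyfun_const. Qed.

Lemma ratfun_coord i : ratfun n (fun zs => nth i zs C0).
Proof. apply ratfun_poly, polyfun_coord. Qed.

Lemma ratfun_mul F G : ratfun n F -> ratfun n G -> ratfun n (fun zs => Cmul (F zs) (G zs)).
Proof.
  intros (P & N & HP) (Q & M & HQ).
  apply ratfun_ext with (fun zs => Cdiv (Cmul (peval P zs) (peval Q zs)) (denom (N + M) zs)).
  - intros zs H D. rewrite HP, HQ by auto. rewrite !(denom_pow N), !(denom_pow M), (denom_pow (N + M)), Cpow_add.
    assert (H1 := denom_neq0 1 zs D). cfield.
  - apply ratfun_frac, polyfun_mul; [exists P|exists Q]; auto.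
Qed.

Lemma ratfun_add F G : ratfun n F -> ratfun n G -> ratfun n (fun zs => Cadd (F zs) (G zs)).
Proof.
  intros (P & N & HP) (Q & M & HQ).
  apply ratfun_ext with (fun zs => Cdiv (Cadd (Cmul (peval P zs) (denom M zs))
                                             (Cmul (peval Q zs) (denom N zs))) (denom (N + M) zs)).
  - intros zs H D. rewrite HP, HQ by auto. rewrite !(denom_pow N), !(denom_pow M), (denom_pow (N + M)), Cpow_add.
    assert (H1 := denom_neq0 1 zs D). cfield.
  - apply ratfun_frac, polyfun_add; apply polyfun_mul; try apply polyfun_denom;
      [exists P|exists Q]; auto.
Qed.

Lemma ratfun_Csum {I} (l : list I) (F : I -> list Cplx -> Cplx) :
  (forall i, In i l -> ratfun n (F i)) -> ratfun n (fun zs => Csum l (fun i => F i zs)).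
Proof.
  induction l as [|i l IH]; intros H; [apply (ratfun_const C0)|].
  apply (ratfun_add (F i) (fun zs => Csum l (fun i => F i zs))); [apply H; left; auto|apply IH; intros; apply H; right; auto].
Qed.

Lemma ratfun_pow F N : ratfun n F -> ratfun n (fun zs => Cpow (F zs) N).
Proof. intros H; induction N; [apply (ratfun_const C1)|apply (ratfun_mul F); auto]. Qed.

(** The inverse of one factor is the product of all the others divided by [denom 1]. *)
Lemma ratfun_inv_factor F :
  Exists (fun g => forall zs, length zs = n -> g zs = F zs) (denom_factors n) ->
  ratfun n (fun zs => Cinv (F zs)).
Proof.
  intros H. apply Exists_exists in H as (g & Hg & E).
  assert (A := denom_factors_poly n).
  destruct (in_split g _ Hg) as (l1 & l2 & El). rewrite El in A.
  apply Forall_app in A as [A1 A2]. inversion_clear A2 as [|? ? _ A2'].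
  apply ratfun_ext with (fun zs => Cdiv (Cprod (map (fun h => h zs) (l1 ++ l2))) (denom 1 zs)).
  - intros zs H D. assert (N := denom_neq0 1 zs D).
    assert (E1 := denom_factorsE n zs H). rewrite El, map_app in E1.
    cbn [map] in E1. rewrite Cprod_app in E1. cbn [Cprod fold_right] in E1.
    rewrite (E zs H) in E1. fold (Cprod (map (fun g => g zs) l2)) in E1.
    assert (F zs <> C0) by (intros Z; apply N; rewrite E1, Z; ring).
    rewrite map_app, Cprod_app.
    apply (f_equal (Cmul (Cinv (F zs)))) in E1.
    transitivity (Cdiv (Cmul (Cinv (F zs)) (denom 1 zs)) (denom 1 zs)); [|cfield].
    rewrite E1. cfield.
  - apply ratfun_frac, polyfun_Cprod, Forall_app; auto.
Qed.

End Rat.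

Lemma denom_factors_coord n i : (i < n)%nat ->
  Exists (fun g => forall zs, length zs = n -> g zs = nth i zs C0) (denom_factors n).
Proof.
  revert i; induction n; intros [|i] H; [lia|lia|left; auto|].
  right. apply Exists_app. right. specialize (IHn i ltac:(lia)).
  apply Exists_exists in IHn as (g & Hg & E). apply Exists_exists.
  exists (fun zs => g (tl zs)); split;
    [apply (in_map (fun (g : list Cplx -> Cplx) zs => g (tl zs))); exact Hg|].
  intros [|z zs] L; [discriminate|]. simpl. apply E. simpl in L; lia.
Qed.

Lemma denom_factors_diff n i j : (i < j < n)%nat ->
  Exists (fun g => forall zs, length zs = n -> g zs = Csub (nth i zs C0) (nth j zs C0))
    (denom_factors n).
Proof.
  revert i j; induction n; intros [|i] [|j] H; try lia.
  - right. apply Exists_app. left. apply Exists_exists.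
    exists (fun zs => Csub (nth 0 zs C0) (nth (S j) zs C0)); split; [|auto].
    apply (in_map (fun j zs => Csub (nth 0 zs C0) (nth (S j) zs C0))), in_seq. lia.
  - right. apply Exists_app. right. specialize (IHn i j ltac:(lia)).
    apply Exists_exists in IHn as (g & Hg & E). apply Exists_exists.
    exists (fun zs => g (tl zs)); split;
    [apply (in_map (fun (g : list Cplx -> Cplx) zs => g (tl zs))); exact Hg|].
    intros [|z zs] L; [discriminate|]. simpl. apply E. simpl in L; lia.
Qed.

Lemma ratfun_coord_inv n i : (i < n)%nat -> ratfun n (fun zs => Cinv (nth i zs C0)).
Proof. intros H. apply ratfun_inv_factor, denom_factors_coord, H. Qed.

Lemma ratfun_coord_Cpowz n i a : (i < n)%nat -> ratfun n (fun zs => Cpowz (nth i zs C0) a).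
Proof.
  intros H. destruct a as [|p|p]; simpl; [apply ratfun_const|apply ratfun_pow, ratfun_coord|].
  apply ratfun_ext with (fun zs => Cpow (Cinv (nth i zs C0)) (Pos.to_nat p)).
  - intros zs L D. apply Cpow_inv. intros E. unfold nondeg in D. inversion_clear D as [|? ? D0 _].
    apply D0. rewrite <- E. apply nth_In. lia.
  - apply ratfun_pow, ratfun_coord_inv, H.
Qed.

Lemma ratfun_diff_inv n i j : (i < n)%nat -> (j < n)%nat -> i <> j ->
  ratfun n (fun zs => Cinv (Csub (nth i zs C0) (nth j zs C0))).
Proof.
  intros Hi Hj N. destruct (Nat.lt_ge_cases i j) as [L|L].
  - apply ratfun_inv_factor, denom_factors_diff; lia.
  - apply ratfun_ext with (fun zs => Cmul (Copp C1) (Cinv (Csub (nth j zs C0) (nth i zs C0)))).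
    + intros zs _ _. replace (Csub (nth i zs C0) (nth j zs C0))
        with (Cmul (Copp C1) (Csub (nth j zs C0) (nth i zs C0))) by ring.
      rewrite Cinv_mul. f_equal. apply Cplx_ext; simpl; field.
    + apply ratfun_mul; [apply ratfun_const|apply ratfun_inv_factor, denom_factors_diff; lia].
Qed.

Lemma nondeg_nth zs i j : nondeg zs -> (i < length zs)%nat -> (j < length zs)%nat ->
  nth i zs C0 <> C0 /\ (i <> j -> nth i zs C0 <> nth j zs C0).
Proof.
  intros D Hi Hj. unfold nondeg in D. inversion_clear D as [|? ? D0 D1]. split.
  - intros E. apply D0. rewrite <- E. apply nth_In; auto.
  - intros N E. apply N. exact (proj1 (NoDup_nth zs C0) D1 i j Hi Hj E).
Qed.

(** * Substitution of inverses into rational functions *)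

Section Subst.
Variable n : nat.

Lemma ratfun_monom gs es : Forall (ratfun n) gs ->
  ratfun n (fun zs => monom (map (fun g => g zs) gs) es).
Proof.
  intros H. revert es; induction H as [|g gs Hg _ IH]; intros [|e es]; try apply (ratfun_const n C1).
  apply (ratfun_mul n (fun zs => Cpow (g zs) e) (fun zs => monom (map (fun g => g zs) gs) es));
    auto. apply ratfun_pow; auto.
Qed.

Lemma ratfun_denom_inv gs :
  Forall (fun g => ratfun n (fun zs => Cinv (g zs))) gs ->
  ForallOrdPairs (fun g h => ratfun n (fun zs => Cinv (Csub (g zs) (h zs)))) gs ->
  ratfun n (fun zs => Cinv (denom 1 (map (fun g => g zs) gs))).
Proof.
  intros H1 H2. induction H2 as [|g gs Hg _ IH].
  - apply (ratfun_const n (Cinv C1)).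
  - inversion_clear H1 as [|? ? Hi H1']. specialize (IH H1'). cbn [map denom].
    apply ratfun_ext with (fun zs => Cmul (Cinv (g zs))
       (Cmul (Cinv (Cprod (map (fun h => Csub (g zs) (h zs)) gs)))
             (Cinv (denom 1 (map (fun g => g zs) gs))))).
    + intros zs _ _. rewrite <- !Cinv_mul. f_equal. simpl. rewrite map_map.
      fold (Cprod (map (fun x => Cmul (Csub (g zs) (x zs)) C1) gs)).
      rewrite (map_ext (fun x => Cmul (Csub (g zs) (x zs)) C1) (fun x => Csub (g zs) (x zs)))
        by (intros; ring). ring.
    + apply ratfun_mul; auto. apply ratfun_mul; auto. clear - Hg.
      induction Hg as [|h gs Hh _ IH]; [apply (ratfun_const n (Cinv C1))|].
      apply ratfun_ext with (fun zs => Cmul (Cinv (Csub (g zs) (h zs)))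
         (Cinv (Cprod (map (fun h => Csub (g zs) (h zs)) gs)))).
      * intros. rewrite <- Cinv_mul. reflexivity.
      * apply ratfun_mul; auto.
Qed.

Lemma ForallOrdPairs_map_NoDup {X Y} (R : Y -> Y -> Prop) (f : X -> Y) l : NoDup l ->
  (forall x y, In x l -> In y l -> x <> y -> R (f x) (f y)) -> ForallOrdPairs R (map f l).
Proof.
  induction 1 as [|x l Hx _ IH]; intros H; simpl; constructor.
  - apply Forall_forall. intros z Hz. apply in_map_iff in Hz as (y & <- & Hy).
    apply H; simpl; auto. intros ->; auto.
  - apply IH. intros; apply H; simpl; auto.
Qed.

Lemma nondeg_rev_inv zs : nondeg zs -> nondeg (rev (map Cinv zs)).
Proof.
  intros D. unfold nondeg in *. inversion_clear D as [|? ? D0 D1].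
  assert (NZ : forall z, In z zs -> z <> C0) by (intros z Hz ->; auto).
  constructor.
  - rewrite <- in_rev. intros Hi. apply in_map_iff in Hi as (z & Hz & Hi).
    exact (Cinv_neq0 z (NZ z Hi) Hz).
  - apply NoDup_rev. apply NoDup_map_NoDup_ForallPairs; auto.
    intros x y Hx Hy E. apply Cinv_inj; auto.
Qed.

(** The substituted denominator has factors 1/z_i and 1/z_i - 1/z_j = (z_j - z_i)/(z_i z_j), whose
    inverses again have poles only at z_i = 0 and z_i = z_j. *)
Lemma ratfun_rev_inv F : ratfun n F -> ratfun n (fun zs => F (rev (map Cinv zs))).
Proof.
  intros (P & N & HP).
  set (gs := map (fun i (zs : list Cplx) => Cinv (nth i zs C0)) (rev (seq 0 n))).
  assert (Egs : forall zs, length zs = n -> rev (map Cinv zs) = map (fun g => g zs) gs).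
  { intros zs H. unfold gs. rewrite map_map, <- H, map_rev.
    rewrite <- (map_nth_seq zs) at 1. rewrite map_map. reflexivity. }
  assert (I : forall i, In i (rev (seq 0 n)) -> (i < n)%nat).
  { intros i Hi. rewrite <- in_rev in Hi. apply in_seq in Hi. lia. }
  apply ratfun_ext with (fun zs => Cmul (peval P (map (fun g => g zs) gs))
     (Cpow (Cinv (denom 1 (map (fun g => g zs) gs))) N)).
  - intros zs H D. assert (D' := nondeg_rev_inv zs D).
    rewrite HP by (auto; rewrite length_rev, length_map; auto).
    rewrite <- Egs by auto. assert (D1 := denom_neq0 1 _ D').
    rewrite Cpow_inv, <- denom_pow by auto. reflexivity.
  - apply ratfun_mul.
    + apply ratfun_Csum. intros p _. apply ratfun_mul; [apply ratfun_const|].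
      apply ratfun_monom, Forall_forall. intros g Hg. apply in_map_iff in Hg as (i & <- & Hi).
      apply ratfun_coord_inv; auto.
    + apply ratfun_pow, ratfun_denom_inv.
      * apply Forall_forall. intros g Hg. apply in_map_iff in Hg as (i & <- & Hi).
        apply ratfun_ext with (fun zs => nth i zs C0); [|apply ratfun_coord].
        intros zs H D. specialize (I i Hi). rewrite <- H in I.
        destruct (nondeg_nth zs i i D I I) as [E _]. cfield.
      * apply ForallOrdPairs_map_NoDup; [apply NoDup_rev, seq_NoDup|].
        intros i j Hi Hj Nij.
        apply ratfun_ext with (fun zs => Cmul (Cmul (nth i zs C0) (nth j zs C0))
            (Cinv (Csub (nth j zs C0) (nth i zs C0)))).
        -- intros zs H D. assert (Ii := I i Hi). assert (Ij := I j Hj). rewrite <- H in Ii, Ij.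
           destruct (nondeg_nth zs i j D Ii Ij) as [Ei Eij].
           destruct (nondeg_nth zs j i D Ij Ii) as [Ej _].
           specialize (Eij Nij).
           assert (Csub (nth j zs C0) (nth i zs C0) <> C0) by (apply Csub_neq0; auto).
           replace (Csub (Cinv (nth i zs C0)) (Cinv (nth j zs C0)))
             with (Cmul (Csub (nth j zs C0) (nth i zs C0)) (Cinv (Cmul (nth i zs C0) (nth j zs C0))))
             by cfield.
           rewrite !Cinv_mul. cfield.
        -- apply ratfun_mul; [apply ratfun_mul; apply ratfun_coord|].
           apply ratfun_diff_inv; auto.
Qed.

End Subst.

(** * Rational series *)

(** [rational_series] with the sum named, so that it can be followed through linear combinations and
    substitutions. *)
Definition ratsum (n : nat) (region : list Cplx -> Prop)
    (term : list Cplx -> list Z -> Cplx) (F : list Cplx -> Cplx) : Prop :=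
  ratfun n F /\ forall zs, length zs = n -> region zs -> abs_sum_to n (term zs) (F zs).

Lemma rational_series_ratsum n (region : list Cplx -> Prop) term :
  (forall zs, region zs -> nondeg zs) ->
  rational_series n region term <-> exists F, ratsum n region term F.
Proof.
  intros HR. split.
  - intros (P & N & H). exists (fun zs => Cdiv (peval P zs) (denom N zs)). split; auto.
    exists P, N. auto.
  - intros (F & (P & N & HF) & H). exists P, N. intros zs L R. rewrite <- HF by auto. auto.
Qed.

(** Comparing all pairs instead of neighbours makes reversal of the chain and distinctness of its
    entries immediate. *)
Lemma norm_chain_sorted zs :
  norm_chain zs <-> StronglySorted (fun a b => Cnorm a > Cnorm b) zs /\ Forall (fun a => Cnorm a > 0) zs.
Proof.
  induction zs as [|z [|z' zs] IH].
  - simpl. split; [split; constructor|auto].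
  - simpl. split; [intros; repeat constructor; auto|].
    intros [_ H]; inversion_clear H; auto.
  - change (norm_chain (z :: z' :: zs)) with (Cnorm z > Cnorm z' /\ norm_chain (z' :: zs)).
    rewrite IH. split.
    + intros (H & S & P). inversion_clear P as [|? ? P1 P2]. inversion_clear S as [|? ? S1 S2].
      repeat constructor; auto; [|lra]. eapply Forall_impl; [|exact S2]. simpl; intros; lra.
    + intros (S & P). inversion_clear P as [|? ? P1 P2]. inversion_clear S as [|? ? S1 S2].
      inversion_clear S2; auto.
Qed.

Lemma StronglySorted_app_last {X} (R : X -> X -> Prop) l a :
  StronglySorted R l -> Forall (fun x => R x a) l -> StronglySorted R (l ++ [a]).
Proof.
  induction 1 as [|x l S IH F]; intros H; simpl; [repeat constructor|].
  inversion_clear H. constructor; auto. apply Forall_app; auto.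
Qed.

Lemma norm_chain_rev_inv zs : norm_chain zs -> norm_chain (rev (map Cinv zs)).
Proof.
  rewrite !norm_chain_sorted. intros (S & P).
  assert (NZ : Forall (fun a => Cnorm (Cinv a) = / Cnorm a /\ / Cnorm a > 0) zs).
  { eapply Forall_impl; [|exact P]. simpl. intros a Ha. split.
    - apply Cnorm_inv, Cnorm_gt0_neq; lra.
    - apply Rinv_0_lt_compat; lra. }
  split.
  - induction S as [|z zs S IH F]; simpl; [constructor|].
    inversion_clear NZ as [|? ? [N1 N2] NZ']. inversion_clear P as [|? ? P1 P2].
    apply StronglySorted_app_last; auto.
    apply Forall_rev, Forall_map. rewrite Forall_forall in NZ', P2, F.
    apply Forall_forall. intros y Hy. destruct (NZ' y Hy) as [N3 _]. rewrite N1, N3.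
    apply Rinv_lt_contravar; [|apply F; auto].
    apply Rmult_lt_0_compat; [apply P2; auto|lra].
  - apply Forall_rev, Forall_map. eapply Forall_impl; [|exact NZ].
    simpl. intros a [-> H]; auto.
Qed.

Lemma norm_chain_nondeg zs : norm_chain zs -> nondeg zs.
Proof.
  rewrite norm_chain_sorted. intros (S & P). constructor.
  - intros Hi. rewrite Forall_forall in P. specialize (P _ Hi). rewrite Cnorm_C0 in P. lra.
  - clear P. induction S as [|z zs S IH F]; constructor; auto; clear IH.
    intros Hi. rewrite Forall_forall in F. specialize (F _ Hi). lra.
Qed.

Lemma iter_region_neq z1 z2 : iter_region [z1; z2] -> z1 <> C0 /\ z2 <> C0 /\ Csub z1 z2 <> C0.
Proof.
  intros [H1 H2]. assert (Csub z1 z2 <> C0) by (apply Cnorm_gt0_neq; lra).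
  repeat split; auto.
  - intros ->. replace (Csub C0 z2) with (Copp z2) in * by ring. rewrite Cnorm_opp in *. lra.
  - intros ->. rewrite Cnorm_C0 in H1. lra.
Qed.

Lemma iter_region_nondeg zs : iter_region zs -> nondeg zs.
Proof.
  destruct zs as [|z1 [|z2 [|]]]; try (intros H; exact (False_ind _ H)).
  intros H. destruct (iter_region_neq z1 z2 H) as (N1 & N2 & N3).
  unfold nondeg. rewrite !NoDup_cons_iff. simpl. repeat split; try tauto; try constructor.
  intros [E|[]]. apply N3. rewrite E. ring.
Qed.

(** * Vector spaces and gradings *)

Section VectorSpace.
Variable V : VSpace.
Hypothesis HV : is_vspace V.
Implicit Types x y z : V.

Lemma vadd_assoc x y z : vadd x (vadd y z) = vadd (vadd x y) z.
Proof. apply HV. Qed.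
Lemma vadd_comm x y : vadd x y = vadd y x.
Proof. apply HV. Qed.
Lemma vadd_0l x : vadd vzero x = x.
Proof. apply HV. Qed.
Lemma vadd_0r x : vadd x vzero = x.
Proof. rewrite vadd_comm. apply vadd_0l. Qed.
Lemma vsub_diag x : vsub x x = vzero.
Proof. apply HV. Qed.
Lemma vscal_1 x : vscal C1 x = x.
Proof. apply HV. Qed.
Lemma vscal_mul a b x : vscal a (vscal b x) = vscal (Cmul a b) x.
Proof. apply HV. Qed.
Lemma vscal_addr a x y : vscal a (vadd x y) = vadd (vscal a x) (vscal a y).
Proof. apply HV. Qed.
Lemma vscal_addl a b x : vscal (Cadd a b) x = vadd (vscal a x) (vscal b x).
Proof. apply HV. Qed.

Lemma vscal_0 x : vscal C0 x = vzero.
Proof.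
  rewrite <- (vsub_diag x). unfold vsub. rewrite <- (vscal_1 x) at 2.
  rewrite <- vscal_addl. f_equal. ring.
Qed.

Lemma vscal_vzero a : vscal a (vzero : V) = vzero.
Proof. rewrite <- (vscal_0 vzero) at 1. rewrite vscal_mul. replace (Cmul a C0) with C0 by ring. apply vscal_0. Qed.

Lemma vsub_add x y : vadd (vsub x y) y = x.
Proof.
  unfold vsub. rewrite <- vadd_assoc, (vadd_comm _ y).
  fold (vsub y y). rewrite vsub_diag. apply vadd_0r.
Qed.

Lemma vsub_eq x y z : vsub x y = z -> x = vadd z y.
Proof. intros <-. symmetry; apply vsub_add. Qed.

Lemma vsub_eq0 x y : vsub x y = vzero -> x = y.
Proof. intros H. apply vsub_eq in H. rewrite H. apply vadd_0l. Qed.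

Lemma vsub_scal a b x : vsub (vscal a x) (vscal b x) = vscal (Csub a b) x.
Proof.
  unfold vsub. rewrite vscal_mul, <- vscal_addl. f_equal. ring.
Qed.

Lemma vscal_eq0 a x : a <> C0 -> vscal a x = vzero -> x = vzero.
Proof.
  intros Ha H. rewrite <- (vscal_1 x). replace C1 with (Cmul (Cinv a) a) by (field; auto).
  rewrite <- vscal_mul, H. apply vscal_vzero.
Qed.

Lemma vadd_perm4 x y z w : vadd (vadd x y) (vadd z w) = vadd (vadd x z) (vadd y w).
Proof.
  rewrite <- !vadd_assoc. f_equal. rewrite !vadd_assoc. f_equal. apply vadd_comm.
Qed.

Section Sums.
Context {X : Type}.
Implicit Types (l : list X) (f g : X -> V).

Lemma vsum_ext l f g : (forall i, In i l -> f i = g i) -> vsum l f = vsum l g.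
Proof. unfold vsum. induction l as [|i l IH]; simpl; intros H; auto. rewrite H, IH by auto. reflexivity. Qed.

Lemma vsum_0 l f : (forall i, In i l -> f i = vzero) -> vsum l f = vzero.
Proof.
  unfold vsum. induction l as [|i l IH]; simpl; intros H; auto. rewrite H, IH by auto. apply vadd_0l.
Qed.

Lemma vsum_add l f g : vsum l (fun i => vadd (f i) (g i)) = vadd (vsum l f) (vsum l g).
Proof.
  unfold vsum. induction l; simpl; [symmetry; apply vadd_0l|].
  rewrite IHl. apply vadd_perm4.
Qed.

Lemma vsum_app l1 l2 f : vsum (l1 ++ l2) f = vadd (vsum l1 f) (vsum l2 f).
Proof.
  unfold vsum. induction l1; simpl; [symmetry; apply vadd_0l|]. rewrite IHl1. apply vadd_assoc.
Qed.

Lemma vsum_single l m f : NoDup l -> In m l -> (forall i, In i l -> i <> m -> f i = vzero) ->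
  vsum l f = f m.
Proof.
  induction 1 as [|x l Hx _ IH]; intros Hm H; [destruct Hm|].
  change (vsum (x :: l) f) with (vadd (f x) (vsum l f)).
  destruct (eq_dec_classic x m) as [->|N].
  - rewrite vsum_0; [apply vadd_0r|]. intros y Hy. apply H; [right; auto|]. intros ->; auto.
  - rewrite (H x (or_introl eq_refl) N), vadd_0l. apply IH.
    + destruct Hm; [congruence|auto].
    + intros y Hy. apply H; right; auto.
Qed.
End Sums.

Lemma vsum_seq_le m n (f : nat -> V) :
  (m <= n)%nat -> (forall j, (m <= j)%nat -> f j = vzero) ->
  vsum (seq 0 n) f = vsum (seq 0 m) f.
Proof.
  intros H Hf. replace n with (m + (n - m))%nat by lia. rewrite seq_app, vsum_app.
  rewrite (vsum_0 (seq (0 + m) (n - m))); [apply vadd_0r|]. intros x Hx. apply in_seq in Hx. apply Hf; lia.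
Qed.

Lemma fsum_eq (f : nat -> V) N : (forall j, (N <= j)%nat -> f j = vzero) ->
  fsum f = vsum (seq 0 N) f.
Proof.
  intros H. unfold fsum. destruct excluded_middle_informative as [e|n].
  - destruct constructive_indefinite_description as [M HM]; simpl.
    destruct (Nat.le_ge_cases M N).
    + symmetry. apply vsum_seq_le; auto.
    + apply vsum_seq_le; auto.
  - exfalso; eauto.
Qed.

End VectorSpace.

Lemma is_linfun_comp {V W : VSpace} (f : V -> W) (g : W -> Cplx) :
  is_lin f -> is_linfun g -> is_linfun (fun x => g (f x)).
Proof. intros [A B] [A' B']. split; intros; [rewrite A, A'|rewrite B, B']; reflexivity. Qed.

Lemma is_lin_iter {V : VSpace} (f : V -> V) n : is_lin f -> is_lin (Nat.iter n f).
Proof.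
  intros [A B]. induction n as [|n [IA IB]]; [split; auto|].
  split; intros; simpl; [rewrite IA, A|rewrite IB, B]; reflexivity.
Qed.

Section Linear.
Variables V W : VSpace.
Hypotheses (HV : is_vspace V) (HW : is_vspace W).

Lemma lin_0 (f : V -> W) : is_lin f -> f vzero = vzero.
Proof.
  intros [_ B]. rewrite <- (vscal_0 V HV vzero), B. apply vscal_0; auto.
Qed.

Lemma lin_sub (f : V -> W) x y : is_lin f -> f (vsub x y) = vsub (f x) (f y).
Proof. intros [A B]. unfold vsub. rewrite A, B. reflexivity. Qed.

Lemma lin_vsum {X} (f : V -> W) (l : list X) h : is_lin f ->
  f (vsum l h) = vsum l (fun x => f (h x)).
Proof.
  intros L. unfold vsum. induction l; simpl; [apply lin_0; auto|].
  rewrite (proj1 L), IHl. reflexivity.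
Qed.

Lemma linfun_0 (f : V -> Cplx) : is_linfun f -> f vzero = C0.
Proof. intros [_ B]. rewrite <- (vscal_0 V HV vzero), B. ring. Qed.

Lemma linfun_sub (f : V -> Cplx) x y : is_linfun f -> f (vsub x y) = Csub (f x) (f y).
Proof. intros [A B]. unfold vsub. rewrite A, B. ring. Qed.

Lemma linfun_vsum {X} (f : V -> Cplx) (l : list X) h : is_linfun f ->
  f (vsum l h) = Csum l (fun x => f (h x)).
Proof.
  intros L. unfold vsum. induction l; simpl; [apply linfun_0; auto|].
  rewrite (proj1 L), IHl. reflexivity.
Qed.

Lemma is_lin_scal c (f : V -> W) : is_lin f -> is_lin (fun x => vscal c (f x)).
Proof.
  intros [A B]. split; intros.
  - rewrite A, vscal_addr; auto.
  - rewrite B, !vscal_mul by auto. f_equal. ring.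
Qed.
End Linear.

Lemma is_lin_sub {V W : VSpace} (HW : is_vspace W) (f g : V -> W) :
  is_lin f -> is_lin g -> is_lin (fun x => vsub (f x) (g x)).
Proof.
  intros [A B] [A' B']. split; intros; unfold vsub.
  - rewrite A, A', vscal_addr by auto. apply vadd_perm4; auto.
  - rewrite B, B', vscal_addr, !vscal_mul by auto. do 2 f_equal. ring.
Qed.

(** * Gradings and their degree operators *)

Section GradingTheory.
Variables (I : Type) (V : VSpace) (HV : is_vspace V) (g : Grading I V) (Hg : is_grading g).
Variables (emb : I -> Cplx) (emb_inj : forall i j, emb i = emb j -> i = j).

Definition hom (n : I) (v : V) : Prop := gproj g n v = v.

Lemma gproj_lin n : is_lin (gproj g n).
Proof. apply Hg. Qed.
Lemma gproj_hom n v : hom n (gproj g n v).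
Proof. apply Hg. Qed.
Lemma gproj_neq n m v : n <> m -> gproj g n (gproj g m v) = vzero.
Proof. apply Hg. Qed.
Lemma gsupp_nodup v : NoDup (gsupp g v).
Proof. apply Hg. Qed.
Lemma gsupp_sum v : v = vsum (gsupp g v) (fun n => gproj g n v).
Proof. apply Hg. Qed.

Lemma hom_neq n m v : hom n v -> m <> n -> gproj g m v = vzero.
Proof. intros <- H. apply gproj_neq; auto. Qed.

Lemma gsupp_out n v : ~ In n (gsupp g v) -> gproj g n v = vzero.
Proof.
  intros H. rewrite (gsupp_sum v), (lin_vsum V V) by (auto using gproj_lin).
  apply vsum_0; auto. intros m Hm. apply gproj_neq. intros ->; auto.
Qed.

Lemma gproj_sep x y : (forall n, gproj g n x = gproj g n y) -> x = y.
Proof.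
  intros H. apply vsub_eq0; auto. rewrite (gsupp_sum (vsub x y)).
  apply vsum_0; auto. intros n _.
  rewrite (lin_sub V V), H by apply gproj_lin. apply vsub_diag; auto.
Qed.

Lemma hom_0 n : hom n vzero.
Proof. apply (lin_0 V V); auto using gproj_lin. Qed.
(** A vector is the finite sum of its components; [n0] gives a degree to the zero vector, which is
    the empty sum. *)
Lemma hom_ind (n0 : I) (P : V -> Prop) :
  (forall n v, hom n v -> P v) -> (forall x y, P x -> P y -> P (vadd x y)) ->
  forall v, P v.
Proof.
  intros H1 H2 v. rewrite (gsupp_sum v). generalize (gsupp g v). intros l.
  unfold vsum. induction l as [|n l IH]; simpl.
  - apply (H1 n0), hom_0.
  - apply H2; auto. apply (H1 n), gproj_hom.
Qed.

Lemma gproj_degop n v : gproj g n (degop emb g v) = vscal (emb n) (gproj g n v).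
Proof.
  unfold degop. rewrite (lin_vsum V V) by (auto using gproj_lin).
  rewrite (vsum_ext V _ _ (fun m => vscal (emb m) (gproj g n (gproj g m v))))
    by (intros; apply gproj_lin).
  destruct (classic (In n (gsupp g v))) as [Hn|Hn].
  - rewrite (vsum_single V HV _ n); auto using gsupp_nodup.
    + f_equal. apply gproj_hom.
    + intros m _ Hm. rewrite gproj_neq by auto. apply vscal_vzero; auto.
  - rewrite gsupp_out, vscal_vzero by auto. apply vsum_0; auto.
    intros m Hm. rewrite gproj_neq, vscal_vzero by (auto || intros ->; auto). reflexivity.
Qed.

Lemma degop_hom n v : hom n v -> degop emb g v = vscal (emb n) v.
Proof.
  intros H. apply gproj_sep. intros m. rewrite gproj_degop, (proj2 (gproj_lin m)).
  destruct (eq_dec_classic m n) as [->|N]; auto.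
  rewrite (hom_neq n m v), !vscal_vzero by auto. reflexivity.
Qed.

(** Since [emb] is injective, distinct degrees are distinct eigenvalues of the degree operator, so
    its eigenvectors are homogeneous. Weights of modes are read off from commutators in this way. *)
Lemma hom_of_degop n v : degop emb g v = vscal (emb n) v -> hom n v.
Proof.
  intros H. apply gproj_sep. intros m.
  destruct (eq_dec_classic m n) as [->|N]; [apply gproj_hom|].
  rewrite gproj_neq by auto. symmetry.
  apply (vscal_eq0 V HV (Csub (emb m) (emb n))).
  - apply Csub_neq0; auto.
  - rewrite <- vsub_scal, <- gproj_degop, H, (proj2 (gproj_lin m)) by auto.
    apply vsub_diag; auto.
Qed.

Lemma degop_lin : is_lin (degop emb g).
Proof.
  split.
  - intros x y. apply gproj_sep. intros n.
    rewrite gproj_degop, !(proj1 (gproj_lin n)), !gproj_degop. apply vscal_addr; auto.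
  - intros c x. apply gproj_sep. intros n.
    rewrite gproj_degop, !(proj2 (gproj_lin n)), gproj_degop, !vscal_mul by auto.
    f_equal. ring.
Qed.

Lemma hom_comm_degop (A : V -> V) n v : is_lin A ->
  A (degop emb g v) = degop emb g (A v) -> hom n v -> hom n (A v).
Proof.
  intros L E H. apply hom_of_degop. rewrite <- E, (degop_hom n) by auto. apply L.
Qed.
End GradingTheory.

Arguments hom {I V} g n v.

(** * Vertex operators and the action of sl(2) *)

(** Used to absorb one more [L(1)] into a truncated exponential: the first term vanishes through its
    factor 0, the last because [L(1)^K] kills the vector. *)
Lemma Csum_seq_reindex K (f : nat -> Cplx) : f 0%nat = C0 -> f K = C0 ->
  Csum (seq 0 K) (fun i => f (S i)) = Csum (seq 0 K) f.
Proof.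
  intros H0 HK. transitivity (Csum (seq 0 (S K)) f).
  - rewrite Csum_seq_front, H0. ring.
  - rewrite Csum_seq_S, HK. ring.
Qed.

Lemma Cmul_cancel c x y : c <> C0 -> Cmul c x = Cmul c y -> x = y.
Proof.
  intros Hc E. transitivity (Cmul (Cinv c) (Cmul c x)); [field; auto|].
  rewrite E. field; auto.
Qed.

Section MobiusMOSVA.
Variables (V : VAData) (rV : SL2 (va_sp V)).
Hypothesis HM : is_mobius_MOSVA V rV.
Notation Y := (va_Y V).
Notation g := (va_gr V).
Notation A := (va_sp V).
Notation homV := (hom (va_gr V)).

Lemma V_vspace : is_vspace A. Proof. apply HM. Qed.
Lemma V_grading : is_grading g. Proof. apply HM. Qed.
Hint Resolve V_vspace V_grading ZC_inj : core.

Lemma Y_lin_l w k : is_lin (fun u => Y u w k).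
Proof. destruct HM as [(_ & _ & H & _) _]. apply H. Qed.
Lemma Y_lin_r u k : is_lin (fun w => Y u w k).
Proof. destruct HM as [(_ & _ & H & _) _]. apply H. Qed.
Lemma Y_add_l x y w k : Y (vadd x y) w k = vadd (Y x w k) (Y y w k).
Proof. apply (Y_lin_l w k). Qed.
Lemma Y_scal_l c x w k : Y (vscal c x) w k = vscal c (Y x w k).
Proof. apply (Y_lin_l w k). Qed.
Lemma Y_0_l w k : Y vzero w k = vzero.
Proof. apply (lin_0 A A V_vspace V_vspace (fun u => Y u w k)), Y_lin_l. Qed.
Lemma Y_add_r u x y k : Y u (vadd x y) k = vadd (Y u x k) (Y u y k).
Proof. apply (Y_lin_r u k). Qed.
Lemma Y_scal_r u c x k : Y u (vscal c x) k = vscal c (Y u x k).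
Proof. apply (Y_lin_r u k). Qed.
Lemma Y_0_r u k : Y u vzero k = vzero.
Proof. apply (lin_0 A A V_vspace V_vspace (fun w => Y u w k)), Y_lin_r. Qed.
Lemma V_d_Y u v k : vsub (va_d V (Y u v k)) (Y u (va_d V v) k)
  = vadd (vscal (ZC (- k - 1)) (Y u v k)) (Y (va_d V u) v k).
Proof. destruct HM as [(_ & _ & _ & _ & H & _) _]. apply H. Qed.
Lemma V_Y_one_l v k : Y (va_one V) v k = if Z.eq_dec k (-1) then v else vzero.
Proof. destruct HM as [(_ & _ & _ & _ & _ & H & _) _]. apply H. Qed.
Lemma V_Y_one_r u : Y u (va_one V) (-1)%Z = u.
Proof. destruct HM as [(_ & _ & _ & _ & _ & _ & _ & H & _) _]. apply H. Qed.
Lemma V_sl2 : is_sl2 rV. Proof. apply HM. Qed.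
Lemma V_L0 v : L0 rV v = va_d V v. Proof. apply HM. Qed.
Lemma V_Lm1 v : Lm1 rV v = va_D V v. Proof. apply HM. Qed.
Lemma V_L1_Y u w k : vsub (L1 rV (Y u w k)) (Y u (L1 rV w) k)
     = vadd (Y (L1 rV u) w k)
            (vadd (vscal (ZC 2) (Y (L0 rV u) w (k + 1)%Z)) (Y (Lm1 rV u) w (k + 2)%Z)).
Proof. apply HM. Qed.
Lemma V_Y_D v w k : Y (va_D V v) w k = vscal (ZC (- k)) (Y v w (k - 1)%Z).
Proof. destruct HM as [(_ & _ & _ & _ & _ & _ & _ & _ & H & _) _]. apply H. Qed.

Lemma L1_lin : is_lin (L1 rV). Proof. apply V_sl2. Qed.
Lemma D_lin : is_lin (va_D V). Proof. apply Y_lin_l. Qed.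
Lemma V_d_lin : is_lin (va_d V). Proof. apply degop_lin; auto. Qed.

Lemma V_d_hom n v : homV n v -> va_d V v = vscal (ZC n) v.
Proof. apply degop_hom; auto. Qed.
Lemma V_hom_of_d n v : va_d V v = vscal (ZC n) v -> homV n v.
Proof. apply hom_of_degop; auto. Qed.

Lemma Y_hom n1 n2 u v k : homV n1 u -> homV n2 v -> homV (n1 + n2 - k - 1)%Z (Y u v k).
Proof.
  intros Hu Hv. apply V_hom_of_d. assert (E := V_d_Y u v k).
  apply vsub_eq in E; auto. rewrite E, (V_d_hom n1 u Hu), (V_d_hom n2 v Hv).
  rewrite Y_scal_l, Y_scal_r, <- !vscal_addl by auto.
  f_equal. rewrite <- !ZC_add. f_equal. lia.
Qed.

Lemma L1_hom n v : homV n v -> homV (n - 1)%Z (L1 rV v).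
Proof.
  intros H. apply V_hom_of_d. destruct V_sl2 as (_ & _ & L & E & _).
  specialize (E v). rewrite !V_L0 in E. apply vsub_eq in E; auto.
  rewrite E, (V_d_hom n v H), (proj2 L), <- vscal_addl by auto.
  f_equal. rewrite ZC_sub. rewrite ZC_1. ring.
Qed.

Lemma D_hom n v : homV n v -> homV (n + 1)%Z (va_D V v).
Proof.
  intros H. apply V_hom_of_d. destruct V_sl2 as (_ & _ & _ & _ & E & _).
  specialize (E v). rewrite !V_L0, !V_Lm1 in E. apply vsub_eq in E; auto.
  rewrite E, (V_d_hom n v H), (proj2 D_lin).
  transitivity (vadd (vscal C1 (va_D V v)) (vscal (ZC n) (va_D V v)));
    [rewrite vscal_1; auto|].
  rewrite <- vscal_addl by auto. f_equal. rewrite ZC_add. rewrite ZC_1. ring.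
Qed.

Lemma L1_iter_hom n v m : homV n v -> homV (n - Z.of_nat m)%Z (Nat.iter m (L1 rV) v).
Proof.
  intros H. induction m; simpl Nat.iter.
  - rewrite Z.sub_0_r. exact H.
  - replace (n - Z.of_nat (S m))%Z with (n - Z.of_nat m - 1)%Z by lia. apply L1_hom; auto.
Qed.

Lemma V_bounded : exists N, forall n v, homV n v -> (n < N)%Z -> v = vzero.
Proof.
  destruct HM as [(_ & _ & _ & [N H] & _) _]. exists N. intros n v Hv L.
  rewrite <- Hv. auto.
Qed.

(** [L(1)] lowers the weight by one, and the weights of V are bounded below. *)
Lemma L1_iter_trunc u : exists K, forall m, (K <= m)%nat -> Nat.iter m (L1 rV) u = vzero.
Proof.
  destruct V_bounded as [N HN]. revert u.
  apply (hom_ind Z A V_vspace g V_grading 0%Z).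
  - intros n u Hu. exists (Z.to_nat (n - N + 1)). intros m Hm.
    apply (HN _ _ (L1_iter_hom n u m Hu)). lia.
  - intros x y [K HK] [K' HK']. exists (Nat.max K K'). intros m Hm.
    rewrite (proj1 (is_lin_iter _ m L1_lin)), HK, HK' by lia. apply vadd_0l; auto.
Qed.

(** For homogeneous vectors the mode k has weight n + n' - k - 1, which falls below the bound on
    weights once k is large. *)
Lemma Y_trunc u v : exists K, forall k, (K <= k)%Z -> Y u v k = vzero.
Proof.
  destruct V_bounded as [N HN]. revert u.
  apply (hom_ind Z A V_vspace g V_grading 0%Z).
  - intros n u Hu. revert v. apply (hom_ind Z A V_vspace g V_grading 0%Z).
    + intros n' v Hv. exists (n + n' - N)%Z. intros k Hk.
      apply (HN _ _ (Y_hom n n' u v k Hu Hv)). lia.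
    + intros x y [K HK] [K' HK']. exists (Z.max K K'). intros m Hm.
      rewrite Y_add_r, HK, HK' by lia. apply vadd_0l; auto.
  - intros x y [K HK] [K' HK']. exists (Z.max K K'). intros m Hm.
    rewrite Y_add_l, HK, HK' by lia. apply vadd_0l; auto.
Qed.

Lemma one_d : va_d V (va_one V) = vzero.
Proof.
  rewrite <- (V_Y_one_r (va_d V (va_one V))).
  assert (E := V_d_Y (va_one V) (va_one V) (-1)).
  rewrite !V_Y_one_l in E. simpl Z.eq_dec in E. cbn iota in E.
  replace (- -1 - 1)%Z with 0%Z in E by lia.
  rewrite ZC_0, vscal_0, vadd_0l, vsub_diag in E by auto. auto.
Qed.

Lemma one_hom : homV 0%Z (va_one V).
Proof. apply V_hom_of_d. rewrite one_d, ZC_0, vscal_0; auto. Qed.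

Lemma one_D : va_D V (va_one V) = vzero.
Proof. unfold va_D. rewrite V_Y_one_l. reflexivity. Qed.

(** In mode -1 the commutator of [L(1)] with Y(1, x), applied to the vacuum, is zero; on the other
    side only [L(1)] of the vacuum survives, since d and D kill the vacuum. *)
Lemma one_L1 : L1 rV (va_one V) = vzero.
Proof.
  rewrite <- (V_Y_one_r (L1 rV (va_one V))).
  assert (E := V_L1_Y (va_one V) (va_one V) (-1)).
  rewrite V_L0, V_Lm1, one_d, one_D, !V_Y_one_l in E. simpl Z.eq_dec in E. cbn iota in E.
  rewrite vsub_diag in E by auto.
  rewrite !Y_0_l in E.
  rewrite vscal_vzero, !vadd_0r in E by auto. auto.
Qed.

Lemma L1_Y_hom n u w k : homV n u ->
  L1 rV (Y u w k) = vadd (Y u (L1 rV w) k)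
    (vadd (Y (L1 rV u) w k) (vscal (ZC (2 * n - k - 2)) (Y u w (k + 1)%Z))).
Proof.
  intros Hu. assert (E := V_L1_Y u w k). apply vsub_eq in E; auto.
  rewrite E, vadd_comm by auto. f_equal. f_equal.
  rewrite V_L0, V_Lm1, V_Y_D, (V_d_hom n u Hu), Y_scal_l, vscal_mul by auto.
  replace (k + 2 - 1)%Z with (k + 1)%Z by lia. rewrite <- vscal_addl by auto.
  f_equal. rewrite <- ZC_mul, <- ZC_add. f_equal. lia.
Qed.

(** The m commutators [L(1), L(-1)] = 2 L(0) contribute 2 (n - i) for i < m, in total m (2n - m +
    1). At m = 0 the value of [pred] is harmless because this coefficient is zero. *)
Lemma L1_iter_D n u m : homV n u ->
  Nat.iter m (L1 rV) (va_D V u) =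
  vadd (va_D V (Nat.iter m (L1 rV) u))
       (vscal (ZC (Z.of_nat m * (2 * n - Z.of_nat m + 1))) (Nat.iter (pred m) (L1 rV) u)).
Proof.
  intros Hu. induction m.
  - simpl Nat.iter. simpl Z.mul. rewrite ZC_0, vscal_0, vadd_0r; auto.
  - change (Nat.iter (S m) (L1 rV) (va_D V u)) with (L1 rV (Nat.iter m (L1 rV) (va_D V u))).
    rewrite IHm, (proj1 L1_lin), (proj2 L1_lin). simpl pred.
    destruct V_sl2 as (_ & _ & _ & _ & _ & E). specialize (E (Nat.iter m (L1 rV) u)).
    rewrite V_L0, !V_Lm1, (V_d_hom _ _ (L1_iter_hom n u m Hu)) in E.
    symmetry in E.
    assert (E' : L1 rV (va_D V (Nat.iter m (L1 rV) u)) =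
       vadd (va_D V (Nat.iter (S m) (L1 rV) u)) (vscal (ZC (2 * (n - Z.of_nat m))) (Nat.iter m (L1 rV) u))).
    { symmetry in E. apply vsub_eq in E; auto. simpl Nat.iter. rewrite E, vscal_mul by auto.
      rewrite (vadd_comm A) by auto. rewrite vadd_assoc by auto.
      rewrite <- vscal_addl by auto.
      replace (Cadd _ _) with C0; [rewrite vscal_0, vadd_0l; auto|].
      rewrite <- ZC_mul, <- ZC_add. rewrite <- ZC_0. f_equal. lia. }
    rewrite E', <- vadd_assoc by auto. f_equal.
    replace (vscal (ZC (Z.of_nat m * (2 * n - Z.of_nat m + 1))) (L1 rV (Nat.iter (Nat.pred m) (L1 rV) u)))
      with (vscal (ZC (Z.of_nat m * (2 * n - Z.of_nat m + 1))) (Nat.iter m (L1 rV) u)).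
    + rewrite <- vscal_addl by auto. f_equal. rewrite <- ZC_add. f_equal. lia.
    + destruct m; [|reflexivity]. simpl Z.mul. rewrite ZC_0, !vscal_0; auto.
Qed.

(* The coefficients of the conjugation formula
   [e^{xL(1)} Y(u,y) = Y(e^{x(1-xy)L(1)} (1-xy)^{-2L(0)} u, y/(1-xy)) e^{xL(1)}]. *)
Lemma L1_iter_Y n u v k K (f : A -> Cplx) m :
  homV n u -> Nat.iter K (L1 rV) u = vzero -> Nat.iter K (L1 rV) v = vzero ->
  is_linfun f ->
  Cmul (invfact m) (f (Nat.iter m (L1 rV) (Y u v k))) =
  Csum (seq 0 K) (fun i => Csum (seq 0 K) (fun l =>
    Cmul (Cmul (gbz (2 * n - k - 2 - Z.of_nat i) (Z.of_nat m - Z.of_nat i - Z.of_nat l))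
               (Cmul (invfact i) (invfact l)))
         (f (Y (Nat.iter i (L1 rV) u) (Nat.iter l (L1 rV) v)
               (k + Z.of_nat m - Z.of_nat i - Z.of_nat l)%Z)))).
Proof.
  intros Hu Ku Kv Hf.
  destruct K as [|K'].
  { simpl in Ku. subst u. simpl Csum. rewrite Y_0_l.
    rewrite (lin_0 A A) by (auto using is_lin_iter, L1_lin).
    rewrite (linfun_0 A) by auto. ring. }
  set (K := S K') in *.
  revert f Hf. induction m as [|m IH]; intros f Hf.
  - unfold K. rewrite Csum_seq_front, Csum_seq_front.
    rewrite Csum_0, Csum_0.
    + simpl. rewrite gbz_0, invfact_0.
      replace (k + 0 - 0 - 0)%Z with k by lia. ring.
    + intros i _. apply Csum_0. intros l _. rewrite gbz_neg by lia. ring.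
    + intros l _. rewrite gbz_neg by lia. ring.
  - apply (Cmul_cancel (ZC (Z.of_nat m + 1))); [apply ZC_neq0; lia|].
    transitivity (Cmul (invfact m) (f (L1 rV (Nat.iter m (L1 rV) (Y u v k))))).
    { rewrite <- (invfact_S m). simpl Nat.iter. ring. }
    rewrite (IH (fun x => f (L1 rV x))) by (apply is_linfun_comp; auto using L1_lin).
    set (t := fun (i l : nat) z => f (Y (Nat.iter i (L1 rV) u) (Nat.iter l (L1 rV) v) z)).
    assert (tK1 : forall l z, t K l z = C0).
    { intros l z. unfold t. rewrite Ku, Y_0_l. apply linfun_0; auto. }
    assert (tK2 : forall i z, t i K z = C0).
    { intros i z. unfold t. rewrite Kv, Y_0_r. apply linfun_0; auto. }
    assert (tL : forall i l z, f (L1 rV (Y (Nat.iter i (L1 rV) u) (Nat.iter l (L1 rV) v) z))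
       = Cadd (t i (S l) z) (Cadd (t (S i) l z)
           (Cmul (ZC (2 * (n - Z.of_nat i) - z - 2)) (t i l (z + 1)%Z)))).
    { intros i l z. rewrite (L1_Y_hom (n - Z.of_nat i)) by (apply L1_iter_hom; auto).
      rewrite !(proj1 Hf), (proj2 Hf). reflexivity. }
    set (E := (2 * n - k - 2)%Z).
    (* The three families collect the terms where the new [L(1)] acts on the second vector, acts on
       the first, or raises the mode. Indices are shifted so that all of them multiply the same
       [t i l]. *)
    set (F1 := fun i l : nat => Cmul (Cmul (gbz (E - Z.of_nat i) (Z.of_nat m + 1 - Z.of_nat i - Z.of_nat l))
       (Cmul (invfact i) (Cmul (ZC (Z.of_nat l)) (invfact l))))
       (t i l (k + Z.of_nat m + 1 - Z.of_nat i - Z.of_nat l)%Z)).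
    set (F2 := fun i l : nat => Cmul (Cmul (gbz (E - Z.of_nat i + 1) (Z.of_nat m + 1 - Z.of_nat i - Z.of_nat l))
       (Cmul (Cmul (ZC (Z.of_nat i)) (invfact i)) (invfact l)))
       (t i l (k + Z.of_nat m + 1 - Z.of_nat i - Z.of_nat l)%Z)).
    set (F3 := fun i l : nat => Cmul (Cmul (gbz (E - Z.of_nat i) (Z.of_nat m - Z.of_nat i - Z.of_nat l))
       (Cmul (invfact i) (invfact l)))
       (Cmul (ZC (2 * (n - Z.of_nat i) - (k + Z.of_nat m - Z.of_nat i - Z.of_nat l) - 2))
             (t i l (k + Z.of_nat m + 1 - Z.of_nat i - Z.of_nat l)%Z))).
    transitivity (Cadd (Csum (seq 0 K) (fun i => Csum (seq 0 K) (F1 i)))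
      (Cadd (Csum (seq 0 K) (fun i => Csum (seq 0 K) (F2 i)))
            (Csum (seq 0 K) (fun i => Csum (seq 0 K) (F3 i))))).
    + transitivity (Csum (seq 0 K) (fun i => Csum (seq 0 K) (fun l =>
        Cadd (F1 i (S l)) (Cadd (F2 (S i) l) (F3 i l))))).
      * apply Csum_ext; intros i _. apply Csum_ext; intros l _. rewrite tL.
        unfold F1, F2, F3.
        replace (Z.of_nat (S l)) with (Z.of_nat l + 1)%Z by lia.
        replace (Z.of_nat (S i)) with (Z.of_nat i + 1)%Z by lia.
        rewrite !invfact_S.
        replace (Z.of_nat m + 1 - Z.of_nat i - (Z.of_nat l + 1))%Z
          with (Z.of_nat m - Z.of_nat i - Z.of_nat l)%Z by lia.
        replace (Z.of_nat m + 1 - (Z.of_nat i + 1) - Z.of_nat l)%Z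
          with (Z.of_nat m - Z.of_nat i - Z.of_nat l)%Z by lia.
        replace (k + Z.of_nat m + 1 - Z.of_nat i - (Z.of_nat l + 1))%Z
          with (k + Z.of_nat m - Z.of_nat i - Z.of_nat l)%Z by lia.
        replace (k + Z.of_nat m + 1 - (Z.of_nat i + 1) - Z.of_nat l)%Z
          with (k + Z.of_nat m - Z.of_nat i - Z.of_nat l)%Z by lia.
        replace (E - (Z.of_nat i + 1) + 1)%Z with (E - Z.of_nat i)%Z by lia.
        replace (k + Z.of_nat m - Z.of_nat i - Z.of_nat l + 1)%Z
          with (k + Z.of_nat m + 1 - Z.of_nat i - Z.of_nat l)%Z by lia.
        ring.
      * transitivity (Csum (seq 0 K) (fun i => Cadd (Csum (seq 0 K) (F1 i))
          (Cadd (Csum (seq 0 K) (F2 (S i))) (Csum (seq 0 K) (F3 i))))).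
        { apply Csum_ext; intros i _. rewrite !Csum_add. f_equal.
          apply (Csum_seq_reindex K (F1 i)); unfold F1; [simpl Z.of_nat; rewrite ZC_0|rewrite tK2]; ring. }
        rewrite !Csum_add. f_equal. f_equal.
        apply (Csum_seq_reindex K (fun i => Csum (seq 0 K) (F2 i)));
          apply Csum_0; intros l _; unfold F2; [simpl Z.of_nat; rewrite ZC_0|rewrite tK1]; ring.
    + rewrite <- !Csum_add, <- Csum_scal. apply Csum_ext; intros i _.
      rewrite <- !Csum_add, <- Csum_scal. apply Csum_ext; intros l _.
      fold E. unfold F1, F2, F3.
      replace (Z.of_nat (S m)) with (Z.of_nat m + 1)%Z by lia.
      replace (k + (Z.of_nat m + 1) - Z.of_nat i - Z.of_nat l)%Z
        with (k + Z.of_nat m + 1 - Z.of_nat i - Z.of_nat l)%Z by lia.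
      fold (t i l (k + Z.of_nat m + 1 - Z.of_nat i - Z.of_nat l)%Z).
      rewrite gbz_pascal.
      set (z := (Z.of_nat m + 1 - Z.of_nat i - Z.of_nat l)%Z).
      replace (Z.of_nat m - Z.of_nat i - Z.of_nat l)%Z with (z - 1)%Z by lia.
      set (X := (E - Z.of_nat i)%Z).
      replace (ZC (2 * (n - Z.of_nat i) - (k + Z.of_nat m - Z.of_nat i - Z.of_nat l) - 2))
        with (Csub (ZC (X - z + 1)) (ZC (Z.of_nat i))) by (rewrite <- ZC_sub; f_equal; lia).
      replace (ZC (Z.of_nat m + 1)) with (Cadd (ZC z) (Cadd (ZC (Z.of_nat i)) (ZC (Z.of_nat l))))
        by (rewrite <- !ZC_add; f_equal; lia).
      (* The term - i coming from the weight of [L(1)^i u] cancels against Pascal's rule; absorption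
         then turns the rest into z times the binomial, and z + i + l = m + 1. *)
      assert (Ab := gbz_absorb X z).
      transitivity (Cadd (Cmul (Cmul (Cmul (ZC (X - z + 1)) (gbz X (z - 1))) (Cmul (invfact i) (invfact l)))
          (t i l (k + Z.of_nat m + 1 - Z.of_nat i - Z.of_nat l)%Z))
        (Cmul (Cmul (Cmul (Cadd (ZC (Z.of_nat i)) (ZC (Z.of_nat l))) (gbz X z)) (Cmul (invfact i) (invfact l)))
          (t i l (k + Z.of_nat m + 1 - Z.of_nat i - Z.of_nat l)%Z))); [ring|].
      rewrite <- Ab. ring.
Qed.

End MobiusMOSVA.

(** * Modules and opposite vertex operators *)

Ltac ZC_push :=
  repeat first [rewrite ZC_sub | rewrite ZC_add | rewrite ZC_opp | rewrite ZC_mul];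
  rewrite ?ZC_1.

Lemma Csum_support {X} (l l' : list X) (f : X -> Cplx) : NoDup l -> NoDup l' ->
  (forall x, In x l -> ~ In x l' -> f x = C0) ->
  (forall x, In x l' -> ~ In x l -> f x = C0) -> Csum l f = Csum l' f.
Proof.
  intros N N' H H'.
  rewrite <- (Csum_filter l f (pbool (fun x => In x l'))),
    <- (Csum_filter l' f (pbool (fun x => In x l))).
  - apply Csum_perm, NoDup_Permutation; try (apply NoDup_filter; auto).
    intros x. rewrite !filter_In, !pbool_true. tauto.
  - intros x Hx Hb. apply pbool_false in Hb. auto.
  - intros x Hx Hb. apply pbool_false in Hb. auto.
Qed.

(** Generalized eigenspaces for distinct eigenvalues meet in zero. By induction on [m] the vector (L
    - c) x vanishes, and then L - c' acts on x by the nonzero scalar c - c'. *)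
Lemma lin_iter_eigen {V : VSpace} (HV : is_vspace V) (L : V -> V) (c c' : Cplx) m p x :
  is_lin L -> c <> c' ->
  Nat.iter m (fun y => vsub (L y) (vscal c y)) x = vzero ->
  Nat.iter p (fun y => vsub (L y) (vscal c' y)) x = vzero -> x = vzero.
Proof.
  intros HL N. revert x. induction m as [|m IH]; intros x H1 H2; [exact H1|].
  assert (Lc : forall c, is_lin (fun y => vsub (L y) (vscal c y))).
  { intros b. apply (is_lin_sub HV L (fun y => vscal b y)); auto. apply (is_lin_scal V V HV b (fun y => y)). split; auto. }
  assert (E : vsub (L x) (vscal c x) = vzero).
  { apply IH.
    - rewrite Nat.iter_succ_r in H1. exact H1.
    - clear H1. assert (Cm : forall q, Nat.iter q (fun y => vsub (L y) (vscal c' y)) (vsub (L x) (vscal c x))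
         = vsub (L (Nat.iter q (fun y => vsub (L y) (vscal c' y)) x))
             (vscal c (Nat.iter q (fun y => vsub (L y) (vscal c' y)) x))).
      { induction q as [|q IHq]; auto. simpl. rewrite IHq.
        set (y := Nat.iter q _ x).
        rewrite !(lin_sub V V L), !(proj2 HL) by auto. unfold vsub.
        rewrite !vscal_addr, !vscal_mul by auto. rewrite <- !vadd_assoc by auto. f_equal.
        rewrite !vadd_assoc by auto. f_equal; [apply vadd_comm; auto|]. f_equal. ring. }
      rewrite Cm, H2. rewrite (lin_0 V V HV HV L HL), vscal_vzero by auto. apply vsub_diag; auto. }
  apply vsub_eq0 in E; auto.
  assert (P : forall q, Nat.iter q (fun y => vsub (L y) (vscal c' y)) x
             = vscal (Cpow (Csub c c') q) x).
  { induction q as [|q IHq]; simpl; [rewrite vscal_1; auto|].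
    rewrite IHq, (proj2 HL), E, !vscal_mul, vsub_scal by auto. f_equal. ring. }
  rewrite P in H2. apply vscal_eq0 in H2; auto.
  apply Cpow_neq0, Csub_neq0; auto.
Qed.

Section MobiusModule.
Variables (V : VAData) (rV : SL2 (va_sp V)).
Hypothesis HM : is_mobius_MOSVA V rV.
Variables (M : ModData V) (rW : SL2 (m_sp M)).
Hypothesis HW : is_mobius_module V rV M rW.
Notation A := (va_sp V).
Notation W := (m_sp M).
Notation YW := (m_Y M).
Notation homV := (hom (va_gr V)).
Notation homW := (hom (m_gr M)).

Lemma W_vspace : is_vspace W. Proof. apply HW. Qed.
Lemma W_grading : is_grading (m_gr M). Proof. apply HW. Qed.
Local Hint Resolve V_vspace V_grading ZC_inj W_vspace W_grading : core.
Let HVs : is_vspace A := V_vspace V rV HM.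
Let HVg : is_grading (va_gr V) := V_grading V rV HM.

Lemma YW_lin_l w k : is_lin (fun u => YW u w k).
Proof. destruct HW as [(_ & _ & H & _) _]. apply H. Qed.
Lemma YW_lin_r u k : is_lin (fun w => YW u w k).
Proof. destruct HW as [(_ & _ & H & _) _]. apply H. Qed.
Lemma YW_add_l x y w k : YW (vadd x y) w k = vadd (YW x w k) (YW y w k).
Proof. apply (YW_lin_l w k). Qed.
Lemma YW_scal_l c x w k : YW (vscal c x) w k = vscal c (YW x w k).
Proof. apply (YW_lin_l w k). Qed.
Lemma YW_0_l w k : YW vzero w k = vzero.
Proof. apply (lin_0 A W HVs W_vspace (fun u => YW u w k)), YW_lin_l. Qed.
Lemma YW_add_r u x y k : YW u (vadd x y) k = vadd (YW u x k) (YW u y k).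
Proof. apply (YW_lin_r u k). Qed.
Lemma YW_scal_r u c x k : YW u (vscal c x) k = vscal c (YW u x k).
Proof. apply (YW_lin_r u k). Qed.

Lemma W_d_Y u w k : vsub (m_d M (YW u w k)) (YW u (m_d M w) k)
  = vadd (YW (va_d V u) w k) (vscal (ZC (- k - 1)) (YW u w k)).
Proof. destruct HW as [(_ & _ & _ & _ & _ & _ & H & _) _]. apply H. Qed.
Lemma W_Y_one w k : YW (va_one V) w k = if Z.eq_dec k (-1) then w else vzero.
Proof. destruct HW as [(_ & _ & _ & _ & _ & _ & _ & H & _) _]. apply H. Qed.
Lemma W_Y_D u w k : YW (va_D V u) w k = vscal (ZC (- k)) (YW u w (k - 1)%Z).
Proof. destruct HW as [(_ & _ & _ & _ & _ & _ & _ & _ & H & _) _]. apply H. Qed.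
Lemma W_D_Y u w k : vsub (Lm1 rW (YW u w k)) (YW u (Lm1 rW w) k)
  = vscal (ZC (- k)) (YW u w (k - 1)%Z).
Proof.
  destruct HW as [(_ & _ & _ & _ & _ & _ & _ & _ & _ & H & _) (_ & E & _)].
  rewrite !E. apply H.
Qed.
Lemma W_sl2 : is_sl2 rW. Proof. apply HW. Qed.
Lemma W_L0_Y u w k : vsub (L0 rW (YW u w k)) (YW u (L0 rW w) k)
     = vadd (YW (L0 rV u) w k) (YW (Lm1 rV u) w (k + 1)%Z).
Proof. apply HW. Qed.
Lemma W_L1_Y u w k : vsub (L1 rW (YW u w k)) (YW u (L1 rW w) k)
     = vadd (YW (L1 rV u) w k)
            (vadd (vscal (ZC 2) (YW (L0 rV u) w (k + 1)%Z)) (YW (Lm1 rV u) w (k + 2)%Z)).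
Proof. apply HW. Qed.
Lemma W_gen_eigen n w : homW n w ->
  exists m : nat, Nat.iter m (fun x => vsub (L0 rW x) (vscal n x)) w = vzero.
Proof. destruct HW as (_ & _ & _ & _ & _ & H & _). apply H. Qed.
Lemma W_L0_d w : L0 rW (m_d M w) = m_d M (L0 rW w).
Proof. apply HW. Qed.

Lemma W_Lm1_lin : is_lin (Lm1 rW). Proof. apply W_sl2. Qed.
Lemma W_L0_lin : is_lin (L0 rW). Proof. apply W_sl2. Qed.
Lemma W_L1_lin : is_lin (L1 rW). Proof. apply W_sl2. Qed.
Lemma W_d_lin : is_lin (m_d M). Proof. apply degop_lin; auto. Qed.

Lemma W_d_hom n w : homW n w -> m_d M w = vscal n w.
Proof. apply (degop_hom Cplx W W_vspace _ W_grading (fun z => z)). Qed.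
Lemma W_hom_of_d n w : m_d M w = vscal n w -> homW n w.
Proof. apply (hom_of_degop Cplx W W_vspace _ W_grading (fun z => z)). auto. Qed.

Lemma W_d_Y_hom n u w k : homV n u ->
  vsub (m_d M (YW u w k)) (YW u (m_d M w) k) = vscal (ZC (n - k - 1)) (YW u w k).
Proof.
  intros Hu. rewrite W_d_Y, (V_d_hom V rV HM n u Hu), YW_scal_l, <- vscal_addl by auto.
  f_equal. rewrite <- ZC_add. f_equal. lia.
Qed.

Lemma W_L0_Y_hom n u w k : homV n u ->
  vsub (L0 rW (YW u w k)) (YW u (L0 rW w) k) = vscal (ZC (n - k - 1)) (YW u w k).
Proof.
  intros Hu. rewrite W_L0_Y, (V_L0 V rV HM), (V_Lm1 V rV HM), W_Y_D, (V_d_hom V rV HM n u Hu), YW_scal_l.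
  replace (k + 1 - 1)%Z with k by lia. rewrite <- vscal_addl by auto.
  f_equal. rewrite <- ZC_add. f_equal. lia.
Qed.

Lemma W_L1_Y_hom n u w k : homV n u ->
  vsub (L1 rW (YW u w k)) (YW u (L1 rW w) k)
  = vadd (YW (L1 rV u) w k) (vscal (ZC (2 * n - k - 2)) (YW u w (k + 1)%Z)).
Proof.
  intros Hu. rewrite W_L1_Y, (V_L0 V rV HM), (V_Lm1 V rV HM), W_Y_D, (V_d_hom V rV HM n u Hu), YW_scal_l, vscal_mul by auto.
  replace (k + 2 - 1)%Z with (k + 1)%Z by lia. rewrite <- vscal_addl by auto. do 2 f_equal.
  rewrite <- ZC_mul, <- ZC_add. f_equal. lia.
Qed.

Lemma YW_hom n h u w k : homV n u -> homW h w -> homW (Cadd h (ZC (n - k - 1))) (YW u w k).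
Proof.
  intros Hu Hw. apply W_hom_of_d. assert (E := W_d_Y_hom n u w k Hu).
  apply vsub_eq in E; auto. rewrite E, (W_d_hom h w Hw), YW_scal_r, <- vscal_addl by auto.
  f_equal. ring.
Qed.

Lemma W_L0_hom h w : homW h w -> homW h (L0 rW w).
Proof.
  apply (hom_comm_degop Cplx W W_vspace _ W_grading (fun z => z)); auto.
  - apply W_L0_lin.
  - apply W_L0_d.
Qed.

Lemma W_Lm1_hom h w : homW h w -> homW (Cadd h C1) (Lm1 rW w).
Proof.
  destruct HW as [(_ & _ & _ & _ & _ & H & _) (_ & E & _)]. rewrite E. apply H.
Qed.

Lemma W_gproj_L0 h w : gproj (m_gr M) h (L0 rW w) = L0 rW (gproj (m_gr M) h w).
Proof.
  revert w. apply (hom_ind Cplx W W_vspace (m_gr M) W_grading C0).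
  - intros n w Hw. destruct (eq_dec_classic h n) as [->|N].
    + rewrite Hw. apply W_L0_hom, Hw.
    + rewrite !(hom_neq Cplx W (m_gr M) W_grading n h) by (auto using W_L0_hom).
      symmetry. apply (lin_0 W W); auto using W_L0_lin.
  - intros x y Hx Hy.
    rewrite (proj1 W_L0_lin), !(proj1 (gproj_lin Cplx W _ W_grading h)), (proj1 W_L0_lin).
    rewrite Hx, Hy. reflexivity.
Qed.

Lemma W_L0_shift_lin c : is_lin (fun x => vsub (L0 rW x) (vscal c x)).
Proof.
  apply (is_lin_sub W_vspace (L0 rW) (fun y => vscal c y)); auto using W_L0_lin.
  apply (is_lin_scal W W W_vspace c (fun y => y)). split; auto.
Qed.

Lemma W_gproj_L0_iter c m h w :
  gproj (m_gr M) h (Nat.iter m (fun x => vsub (L0 rW x) (vscal c x)) w)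
  = Nat.iter m (fun x => vsub (L0 rW x) (vscal c x)) (gproj (m_gr M) h w).
Proof.
  induction m; simpl; auto. assert (L := gproj_lin Cplx W _ W_grading h).
  rewrite (lin_sub W W) by auto. rewrite (proj2 L), W_gproj_L0, IHm. reflexivity.
Qed.

(* [L(1)] lowers generalized eigenvalues of [L(0)] by one, and [W_[n]] is the
   generalized eigenspace for [n]. *)
Lemma W_L1_hom h w : homW h w -> homW (Csub h C1) (L1 rW w).
Proof.
  intros Hw. destruct (W_gen_eigen h w Hw) as [m Hm].
  assert (E : forall q, Nat.iter q (fun x => vsub (L0 rW x) (vscal (Csub h C1) x)) (L1 rW w)
      = L1 rW (Nat.iter q (fun x => vsub (L0 rW x) (vscal h x)) w)).
  { induction q as [|q IHq]; auto. simpl. rewrite IHq. set (y := Nat.iter q _ w).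
    destruct W_sl2 as (_ & _ & L & C & _). specialize (C y). apply vsub_eq in C; auto.
    rewrite C, (lin_sub W W) by auto. rewrite (proj2 L). unfold vsub.
    rewrite (vadd_comm W) by auto. rewrite vadd_assoc, vscal_mul, <- vscal_addl by auto.
    rewrite (vadd_comm W) by auto. rewrite vscal_mul by auto. f_equal. f_equal. ring. }
  apply (gproj_sep Cplx W W_vspace _ W_grading). intros n.
  destruct (eq_dec_classic n (Csub h C1)) as [->|N]; [apply gproj_hom; auto|].
  rewrite (gproj_neq Cplx W _ W_grading n) by auto. symmetry.
  (* A component of degree n other than h - 1 is a generalized eigenvector for both n and h - 1,
     hence zero. *)
  destruct (W_gen_eigen n (gproj (m_gr M) n (L1 rW w))) as [p Hp]; [apply gproj_hom; auto|].
  apply (lin_iter_eigen W_vspace (L0 rW) (Csub h C1) n m p); auto using W_L0_lin.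
  rewrite <- W_gproj_L0_iter, E, Hm.
  rewrite (lin_0 W W W_vspace W_vspace (L1 rW) W_L1_lin).
  apply (lin_0 W W); auto. apply gproj_lin; auto.
Qed.

(** The list [gsupp] in [Yo] depends on the vector in no additive way. A set of degrees and a power
    of [L(1)] good for several vectors at once puts their opposite operators over one index set,
    where linearity can be compared term by term. *)
Definition Yo_bound (S : list Z) (K : nat) (u : A) : Prop :=
  NoDup S /\ (forall n, ~ In n S -> gproj (va_gr V) n u = vzero) /\
  (forall n m, (K <= m)%nat -> Nat.iter m (L1 rV) (gproj (va_gr V) n u) = vzero).

Lemma Yo_bound_exists (us : list A) : exists S K, Forall (Yo_bound S K) us.
Proof.
  assert (Z0 : forall m, Nat.iter m (L1 rV) vzero = vzero).
  { intros m. apply (lin_0 A A); auto. apply is_lin_iter, (L1_lin V rV HM). }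
  assert (B1 : forall u, exists S K, Yo_bound S K u).
  { intros u.
    assert (exists K, forall n m, In n (gsupp (va_gr V) u) -> (K <= m)%nat ->
        Nat.iter m (L1 rV) (gproj (va_gr V) n u) = vzero) as [K HK].
    { induction (gsupp (va_gr V) u) as [|n l [K IH]]; [exists 0%nat; intros ? ? []|].
      destruct (L1_iter_trunc V rV HM (gproj (va_gr V) n u)) as [K' HK'].
      exists (Nat.max K K'). intros n' m [<-|Hn] Hm; [apply HK'; lia|apply IH; auto; lia]. }
    exists (gsupp (va_gr V) u), K. split; [apply gsupp_nodup; auto|]. split.
    - intros n Hn. apply gsupp_out; auto.
    - intros n m Hm. destruct (classic (In n (gsupp (va_gr V) u))); auto.
      rewrite (gsupp_out Z A); auto. }
  induction us as [|u us (S & K & IH)]; [exists [], 0%nat; constructor|].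
  destruct (B1 u) as (S' & K' & N' & O' & T').
  exists (nodup Z.eq_dec (S ++ S')), (Nat.max K K'). constructor.
  - split; [apply NoDup_nodup|]. split.
    + intros n Hn. apply O'. intros Hi. apply Hn, nodup_In, in_app_iff; auto.
    + intros n m Hm. apply T'. lia.
  - eapply Forall_impl; [|exact IH]. intros v (N & O & T). split; [apply NoDup_nodup|]. split.
    + intros n Hn. apply O. intros Hi. apply Hn, nodup_In, in_app_iff; auto.
    + intros n m Hm. apply T. lia.
Qed.

Lemma Yo_eq f u w p S K : is_linfun f -> Yo_bound S K u ->
  f (Yo V rV M u w p) = Csum S (fun n => Csum (seq 0 K) (fun m =>
    Cmul (Cmul (Csign n) (invfact m))
      (f (YW (Nat.iter m (L1 rV) (gproj (va_gr V) n u)) w (2 * n - p - Z.of_nat m - 2)%Z)))).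
Proof.
  intros Hf (N & O & T). unfold Yo. rewrite (linfun_vsum W) by auto.
  set (F := fun n => Csum (seq 0 K) (fun m =>
    Cmul (Cmul (Csign n) (invfact m))
      (f (YW (Nat.iter m (L1 rV) (gproj (va_gr V) n u)) w (2 * n - p - Z.of_nat m - 2)%Z)))).
  assert (FZ : forall n, gproj (va_gr V) n u = vzero -> F n = C0).
  { intros n E. apply Csum_0. intros m _. rewrite E.
    rewrite (lin_0 A A) by (auto; apply is_lin_iter, (L1_lin V rV HM)).
    rewrite YW_0_l, (linfun_0 W) by auto. ring. }
  transitivity (Csum (gsupp (va_gr V) u) F).
  - apply Csum_ext. intros n _. rewrite (fsum_eq W W_vspace _ K).
    + rewrite (linfun_vsum W) by auto. apply Csum_ext. intros m _. apply Hf.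
    + intros m Hm. rewrite T, YW_0_l by auto. apply vscal_vzero; auto.
  - apply Csum_support; auto using gsupp_nodup.
    intros n _ Hn. apply FZ, gsupp_out; auto.
Qed.

Lemma Yo_add_l f u v w p : is_linfun f ->
  f (Yo V rV M (vadd u v) w p) = Cadd (f (Yo V rV M u w p)) (f (Yo V rV M v w p)).
Proof.
  intros Hf. destruct (Yo_bound_exists [vadd u v; u; v]) as (S & K & B).
  rewrite !Forall_cons_iff in B. destruct B as (B0 & B1 & B2 & _).
  rewrite !(Yo_eq f _ _ _ S K) by auto. rewrite <- Csum_add. apply Csum_ext. intros n _.
  rewrite <- Csum_add. apply Csum_ext. intros m _.
  rewrite (proj1 (gproj_lin Z A _ HVg n)),
    (proj1 (is_lin_iter _ m (L1_lin V rV HM))), YW_add_l, (proj1 Hf). ring.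
Qed.

Lemma Yo_scal_l f c u w p : is_linfun f ->
  f (Yo V rV M (vscal c u) w p) = Cmul c (f (Yo V rV M u w p)).
Proof.
  intros Hf. destruct (Yo_bound_exists [vscal c u; u]) as (S & K & B).
  rewrite !Forall_cons_iff in B. destruct B as (B0 & B1 & _).
  rewrite !(Yo_eq f _ _ _ S K) by auto. rewrite <- Csum_scal. apply Csum_ext. intros n _.
  rewrite <- Csum_scal. apply Csum_ext. intros m _.
  rewrite (proj2 (gproj_lin Z A _ HVg n)),
    (proj2 (is_lin_iter _ m (L1_lin V rV HM))), YW_scal_l, (proj2 Hf). ring.
Qed.

Lemma Yo_linfun_l f w p : is_linfun f -> is_linfun (fun u => f (Yo V rV M u w p)).
Proof. intros Hf. split; intros; [apply Yo_add_l|apply Yo_scal_l]; auto. Qed.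

Lemma Yo_linfun_r f u p : is_linfun f -> is_linfun (fun w => f (Yo V rV M u w p)).
Proof.
  intros Hf. destruct (Yo_bound_exists [u]) as (S & K & B).
  rewrite !Forall_cons_iff in B. destruct B as (B & _). split.
  - intros x y. rewrite !(Yo_eq f _ _ _ S K) by auto. rewrite <- Csum_add. apply Csum_ext. intros n _.
    rewrite <- Csum_add. apply Csum_ext. intros m _. rewrite YW_add_r, (proj1 Hf). ring.
  - intros c x. rewrite !(Yo_eq f _ _ _ S K) by auto. rewrite <- Csum_scal. apply Csum_ext. intros n _.
    rewrite <- Csum_scal. apply Csum_ext. intros m _. rewrite YW_scal_r, (proj2 Hf). ring.
Qed.

Lemma L1_iter_ge (u : A) K m : Nat.iter K (L1 rV) u = vzero -> (K <= m)%nat ->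
  Nat.iter m (L1 rV) u = vzero.
Proof.
  intros H L. replace m with (m - K + K)%nat by lia. rewrite Nat.iter_add, H.
  apply (lin_0 A A); auto. apply is_lin_iter, (L1_lin V rV HM).
Qed.

Lemma Yo_hom_eq f n u w p K : is_linfun f -> homV n u -> Nat.iter K (L1 rV) u = vzero ->
  f (Yo V rV M u w p) = Csum (seq 0 K) (fun m =>
    Cmul (Cmul (Csign n) (invfact m))
      (f (YW (Nat.iter m (L1 rV) u) w (2 * n - p - Z.of_nat m - 2)%Z))).
Proof.
  intros Hf Hu HK.
  assert (Z0 : forall m, Nat.iter m (L1 rV) vzero = vzero).
  { intros m. apply (lin_0 A A); auto. apply is_lin_iter, (L1_lin V rV HM). }
  rewrite (Yo_eq f u w p [n] K); auto.
  - cbn [Csum fold_right]. rewrite Hu. simpl. ring.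
  - split; [repeat constructor; simpl; tauto|]. split.
    + intros m Hm. apply (hom_neq Z A (va_gr V) HVg n); auto. intros ->. apply Hm. left; auto.
    + intros i m Hm. destruct (Z.eq_dec i n) as [->|N].
      * rewrite Hu. apply (L1_iter_ge u K); auto.
      * rewrite (hom_neq Z A (va_gr V) HVg n); auto.
Qed.

Lemma V_hom_ind (P : A -> Prop) :
  (forall n K u, homV n u -> Nat.iter K (L1 rV) u = vzero -> P u) ->
  (forall x y, P x -> P y -> P (vadd x y)) -> forall u, P u.
Proof.
  intros H1 H2. apply (hom_ind Z A HVs (va_gr V) HVg 0%Z); auto.
  intros n u Hu. destruct (L1_iter_trunc V rV HM u) as [K HK]. apply (H1 n K); auto.
Qed.

Lemma Yo_one f w p : is_linfun f ->
  f (Yo V rV M (va_one V) w p) = f (if Z.eq_dec p (-1) then w else vzero).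
Proof.
  intros Hf. rewrite (Yo_hom_eq f 0 (va_one V) w p 1); auto.
  - simpl Csum. rewrite W_Y_one, invfact_0. unfold Csign; cbn [Z.even].
    destruct (Z.eq_dec p (-1)), (Z.eq_dec (- p - 0 - 2) (-1)); try lia; ring.
  - apply (one_hom V rV HM).
  - apply (one_L1 V rV HM).
Qed.

(** In the coefficient of L(1)^m u, the derivative of the mode contributes 2n - k - m and the
    commutator of L(1)^(m+1) with D contributes - (2n - m); what remains is - k. *)
Lemma Yo_D f u w k : is_linfun f ->
  f (Yo V rV M (va_D V u) w k) = Cmul (ZC (- k)) (f (Yo V rV M u w (k - 1)%Z)).
Proof.
  intros Hf. revert u. apply V_hom_ind.
  2:{ intros x y Hx Hy. rewrite (proj1 (D_lin V rV HM)), !Yo_add_l, Hx, Hy by auto. ring. }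
  intros n K u Hu HK.
  (* [D u] may survive one more [L(1)] than [u], so its truncation is taken one step later. *)
  assert (HK' : Nat.iter (S K) (L1 rV) (va_D V u) = vzero).
  { rewrite (L1_iter_D V rV HM n u (S K) Hu). simpl pred. rewrite HK, vscal_vzero by auto.
    rewrite (L1_iter_ge u K (S K)) by auto. rewrite vadd_0r by auto.
    apply (lin_0 A A); auto. apply (D_lin V rV HM). }
  rewrite (Yo_hom_eq f (n + 1) (va_D V u) w k (S K)) by (auto; apply (D_hom V rV HM); auto).
  rewrite (Yo_hom_eq f n u w (k - 1) K) by auto.
  set (t := fun m => f (YW (Nat.iter m (L1 rV) u) w (2 * n - k - Z.of_nat m - 1)%Z)).
  assert (tK : t K = C0) by (unfold t; rewrite HK, YW_0_l; apply (linfun_0 W); auto).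
  set (F1 := fun m => Cmul (Cmul (Copp (Csign n)) (invfact m)) (Cmul (Copp (ZC (2 * n - k - Z.of_nat m))) (t m))).
  set (F2 := fun m => Cmul (Cmul (Copp (Csign n)) (Cmul (ZC (Z.of_nat m)) (invfact m)))
         (Cmul (ZC (2 * n - Z.of_nat m + 1)) (t (pred m)))).
  transitivity (Csum (seq 0 (S K)) (fun m => Cadd (F1 m) (F2 m))).
  - apply Csum_ext. intros m _. rewrite (L1_iter_D V rV HM n u m Hu).
    rewrite YW_add_l, YW_scal_l, W_Y_D, (proj1 Hf), !(proj2 Hf), Csign_succ.
    unfold F1, F2, t.
    replace (2 * (n + 1) - k - Z.of_nat m - 2 - 1)%Z with (2 * n - k - Z.of_nat m - 1)%Z by lia.
    replace (2 * (n + 1) - k - Z.of_nat m - 2)%Z with (2 * n - k - Z.of_nat m)%Z by lia.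
    rewrite ZC_opp, ZC_mul. destruct m.
    + simpl Z.of_nat. rewrite ZC_0. ring.
    + simpl pred.
      replace (2 * n - k - Z.of_nat (S m))%Z with (2 * n - k - Z.of_nat m - 1)%Z by lia. ring.
  - rewrite Csum_add, Csum_seq_S, Csum_seq_front.
    replace (F1 K) with C0 by (unfold F1; rewrite tK; ring).
    replace (F2 0%nat) with C0 by (unfold F2; simpl Z.of_nat; rewrite ZC_0; ring).
    transitivity (Cadd (Csum (seq 0 K) F1) (Csum (seq 0 K) (fun j => F2 (S j)))); [ring|].
    rewrite <- Csum_add, <- Csum_scal. apply Csum_ext. intros m _.
    unfold F1, F2. simpl pred.
    replace (Z.of_nat (S m)) with (Z.of_nat m + 1)%Z by lia. rewrite invfact_S.
    replace (2 * n - (k - 1) - Z.of_nat m - 2)%Z with (2 * n - k - Z.of_nat m - 1)%Z by lia.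
    fold (t m). ZC_push. ring.
Qed.

(** Transposed, this is the bracket of [L'(-1)] with Y'. The terms L(1)^(m+1) u, shifted back to
    index m, carry - m; the remaining part of the [L(1)] commutator carries m - k. *)
Lemma Yo_L1 f u w k : is_linfun f ->
  Csub (f (Yo V rV M u (L1 rW w) k)) (f (L1 rW (Yo V rV M u w k)))
  = Cmul (ZC (- k)) (f (Yo V rV M u w (k - 1)%Z)).
Proof.
  intros Hf. assert (Hf' := is_linfun_comp (L1 rW) f W_L1_lin Hf).
  revert u. apply V_hom_ind.
  2:{ intros x y Hx Hy. rewrite !Yo_add_l, (Yo_add_l (fun x => f (L1 rW x))) by auto.
      transitivity (Cadd (Csub (f (Yo V rV M x (L1 rW w) k)) (f (L1 rW (Yo V rV M x w k))))
        (Csub (f (Yo V rV M y (L1 rW w) k)) (f (L1 rW (Yo V rV M y w k))))); [ring|].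
      rewrite Hx, Hy. ring. }
  intros n K u Hu HK.
  rewrite (Yo_hom_eq (fun x => f (L1 rW x)) n u w k K), !(Yo_hom_eq f n u _ _ K) by auto.
  set (t := fun m => f (YW (Nat.iter m (L1 rV) u) w (2 * n - k - Z.of_nat m - 1)%Z)).
  assert (tK : t K = C0) by (unfold t; rewrite HK, YW_0_l; apply (linfun_0 W); auto).
  set (F := fun m => Cmul (Cmul (ZC (Z.of_nat m)) (invfact m)) (t m)).
  assert (R : Csum (seq 0 K) (fun m => Cmul (invfact m) (t (S m))) = Csum (seq 0 K) F).
  { rewrite <- (Csum_seq_reindex K F).
    - apply Csum_ext. intros m _. unfold F.
      replace (Z.of_nat (S m)) with (Z.of_nat m + 1)%Z by lia. rewrite invfact_S. ring.
    - unfold F. simpl Z.of_nat. rewrite ZC_0. ring.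
    - unfold F. rewrite tK. ring. }
  transitivity (Cmul (Csign n) (Cadd (Copp (Csum (seq 0 K) (fun m => Cmul (invfact m) (t (S m)))))
     (Csum (seq 0 K) (fun m => Cmul (invfact m) (Cmul (ZC (Z.of_nat m - k)) (t m)))))).
  - unfold Csub. rewrite <- !Csum_opp, <- !Csum_add, <- Csum_scal. apply Csum_ext. intros m _.
    assert (E := W_L1_Y_hom (n - Z.of_nat m) _ w (2 * n - k - Z.of_nat m - 2)
       (L1_iter_hom V rV HM n u m Hu)).
    apply vsub_eq in E; auto. rewrite E, !(proj1 Hf), (proj2 Hf).
    unfold t. simpl Nat.iter.
    replace (2 * n - k - Z.of_nat m - 2 + 1)%Z with (2 * n - k - Z.of_nat m - 1)%Z by lia.
    replace (2 * n - k - Z.of_nat (S m) - 1)%Z with (2 * n - k - Z.of_nat m - 2)%Z by lia.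
    replace (2 * (n - Z.of_nat m) - (2 * n - k - Z.of_nat m - 2) - 2)%Z with (k - Z.of_nat m)%Z by lia.
    rewrite !ZC_sub. ring.
  - rewrite R. rewrite <- !Csum_opp, <- Csum_add, <- !Csum_scal. apply Csum_ext. intros m _.
    unfold F. replace (2 * n - (k - 1) - Z.of_nat m - 2)%Z with (2 * n - k - Z.of_nat m - 1)%Z by lia.
    fold (t m). rewrite ZC_opp, ZC_sub. ring.
Qed.

(** One argument for [m_d] and for [L(0)]: they have the same commutators with modes of homogeneous
    vectors, although [L(0)] may fail to be semisimple. Replacing x by 1/x negates the weight of a
    mode, which matches the reversed commutator of the transpose. *)
Lemma Yo_weight f (T : W -> W) n u w k : is_linfun f -> is_lin T -> homV n u ->
  (forall n u w k, homV n u ->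
     vsub (T (YW u w k)) (YW u (T w) k) = vscal (ZC (n - k - 1)) (YW u w k)) ->
  Csub (f (Yo V rV M u (T w) k)) (f (T (Yo V rV M u w k)))
  = Cmul (ZC (n - k - 1)) (f (Yo V rV M u w k)).
Proof.
  intros Hf HT Hu H. assert (Hf' := is_linfun_comp T f HT Hf).
  destruct (L1_iter_trunc V rV HM u) as [K HK]. specialize (HK K (Nat.le_refl _)).
  rewrite (Yo_hom_eq (fun x => f (T x)) n u w k K), !(Yo_hom_eq f n u _ _ K) by auto.
  unfold Csub. rewrite <- Csum_opp, <- Csum_add, <- Csum_scal. apply Csum_ext. intros m _.
  assert (E := H _ _ w (2 * n - k - Z.of_nat m - 2)%Z (L1_iter_hom V rV HM n u m Hu)).
  apply vsub_eq in E; auto. rewrite E, (proj1 Hf), (proj2 Hf).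
  replace (n - Z.of_nat m - (2 * n - k - Z.of_nat m - 2) - 1)%Z with (- (n - k - 1))%Z by lia.
  rewrite ZC_opp. ring.
Qed.

Lemma Yo_d f u w k : is_linfun f ->
  Csub (f (Yo V rV M u (m_d M w) k)) (f (m_d M (Yo V rV M u w k)))
  = Cadd (f (Yo V rV M (va_d V u) w k)) (Cmul (ZC (- k - 1)) (f (Yo V rV M u w k))).
Proof.
  intros Hf. assert (Hf' := is_linfun_comp (m_d M) f W_d_lin Hf).
  revert u. apply V_hom_ind.
  - intros n K u Hu _. rewrite (Yo_weight f (m_d M) n) by auto using W_d_lin, W_d_Y_hom.
    rewrite (V_d_hom V rV HM n u Hu), Yo_scal_l by auto.
    replace (n - k - 1)%Z with (n + (- k - 1))%Z by lia. rewrite ZC_add. ring.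
  - intros x y Hx Hy.
    rewrite (proj1 (V_d_lin V rV HM)), !Yo_add_l, (Yo_add_l (fun x => f (m_d M x))) by auto.
    transitivity (Cadd (Csub (f (Yo V rV M x (m_d M w) k)) (f (m_d M (Yo V rV M x w k))))
        (Csub (f (Yo V rV M y (m_d M w) k)) (f (m_d M (Yo V rV M y w k))))); [ring|].
    rewrite Hx, Hy. ring.
Qed.

Lemma V_L0_lin : is_lin (L0 rV). Proof. apply (V_sl2 V rV HM). Qed.
Lemma V_Lm1_lin : is_lin (Lm1 rV). Proof. apply (V_sl2 V rV HM). Qed.

Lemma Yo_L0 f u w k : is_linfun f ->
  Csub (f (Yo V rV M u (L0 rW w) k)) (f (L0 rW (Yo V rV M u w k)))
  = Cadd (f (Yo V rV M (L0 rV u) w k)) (f (Yo V rV M (Lm1 rV u) w (k + 1)%Z)).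
Proof.
  intros Hf. assert (Hf' := is_linfun_comp (L0 rW) f W_L0_lin Hf).
  revert u. apply V_hom_ind.
  - intros n K u Hu _. rewrite (Yo_weight f (L0 rW) n) by auto using W_L0_lin, W_L0_Y_hom.
    rewrite (V_L0 V rV HM), (V_Lm1 V rV HM), Yo_D, (V_d_hom V rV HM n u Hu), Yo_scal_l by auto.
    replace (k + 1 - 1)%Z with k by lia.
    replace (n - k - 1)%Z with (n + - (k + 1))%Z by lia. rewrite ZC_add. ring.
  - intros x y Hx Hy.
    rewrite (proj1 V_L0_lin), (proj1 V_Lm1_lin), !Yo_add_l, (Yo_add_l (fun x => f (L0 rW x))) by auto.
    transitivity (Cadd (Csub (f (Yo V rV M x (L0 rW w) k)) (f (L0 rW (Yo V rV M x w k))))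
        (Csub (f (Yo V rV M y (L0 rW w) k)) (f (L0 rW (Yo V rV M y w k))))); [ring|].
    rewrite Hx, Hy. ring.
Qed.

(** Transposed, this is the bracket of [L'(1)] with Y'. On the right the coefficient of L(1)^m u
    receives - m from Y^o(L(1) u) after an index shift, 2n from 2 L(0) and - (k + 2) from L(-1);
    their sum is the mode number 2n - k - m - 2 that [L(-1)] produces on the left. *)
Lemma Yo_Lm1 f u w k : is_linfun f ->
  Csub (f (Yo V rV M u (Lm1 rW w) k)) (f (Lm1 rW (Yo V rV M u w k)))
  = Cadd (f (Yo V rV M (L1 rV u) w k))
      (Cadd (Cmul (ZC 2) (f (Yo V rV M (L0 rV u) w (k + 1)%Z)))
            (f (Yo V rV M (Lm1 rV u) w (k + 2)%Z))).
Proof.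
  intros Hf. assert (Hf' := is_linfun_comp (Lm1 rW) f W_Lm1_lin Hf).
  revert u. apply V_hom_ind.
  2:{ intros x y Hx Hy.
    rewrite (proj1 V_L0_lin), (proj1 V_Lm1_lin), (proj1 (L1_lin V rV HM)), !Yo_add_l, (Yo_add_l (fun x => f (Lm1 rW x))) by auto.
    transitivity (Cadd (Csub (f (Yo V rV M x (Lm1 rW w) k)) (f (Lm1 rW (Yo V rV M x w k))))
        (Csub (f (Yo V rV M y (Lm1 rW w) k)) (f (Lm1 rW (Yo V rV M y w k))))); [ring|].
    rewrite Hx, Hy. ring. }
  intros n K u Hu HK.
  rewrite (V_L0 V rV HM), (V_Lm1 V rV HM), Yo_D, (V_d_hom V rV HM n u Hu), Yo_scal_l by auto.
  replace (k + 2 - 1)%Z with (k + 1)%Z by lia.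
  assert (HK1 : Nat.iter K (L1 rV) (L1 rV u) = vzero).
  { rewrite <- Nat.iter_succ_r. apply (L1_iter_ge u K); auto. }
  rewrite (Yo_hom_eq f (n - 1) (L1 rV u) w k K) by (auto; apply (L1_hom V rV HM); auto).
  rewrite (Yo_hom_eq (fun x => f (Lm1 rW x)) n u w k K), !(Yo_hom_eq f n u _ _ K) by auto.
  set (t := fun m => f (YW (Nat.iter m (L1 rV) u) w (2 * n - k - Z.of_nat m - 3)%Z)).
  assert (tK : t K = C0) by (unfold t; rewrite HK, YW_0_l; apply (linfun_0 W); auto).
  set (F := fun m => Cmul (Cmul (ZC (Z.of_nat m)) (invfact m)) (t m)).
  assert (R : Csum (seq 0 K) (fun m =>
      Cmul (Cmul (Csign (n - 1)) (invfact m))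
        (f (YW (Nat.iter m (L1 rV) (L1 rV u)) w (2 * (n - 1) - k - Z.of_nat m - 2)%Z)))
     = Cmul (Copp (Csign n)) (Csum (seq 0 K) F)).
  { rewrite <- (Csum_seq_reindex K F).
    - rewrite <- Csum_scal. apply Csum_ext. intros m _. unfold F, t.
      rewrite <- Nat.iter_succ_r, Csign_pred.
      replace (2 * n - k - Z.of_nat (S m) - 3)%Z with (2 * (n - 1) - k - Z.of_nat m - 2)%Z by lia.
      replace (Z.of_nat (S m)) with (Z.of_nat m + 1)%Z by lia. rewrite invfact_S. ring.
    - unfold F. simpl Z.of_nat. rewrite ZC_0. ring.
    - unfold F. rewrite tK. ring. }
  rewrite R. unfold Csub. rewrite <- !Csum_opp, <- !Csum_scal, <- !Csum_add.
  apply Csum_ext. intros m _. unfold F.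
  assert (E := W_D_Y (Nat.iter m (L1 rV) u) w (2 * n - k - Z.of_nat m - 2)).
  apply vsub_eq in E; auto. rewrite E, (proj1 Hf), (proj2 Hf).
  replace (2 * n - k - Z.of_nat m - 2 - 1)%Z with (2 * n - k - Z.of_nat m - 3)%Z by lia.
  replace (2 * n - (k + 1) - Z.of_nat m - 2)%Z with (2 * n - k - Z.of_nat m - 3)%Z by lia.
  fold (t m).
  replace (- (2 * n - k - Z.of_nat m - 2))%Z with (k + 2 + Z.of_nat m - 2 * n)%Z by lia.
  ZC_push. ring.
Qed.

(** A fixed mode of Y^o shifts degrees by one integer for each homogeneous component of [u], hence
    by finitely many, and finite support is preserved. *)
Lemma Yo_gdual f u p : gdual (m_gr M) f -> gdual (m_gr M) (fun w => f (Yo V rV M u w p)).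
Proof.
  intros [Hf [S HS]]. split; [apply Yo_linfun_r; auto|].
  destruct (Yo_bound_exists [u]) as (S' & K & B).
  rewrite !Forall_cons_iff in B. destruct B as (B & _).
  exists (map (fun q => Cadd (fst q) (ZC (snd q - p - 1))) (list_prod S S')).
  intros h w Hh. rewrite (Yo_eq f _ _ _ S' K) by auto.
  apply Csum_0. intros n Hn. apply Csum_0. intros m _.
  assert (Hg : homW (Cadd h (ZC (- (n - p - 1))))
     (YW (Nat.iter m (L1 rV) (gproj (va_gr V) n u)) (gproj (m_gr M) h w) (2 * n - p - Z.of_nat m - 2)%Z)).
  { replace (- (n - p - 1))%Z with (n - Z.of_nat m - (2 * n - p - Z.of_nat m - 2) - 1)%Z by lia.
    apply YW_hom; [apply (L1_iter_hom V rV HM)|]; apply gproj_hom; auto. }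
  rewrite <- Hg, HS; [ring|]. intros Hi. apply Hh, in_map_iff.
  exists (Cadd h (ZC (- (n - p - 1))), n). split; [|apply in_prod; auto].
  simpl. rewrite ZC_opp. ring.
Qed.

Lemma gdual_comp f (T : W -> W) c : gdual (m_gr M) f -> is_lin T ->
  (forall h w, homW h w -> homW (Cadd h c) (T w)) -> gdual (m_gr M) (fun w => f (T w)).
Proof.
  intros [Hf [S HS]] HT H. split; [apply is_linfun_comp; auto|].
  exists (map (fun s => Csub s c) S). intros h w Hh.
  assert (E := H h _ (gproj_hom Cplx W _ W_grading h w)). rewrite <- E. apply HS.
  intros Hi. apply Hh, in_map_iff. exists (Cadd h c). split; auto. ring.
Qed.

End MobiusModule.

(** * Opposite vertex operators of iterates *)

Section OppositeIterate.
Variables (V : VAData) (rV : SL2 (va_sp V)).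
Hypothesis HM : is_mobius_MOSVA V rV.
Variables (M : ModData V) (rW : SL2 (m_sp M)).
Hypothesis HW : is_mobius_module V rV M rW.
Notation A := (va_sp V).
Notation W := (m_sp M).
Notation YV := (va_Y V).
Notation YW := (m_Y M).
Notation homV := (hom (va_gr V)).
Notation L1V := (L1 rV).
Let HVs : is_vspace A := V_vspace V rV HM.
Let HWs : is_vspace W := W_vspace V rV M rW HW.

(** The j-fold derivative rule; the product of the successive mode numbers divided by j! is a
    binomial coefficient. *)
Lemma Yo_D_iter f v w m j : is_linfun f ->
  Cmul (invfact j) (f (Yo V rV M (Nat.iter j (va_D V) v) w m))
  = Cmul (Cmul (Csign (Z.of_nat j)) (gbin m j)) (f (Yo V rV M v w (m - Z.of_nat j)%Z)).
Proof.
  intros Hf. revert v. induction j as [|j IH]; intros v.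
  - simpl Nat.iter. rewrite invfact_0. simpl Z.of_nat. rewrite Z.sub_0_r.
    unfold Csign. simpl. ring.
  - apply (Cmul_cancel (ZC (Z.of_nat j + 1))); [apply ZC_neq0; lia|].
    rewrite Nat.iter_succ_r.
    transitivity (Cmul (Cmul (ZC (Z.of_nat j + 1)) (invfact (S j)))
       (f (Yo V rV M (Nat.iter j (va_D V) (va_D V v)) w m))); [ring|].
    rewrite invfact_S, IH, (Yo_D V rV HM M rW HW) by auto.
    replace (m - Z.of_nat j - 1)%Z with (m - Z.of_nat (S j))%Z by lia.
    transitivity (Cmul (Cmul (Csign (Z.of_nat (S j))) (Cmul (ZC (Z.of_nat j + 1)) (gbin m (S j))))
       (f (Yo V rV M v w (m - Z.of_nat (S j))%Z))); [|ring].
    rewrite gbin_S. replace (Z.of_nat (S j)) with (Z.of_nat j + 1)%Z by lia.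
    rewrite Csign_succ, ZC_opp. ring.
Qed.

Section Homogeneous.
Variables (n1 n2 : Z) (u1 u2 : A) (K : nat) (K0 : Z).
Hypotheses (Hu1 : homV n1 u1) (Hu2 : homV n2 u2).
Hypotheses (HK1 : Nat.iter K L1V u1 = vzero) (HK2 : Nat.iter K L1V u2 = vzero).
Hypothesis HK0 : forall i l k, (K0 <= k)%Z ->
  YV (Nat.iter i L1V u2) (Nat.iter l L1V u1) k = vzero.

(** The powers L(1)^m in Y^o of a mode of Y_V are distributed: i go to the first vector, l to the
    second, and q = m - i - l is left for the binomial factor of the conjugation. The truncation
    [K0] bounds q. *)
Lemma Yo_Y_eq f w k p : is_linfun f ->
  f (Yo V rV M (YV u2 u1 k) w p) =
  Cmul (Csign (n1 + n2 - k - 1)) (Csum (seq 0 K) (fun i => Csum (seq 0 K) (fun l =>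
    Csum (seq 0 (Z.to_nat (K0 - k))) (fun q =>
    Cmul (Cmul (gbin (2 * n2 - k - 2 - Z.of_nat i) q) (Cmul (invfact i) (invfact l)))
      (f (YW (YV (Nat.iter i L1V u2) (Nat.iter l L1V u1) (k + Z.of_nat q)%Z) w
        (2 * (n1 + n2 - k - 1) - p - 2 - Z.of_nat i - Z.of_nat l - Z.of_nat q)%Z)))))).
Proof.
  intros Hf. set (N := (n1 + n2 - k - 1)%Z). set (x := YV u2 u1 k).
  assert (Hx : homV N x).
  { replace N with (n2 + n1 - k - 1)%Z by (unfold N; lia). apply (Y_hom V rV HM); auto. }
  set (n := Z.to_nat (K0 - k)).
  destruct (L1_iter_trunc V rV HM x) as [Kx HKx].
  (* Large enough to exhaust the powers of [L(1)] on [x] and to contain every sum i + l + q that can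
     occur. *)
  set (K' := (Kx + (K + K + n))%nat).
  rewrite (Yo_hom_eq V rV HM M rW HW f N x w p K') by (auto; apply HKx; lia).
  set (G := fun i l z => Cmul (Cmul (gbz (2 * n2 - k - 2 - Z.of_nat i) z) (Cmul (invfact i) (invfact l)))
      (f (YW (YV (Nat.iter i L1V u2) (Nat.iter l L1V u1) (k + z)%Z) w
        (2 * N - p - 2 - Z.of_nat i - Z.of_nat l - z)%Z))).
  transitivity (Cmul (Csign N) (Csum (seq 0 K') (fun m => Csum (seq 0 K) (fun i =>
     Csum (seq 0 K) (fun l => G i l (Z.of_nat m - Z.of_nat (i + l))%Z))))).
  - rewrite <- Csum_scal. apply Csum_ext. intros m _.
    transitivity (Cmul (Csign N) (Cmul (invfact m)
       (f (YW (Nat.iter m L1V x) w (2 * N - p - Z.of_nat m - 2)%Z)))); [ring|].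
    f_equal. unfold x.
    rewrite (L1_iter_Y V rV HM n2 u2 u1 k K (fun y => f (YW y w (2 * N - p - Z.of_nat m - 2)%Z)) m); auto.
    2:{ apply (is_linfun_comp (fun y => YW y w (2 * N - p - Z.of_nat m - 2)%Z)); auto.
        apply (YW_lin_l V rV M rW HW). }
    apply Csum_ext. intros i _. apply Csum_ext. intros l _. unfold G.
    replace (Z.of_nat m - Z.of_nat (i + l))%Z with (Z.of_nat m - Z.of_nat i - Z.of_nat l)%Z by lia.
    replace (k + (Z.of_nat m - Z.of_nat i - Z.of_nat l))%Z
      with (k + Z.of_nat m - Z.of_nat i - Z.of_nat l)%Z by lia.
    replace (2 * N - p - 2 - Z.of_nat i - Z.of_nat l - (Z.of_nat m - Z.of_nat i - Z.of_nat l))%Z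
      with (2 * N - p - Z.of_nat m - 2)%Z by lia.
    reflexivity.
  - f_equal. rewrite Csum_swap. apply Csum_ext. intros i Hi. rewrite Csum_swap.
    apply Csum_ext. intros l Hl. apply in_seq in Hi, Hl.
    rewrite (Csum_seq_shift (i + l) n K' (G i l)).
    + apply Csum_ext. intros q _. unfold G. rewrite gbz_nat. reflexivity.
    + unfold K'. lia.
    + intros z [Hz|Hz]; unfold G; [rewrite gbz_neg by auto; ring|].
      rewrite HK0 by (unfold n in Hz; lia). rewrite (YW_0_l V rV HM M rW HW), (linfun_0 W) by auto. ring.
Qed.

(** The operator e^{x_0 D} in Y^s contributes binomials in m, and the conjugation contributes
    binomials in 2 n_2 - k - 2 - i - j. [gbin_vandermonde] convolves them into one binomial whose
    upper index 2 n_2 - 2 - i - (k + m) is constant along the lines k + m = const. *)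
Lemma Yo_opp_Y_eq f w k m : is_linfun f ->
  f (Yo V rV M (opp_Y V u1 u2 k) w m) =
  Cmul (Csign (n1 + n2)) (Csum (seq 0 K) (fun i => Csum (seq 0 K) (fun l =>
    Csum (seq 0 (Z.to_nat (K0 - k))) (fun r =>
    Cmul (Cmul (gbin (2 * n2 - k - 2 - Z.of_nat i - m) r) (Cmul (invfact i) (invfact l)))
      (f (YW (YV (Nat.iter i L1V u2) (Nat.iter l L1V u1) (k + Z.of_nat r)%Z) w
        (2 * n1 + 2 * n2 - 2 * k - m - Z.of_nat i - Z.of_nat l - Z.of_nat r - 4)%Z)))))).
Proof.
  intros Hf. set (n := Z.to_nat (K0 - k)).
  assert (Hop : opp_Y V u1 u2 k = vsum (seq 0 n) (fun j =>
    vscal (Cmul (Csign (k + Z.of_nat j + 1)%Z) (invfact j))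
          (Nat.iter j (va_D V) (YV u2 u1 (k + Z.of_nat j)%Z)))).
  { unfold opp_Y. apply fsum_eq; auto. intros j Hj. rewrite (HK0 0%nat 0%nat) by (unfold n in Hj; lia).
    rewrite (lin_0 A A) by (auto; apply is_lin_iter, (D_lin V rV HM)). apply vscal_vzero; auto. }
  rewrite Hop. set (F := fun x => f (Yo V rV M x w m)).
  assert (HF : is_linfun F) by (apply (Yo_linfun_l V rV HM M rW HW); auto).
  change (F (vsum (seq 0 n) (fun j =>
    vscal (Cmul (Csign (k + Z.of_nat j + 1)%Z) (invfact j))
          (Nat.iter j (va_D V) (YV u2 u1 (k + Z.of_nat j)%Z)))) =
   Cmul (Csign (n1 + n2)) (Csum (seq 0 K) (fun i => Csum (seq 0 K) (fun l =>
    Csum (seq 0 n) (fun r =>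
    Cmul (Cmul (gbin (2 * n2 - k - 2 - Z.of_nat i - m) r) (Cmul (invfact i) (invfact l)))
      (f (YW (YV (Nat.iter i L1V u2) (Nat.iter l L1V u1) (k + Z.of_nat r)%Z) w
        (2 * n1 + 2 * n2 - 2 * k - m - Z.of_nat i - Z.of_nat l - Z.of_nat r - 4)%Z))))))).
  rewrite (linfun_vsum A) by auto.
  set (B := fun i l z => Cmul (Cmul (invfact i) (invfact l))
      (f (YW (YV (Nat.iter i L1V u2) (Nat.iter l L1V u1) (k + z)%Z) w
        (2 * n1 + 2 * n2 - 2 * k - m - Z.of_nat i - Z.of_nat l - z - 4)%Z))).
  transitivity (Cmul (Csign (n1 + n2)) (Csum (seq 0 n) (fun j => Csum (seq 0 K) (fun i =>
    Csum (seq 0 K) (fun l => Csum (seq 0 (n - j)) (fun q =>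
     Cmul (Cmul (Csign (Z.of_nat j)) (Cmul (gbin m j) (gbin (2 * n2 - k - 2 - Z.of_nat i - Z.of_nat j) q)))
       (B i l (Z.of_nat j + Z.of_nat q)%Z))))))).
  - rewrite <- Csum_scal. apply Csum_ext. intros j _. rewrite (proj2 HF). unfold F.
    transitivity (Cmul (Csign (k + Z.of_nat j + 1)) (Cmul (invfact j)
       (f (Yo V rV M (Nat.iter j (va_D V) (YV u2 u1 (k + Z.of_nat j)%Z)) w m)))); [ring|].
    rewrite Yo_D_iter, Yo_Y_eq by auto.
    replace (Csign (n1 + n2)) with
      (Cmul (Csign (k + Z.of_nat j + 1)) (Csign (n1 + n2 - (k + Z.of_nat j) - 1)))
      by (rewrite <- Csign_add; f_equal; lia).
    transitivity (Cmul (Cmul (Csign (k + Z.of_nat j + 1)) (Csign (n1 + n2 - (k + Z.of_nat j) - 1)))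
      (Cmul (Cmul (Csign (Z.of_nat j)) (gbin m j))
       (Csum (seq 0 K) (fun i => Csum (seq 0 K) (fun l =>
    Csum (seq 0 (Z.to_nat (K0 - (k + Z.of_nat j)))) (fun q =>
    Cmul (Cmul (gbin (2 * n2 - (k + Z.of_nat j) - 2 - Z.of_nat i) q) (Cmul (invfact i) (invfact l)))
      (f (YW (YV (Nat.iter i L1V u2) (Nat.iter l L1V u1) (k + Z.of_nat j + Z.of_nat q)%Z) w
        (2 * (n1 + n2 - (k + Z.of_nat j) - 1) - (m - Z.of_nat j) - 2 - Z.of_nat i - Z.of_nat l - Z.of_nat q)%Z)))))))); [ring|].
    f_equal. replace (Z.to_nat (K0 - (k + Z.of_nat j))) with (n - j)%nat by (unfold n; lia).
    rewrite <- Csum_scal. apply Csum_ext. intros i _.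
    rewrite <- Csum_scal. apply Csum_ext. intros l _.
    rewrite <- Csum_scal. apply Csum_ext. intros q _. unfold B.
    replace (2 * (n1 + n2 - (k + Z.of_nat j) - 1) - (m - Z.of_nat j) - 2 - Z.of_nat i - Z.of_nat l - Z.of_nat q)%Z
      with (2 * n1 + 2 * n2 - 2 * k - m - Z.of_nat i - Z.of_nat l - (Z.of_nat j + Z.of_nat q) - 4)%Z by lia.
    replace (k + (Z.of_nat j + Z.of_nat q))%Z with (k + Z.of_nat j + Z.of_nat q)%Z by lia.
    replace (2 * n2 - (k + Z.of_nat j) - 2 - Z.of_nat i)%Z
      with (2 * n2 - k - 2 - Z.of_nat i - Z.of_nat j)%Z by lia.
    ring.
  - f_equal. rewrite Csum_swap. apply Csum_ext. intros i _. rewrite Csum_swap.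
    apply Csum_ext. intros l _. rewrite Csum_seq_triangle. apply Csum_ext. intros r _.
    rewrite <- (gbin_vandermonde r m (2 * n2 - k - 2 - Z.of_nat i)).
    transitivity (Cmul (B i l (Z.of_nat r)) (Csum (seq 0 (S r))
    (fun j : nat => Cmul (Csign (Z.of_nat j)) (Cmul (gbin m j) (gbin (2 * n2 - k - 2 - Z.of_nat i - Z.of_nat j) (r - j))))));
      [|unfold B; ring].
    rewrite <- Csum_scal. apply Csum_ext. intros j Hj. apply in_seq in Hj.
    replace (Z.of_nat j + Z.of_nat (r - j))%Z with (Z.of_nat r) by lia. ring.
Qed.

End Homogeneous.
End OppositeIterate.

(** * Re-expansion of iterates *)

(** The support lies on a half-line: k + m = s with k < K0. Numbering it by n = K0 - 1 - k makes the
    double series a simple one. *)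
Lemma asum_antidiagonal (K0 s : Z) (a : list Z -> Cplx) (R : Cplx) :
  let phi n := [(K0 - 1 - Z.of_nat n)%Z; (s - (K0 - 1 - Z.of_nat n))%Z] in
  (forall k m, (K0 <= k \/ k + m <> s)%Z -> a [k; m] = C0) ->
  abs_sum_to 2 a R <-> asum (fun _ => True) (fun n => a (phi n)) R.
Proof.
  intros phi Ha. rewrite abs_sum_to_asum.
  set (P' := fun ks => exists n, ks = phi n).
  set (psi := fun ks : list Z => Z.to_nat (K0 - 1 - hd 0%Z ks)).
  assert (S : forall ks, P' ks -> length ks = 2%nat) by (intros ks [n ->]; reflexivity).
  assert (Z : forall ks, length ks = 2%nat -> ~ P' ks -> a ks = C0).
  { intros [|k [|m [|]]] L N; try discriminate. apply Ha.
    destruct (Z_lt_dec k K0); [|lia]. right. intros E. apply N.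
    exists (Z.to_nat (K0 - 1 - k)). unfold phi. repeat f_equal; lia. }
  assert (PP : forall ks, P' ks -> phi (psi ks) = ks).
  { intros ks [n ->]. unfold psi, phi; simpl hd. repeat f_equal; lia. }
  split; intros H.
  - apply (asum_restrict _ P') in H; auto.
    apply (asum_bij P' (fun _ => True) phi psi) in H; auto.
    + intros n _; exists n; auto.
    + intros n _; unfold psi, phi; simpl hd; lia.
  - apply (asum_extend _ P'); auto.
    apply (asum_ext P' (fun ks => a (phi (psi ks)))); [intros; f_equal; auto|].
    apply (asum_bij (fun _ => True) P' psi phi (fun n => a (phi n))); auto.
    + intros n _; exists n; auto.
    + intros n _; unfold psi, phi; simpl hd; lia.
Qed.

Lemma Cinv_sub_eq z1 z2 : z1 <> C0 -> z2 <> C0 ->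
  Csub (Cinv z2) (Cinv z1) = Cmul (Csub z1 z2) (Cinv (Cmul z1 z2)).
Proof. intros; rewrite Cinv_mul. field; auto. Qed.

(** As 1/z_2 - 1/z_1 = (z_1 - z_2)/(z_1 z_2), the new conditions are the old ones divided by |z_1|
    |z_2|. *)
Lemma iter_region_inv z1 z2 : iter_region [z1; z2] -> iter_region [Cinv z2; Cinv z1].
Proof.
  intros H. destruct (iter_region_neq z1 z2 H) as (N1 & N2 & N3). destruct H as [H1 H2].
  assert (P1 := Cnorm_gt0 z1 N1). assert (P2 := Cnorm_gt0 z2 N2).
  assert (P1' := Rinv_0_lt_compat _ P1). assert (P2' := Rinv_0_lt_compat _ P2).
  unfold iter_region. rewrite Cinv_sub_eq, Cnorm_mul, Cinv_mul, Cnorm_mul, !Cnorm_inv by auto.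
  split.
  - apply Rlt_gt.
    apply Rlt_le_trans with (/ Cnorm z1 * (Cnorm z2 * / Cnorm z2));
      [|rewrite Rinv_r by lra; lra].
    rewrite Rmult_comm, Rmult_assoc. apply Rmult_lt_compat_l; auto.
    rewrite Rmult_comm. apply Rmult_lt_compat_r; auto.
  - apply Rmult_gt_0_compat; auto. apply Rmult_gt_0_compat; auto.
Qed.

Lemma assoc_region_iter z1 z2 : assoc_region z1 z2 -> iter_region [z1; z2].
Proof. intros (H1 & H2 & H3); split; auto. Qed.

Lemma assoc_region_chain z1 z2 : assoc_region z1 z2 -> norm_chain [z1; z2].
Proof. intros (H1 & H2 & H3); simpl; split; lra. Qed.

Lemma assoc_region_inv z1 z2 : assoc_region z1 z2 -> assoc_region (Cinv z2) (Cinv z1).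
Proof.
  intros H. assert (I := assoc_region_iter _ _ H).
  destruct (iter_region_neq z1 z2 I) as (N1 & N2 & _).
  destruct (iter_region_inv z1 z2 I) as [I1 I2]. destruct H as (H1 & _).
  split; auto. rewrite !Cnorm_inv by auto.
  assert (P2 := Cnorm_gt0 z2 N2). apply Rinv_lt_contravar; auto.
  apply Rmult_lt_0_compat; lra.
Qed.

(* With [z1 = z2 + x0], homogeneity makes the iterate a single power series in
   [y = x0/z2], and the expansion of the power of [z1] is the factor [(1 + y)^Q]. *)
Lemma iter_series_expand (B : Z -> Z -> Cplx) (K0 s S Q : Z) (z1 z2 R : Cplx) :
  iter_region [z1; z2] ->
  (forall k m, (K0 <= k \/ k + m <> s)%Z -> B k m = C0) ->
  abs_sum_to 2 (fun ks => match ks with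
    | [k; m] => Cmul (B k m) (Cmul (Cpowz (Csub (Cinv z2) (Cinv z1)) (- k - 1)%Z)
                                   (Cpowz (Cinv z1) (- m - 1)%Z))
    | _ => C0 end) R ->
  abs_sum_to 2 (fun ks => match ks with
    | [k; m] => Cmul (if Z.eq_dec (k + m) S then
          Csum (seq 0 (Z.to_nat (K0 - k))) (fun r =>
            Cmul (gbin Q r) (B (k + Z.of_nat r)%Z (s - (k + Z.of_nat r))%Z)) else C0)
        (Cmul (Cpowz (Csub z1 z2) (- k - 1)%Z) (Cpowz z2 (- m - 1)%Z))
    | _ => C0 end)
    (Cmul (Cmul (Cpowz z1 (Q - s - 2)%Z) (Cpowz z2 (- S - 2 - Q)%Z)) R).
Proof.
  intros HR HB. destruct (iter_region_neq z1 z2 HR) as (N1 & N2 & N0).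
  set (x0 := Csub z1 z2) in *. set (y := Cdiv x0 z2).
  assert (N12 := Cmul_neq0 z1 z2 N1 N2).
  rewrite (asum_antidiagonal K0 s), (asum_antidiagonal K0 S); cbn beta iota zeta.
  2:{ intros k m H. destruct Z.eq_dec as [E|E]; [|ring].
      replace (Z.to_nat (K0 - k)) with 0%nat by lia. simpl. ring. }
  2:{ intros k m H. rewrite HB by auto. ring. }
  intros HS.
  set (b := fun n => B (K0 - 1 - Z.of_nat n)%Z (s - (K0 - 1 - Z.of_nat n))%Z).
  (* In the given series the powers of z_1 that depend on n cancel, leaving terms c1 b_n y^n. The
     terms of the wanted series are c2 y^n times the convolution of b with the coefficients of (1 +
     y)^Q. *)
  set (c1 := Cmul (Cpowz x0 (- K0)) (Cmul (Cpowz z1 (s + 2)) (Cpowz z2 K0))).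
  set (c2 := Cmul (Cpowz x0 (- K0)) (Cpowz z2 (K0 - S - 2))).
  assert (c1N : c1 <> C0) by (repeat apply Cmul_neq0; apply Cpowz_neq0; auto).
  assert (HS1 : asum (fun _ => True) (fun n => Cmul (b n) (Cpow y n)) (Cmul (Cinv c1) R)).
  { eapply asum_ext; [|apply asum_scal, HS]. intros n _. cbn beta.
    fold (b n). set (N := Z.of_nat n).
    rewrite Cinv_sub_eq by auto. fold x0.
    rewrite Cpowz_mul by (auto using Cinv_neq0). rewrite !Cpowz_inv, Cpowz_mul by auto.
    rewrite <- Cpowz_nat. fold N. unfold y, Cdiv.
    rewrite Cpowz_mul by (auto using Cinv_neq0). rewrite Cpowz_inv by auto.
    unfold c1. rewrite !Cinv_mul. rewrite <- !Cpowz_opp by auto.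
    replace (- (K0 - 1 - N) - 1)%Z with (N + - K0)%Z by lia.
    replace (- (N + - K0))%Z with (- N + K0)%Z by lia.
    replace (- (- (s - (K0 - 1 - N)) - 1))%Z with (s + 2 + N - K0)%Z by lia.
    transitivity (Cmul (b n) (Cmul (Cpowz x0 (- - K0 + (N + - K0)))
       (Cmul (Cpowz z1 (- (s + 2) + (- N + K0 + (s + 2 + N - K0)))) (Cpowz z2 (- K0 + (- N + K0)))))).
    - rewrite !(Cpowz_add x0), !(Cpowz_add z2), !(Cpowz_add z1) by auto. ring.
    - replace (- (s + 2) + (- N + K0 + (s + 2 + N - K0)))%Z with 0%Z by lia.
      replace (- - K0 + (N + - K0))%Z with N by lia.
      replace (- K0 + (- N + K0))%Z with (- N)%Z by lia. simpl (Cpowz z1 0). ring. }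
  assert (Hy : Cnorm y < 1).
  { unfold y, Cdiv. rewrite Cnorm_mul, Cnorm_inv by auto. destruct HR as [H1 _].
    assert (P2 := Cnorm_gt0 z2 N2). apply Rmult_lt_reg_r with (Cnorm z2); auto.
    rewrite Rmult_assoc, Rinv_l by lra. fold x0 in H1. lra. }
  assert (HS2 := asum_scal _ c2 _ _ (asum_binomial_series b y _ Q Hy HS1)).
  (* 1 + y = z_1/z_2, so the binomial factor is itself a monomial in z_1 and z_2. *)
  assert (E1 : Cadd C1 y = Cmul z1 (Cinv z2)) by (unfold y, x0; field; auto).
  replace (Cmul (Cmul (Cpowz z1 (Q - s - 2)) (Cpowz z2 (- S - 2 - Q))) R)
    with (Cmul c2 (Cmul (Cpowz (Cadd C1 y) Q) (Cmul (Cinv c1) R))).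
  - eapply asum_ext; [|exact HS2]. intros n _. cbn beta.
    destruct Z.eq_dec as [_|E]; [|lia].
    replace (Z.to_nat (K0 - (K0 - 1 - Z.of_nat n))) with (Datatypes.S n) by lia.
    rewrite (Csum_ext _ (fun r => Cmul (gbin Q r)
        (B (K0 - 1 - Z.of_nat n + Z.of_nat r)%Z (s - (K0 - 1 - Z.of_nat n + Z.of_nat r))%Z))
      (fun r => Cmul (gbin Q r) (b (n - r)%nat))).
    + set (Z0 := Csum _ _). set (N := Z.of_nat n).
      rewrite <- Cpowz_nat. fold N. unfold y, Cdiv.
      rewrite Cpowz_mul by (auto using Cinv_neq0). rewrite Cpowz_inv by auto.
      unfold c2.
      replace (- (K0 - 1 - N) - 1)%Z with (- K0 + N)%Z by lia.
      replace (- (S - (K0 - 1 - N)) - 1)%Z with (K0 - S - 2 + - N)%Z by lia.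
      rewrite (Cpowz_add x0), (Cpowz_add z2 (K0 - S - 2)) by auto. ring.
    + intros r Hr. apply in_seq in Hr. unfold b. f_equal. f_equal; lia.
  - rewrite E1, Cpowz_mul by (auto using Cinv_neq0). rewrite Cpowz_inv by auto.
    unfold c1, c2. rewrite !Cinv_mul. rewrite <- !Cpowz_opp by auto.
    replace (Q - s - 2)%Z with (Q + - (s + 2))%Z by lia.
    replace (- S - 2 - Q)%Z with (K0 - S - 2 + - Q + - K0)%Z by lia.
    rewrite !(Cpowz_add z1 Q), !(Cpowz_add z2 _ (- K0)), !(Cpowz_add z2 _ (- Q)) by auto.
    rewrite (Cpowz_opp x0 (- K0)) by auto.
    field. repeat split; apply Cpowz_neq0; auto.
Qed.

(** * Convergence and associativity for opposite vertex operators *)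

Lemma ratsum_Csum {I} n region (l : list I) (T : I -> list Cplx -> list Z -> Cplx) :
  (forall i, In i l -> exists F, ratsum n region (T i) F) ->
  exists F, ratsum n region (fun zs ks => Csum l (fun i => T i zs ks)) F.
Proof.
  induction l as [|i l IH]; intros H.
  - exists (fun _ => C0). split; [apply ratfun_const|]. intros zs _ _. apply asum_0.
  - destruct (H i) as (F & R & S); [left; auto|].
    destruct IH as (F' & R' & S'); [intros; apply H; right; auto|].
    exists (fun zs => Cadd (F zs) (F' zs)). split; [apply ratfun_add; auto|].
    intros zs L Z. apply asum_add; [apply S|apply S']; auto.
Qed.

Lemma ratsum_scal n region c T F :
  ratsum n region T F -> ratsum n region (fun zs ks => Cmul c (T zs ks)) (fun zs => Cmul c (F zs)).
Proof.
  intros [R S]. split; [apply ratfun_mul; auto; apply ratfun_const|].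
  intros zs L Z. apply asum_scal. apply S; auto.
Qed.

Lemma ratsum_ext n region T T' F :
  (forall zs ks, length zs = n -> region zs -> length ks = n -> T zs ks = T' zs ks) ->
  ratsum n region T F -> ratsum n region T' F.
Proof.
  intros E [R S]. split; auto. intros zs L Z.
  apply (asum_ext _ (T zs)); [intros; apply E; auto|apply S; auto].
Qed.

(** Convergence and associativity for fixed vectors, with associativity phrased as the existence of
    a common sum. In this form the property passes to linear combinations, which allows the
    reduction to homogeneous vectors. *)
Definition compat (P I : list Cplx -> list Z -> Cplx) : Prop :=
  (exists F, ratsum 2 iter_region I F) /\
  forall z1 z2, assoc_region z1 z2 ->
    exists s, abs_sum_to 2 (P [z1; z2]) s /\ abs_sum_to 2 (I [z1; z2]) s.

Lemma compat_Csum {J} (l : list J) (P I : J -> list Cplx -> list Z -> Cplx) :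
  (forall j, In j l -> compat (P j) (I j)) ->
  compat (fun zs ks => Csum l (fun j => P j zs ks)) (fun zs ks => Csum l (fun j => I j zs ks)).
Proof.
  intros H. split; [apply ratsum_Csum; intros; apply H; auto|].
  intros z1 z2 Hz. induction l as [|j l IH].
  - exists C0. split; apply asum_0.
  - destruct (proj2 (H j (or_introl eq_refl)) z1 z2 Hz) as (s & S1 & S2).
    destruct IH as (s' & S1' & S2'); [intros; apply H; right; auto|].
    exists (Cadd s s'). split; apply asum_add; auto.
Qed.

Lemma compat_add P I P' I' : compat P I -> compat P' I' ->
  compat (fun zs ks => Cadd (P zs ks) (P' zs ks)) (fun zs ks => Cadd (I zs ks) (I' zs ks)).
Proof.
  intros [[F [R S]] H] [[F' [R' S']] H']. split.
  - exists (fun zs => Cadd (F zs) (F' zs)). split; [apply ratfun_add; auto|].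
    intros zs L Z. apply asum_add; [apply S|apply S']; auto.
  - intros z1 z2 Hz. destruct (H z1 z2 Hz) as (s & S1 & S2), (H' z1 z2 Hz) as (s' & S1' & S2').
    exists (Cadd s s'). split; apply asum_add; auto.
Qed.

Lemma compat_scal c P I : compat P I ->
  compat (fun zs ks => Cmul c (P zs ks)) (fun zs ks => Cmul c (I zs ks)).
Proof.
  intros [[F R] H]. split; [eexists; apply ratsum_scal; exact R|].
  intros z1 z2 Hz. destruct (H z1 z2 Hz) as (s & S1 & S2).
  exists (Cmul c s). split; apply asum_scal; auto.
Qed.

Lemma compat_ext P I P' I' :
  (forall z1 z2 k m, P [z1; z2] [k; m] = P' [z1; z2] [k; m]) ->
  (forall z1 z2 k m, I [z1; z2] [k; m] = I' [z1; z2] [k; m]) ->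
  compat P I -> compat P' I'.
Proof.
  intros EP EI [[F R] H]. split.
  - exists F. apply (ratsum_ext _ _ I); auto.
    intros [|z1 [|z2 [|]]] [|k [|m [|]]]; try discriminate; auto.
  - intros z1 z2 Hz. destruct (H z1 z2 Hz) as (s & S1 & S2). exists s. split.
    + apply (asum_ext _ (P [z1; z2])); [|exact S1].
      intros [|k [|m [|]]]; try discriminate; auto.
    + apply (asum_ext _ (I [z1; z2])); [|exact S2].
      intros [|k [|m [|]]]; try discriminate; auto.
Qed.

Definition zsub (ss ks : list Z) : list Z := map (fun p => (fst p - snd p)%Z) (combine ss ks).

(** The monomial split off when z^(-k-1) is written as z^(-s-2) times (1/z)^(-(s-k)-1), one shift s
    for each variable. *)
Definition zmono (zs : list Cplx) (ss : list Z) : Cplx :=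
  Cprod (map (fun p => Cpowz (fst p) (- snd p - 2)%Z) (combine zs ss)).

Lemma zsub_length ss ks : length ss = length ks -> length (zsub ss ks) = length ks.
Proof. intros H. unfold zsub. rewrite length_map, length_combine. lia. Qed.

Lemma zsub_zsub ss ks : length ss = length ks -> zsub ss (zsub ss ks) = ks.
Proof.
  revert ks; induction ss as [|s ss IH]; intros [|k ks] H; try discriminate; auto.
  injection H as H. unfold zsub in *. simpl. f_equal; [lia|auto].
Qed.

Lemma ratfun_zmono ss : ratfun (length ss) (fun zs => zmono zs ss).
Proof.
  apply ratfun_ext with (fun zs =>
    Cprod (map (fun i => Cpowz (nth i zs C0) (- nth i ss 0%Z - 2)%Z) (seq 0 (length ss)))).
  - intros zs H _. unfold zmono. revert zs H.
    induction ss as [|s ss IH]; intros [|z zs] H; try discriminate; auto.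
    injection H as H. cbn [length seq map combine Cprod fold_right]. cbn [fst snd]. simpl nth.
    f_equal. rewrite <- seq_shift, map_map. apply IH; auto.
  - assert (H : forall i, In i (seq 0 (length ss)) -> (i < length ss)%nat)
      by (intros i Hi; apply in_seq in Hi; lia).
    induction (seq 0 (length ss)) as [|i l IH]; [apply (ratfun_const _ C1)|].
    apply (ratfun_mul _ (fun zs => Cpowz (nth i zs C0) (- nth i ss 0%Z - 2)%Z)).
    + apply ratfun_coord_Cpowz, H. left; auto.
    + apply IH. intros; apply H; right; auto.
Qed.

Lemma zfac_snoc zs ks z k : length zs = length ks ->
  zfac (zs ++ [z]) (ks ++ [k]) = Cmul (zfac zs ks) (Cpowz z (- k - 1)%Z).
Proof.
  revert ks; induction zs as [|z' zs IH]; intros [|k' ks] H; try discriminate; simpl; [ring|].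
  rewrite IH by (simpl in H; lia). ring.
Qed.

Lemma zfac_rev_inv zs ks ss : ~ In C0 zs -> length zs = length ks -> length ss = length ks ->
  zfac zs ks = Cmul (zmono zs ss) (zfac (rev (map Cinv zs)) (rev (zsub ss ks))).
Proof.
  revert ks ss; induction zs as [|z zs IH]; intros [|k ks] [|s ss] N H1 H2; try discriminate.
  - unfold zmono. simpl. ring.
  - simpl in H1, H2. change (zsub (s :: ss) (k :: ks)) with ((s - k)%Z :: zsub ss ks).
    cbn [map rev]. rewrite zfac_snoc.
    2:{ rewrite !length_rev, length_map, zsub_length; lia. }
    assert (Hz : z <> C0) by (intros ->; apply N; left; auto).
    rewrite Cpowz_inv by auto. cbn [zfac]. rewrite (IH ks ss); try lia.
    2:{ intros Hi; apply N; right; auto. }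
    change (zmono (z :: zs) (s :: ss)) with (Cmul (Cpowz z (- s - 2)) (zmono zs ss)).
    replace (- k - 1)%Z with (- s - 2 + - (- (s - k) - 1))%Z by lia.
    rewrite Cpowz_add by auto. ring.
Qed.

Lemma opprod_snoc {A W : VSpace} (Y : A -> W -> Z -> W) vs js v j w :
  length vs = length js -> opprod Y (vs ++ [v]) (js ++ [j]) w = opprod Y vs js (Y v w j).
Proof.
  revert js; induction vs as [|v' vs IH]; intros [|j' js] H; try discriminate; auto.
  simpl. rewrite IH by (simpl in H; lia). reflexivity.
Qed.

Lemma opprod_lin {A W : VSpace} (Y : A -> W -> Z -> W) vs js :
  (forall u k, is_lin (fun w => Y u w k)) -> is_lin (opprod Y vs js).
Proof.
  intros H. revert js; induction vs as [|v vs IH]; intros [|j js]; try (split; auto).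
  - intros x y. simpl. rewrite (proj1 (IH js)). apply (H v j).
  - intros c x. simpl. rewrite (proj2 (IH js)). apply (H v j).
Qed.

(** The reindexing k -> s - k, followed by reversal, is a bijection of integer lists of the given
    length; it matches the powers of 1/z up to the monomial [zmono zs ss]. *)
Lemma prod_term_transfer {A W : VSpace} (Y : A -> W -> Z -> W) vs w f zs ss r :
  nondeg zs -> length ss = length zs ->
  abs_sum_to (length zs) (prod_term Y vs w f (rev (map Cinv zs))) r ->
  abs_sum_to (length zs)
    (fun ks => Cmul (f (opprod Y vs (rev (zsub ss ks)) w)) (zfac zs ks)) (Cmul (zmono zs ss) r).
Proof.
  intros D L H. rewrite abs_sum_to_asum in *.
  apply (asum_scal _ (zmono zs ss)) in H.
  eapply asum_ext; [|apply (asum_bij (fun ks => length ks = length zs) (fun ks => length ks = length zs)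
     (fun ks => rev (zsub ss ks)) (fun js => zsub ss (rev js))
     (fun js => Cmul (zmono zs ss) (prod_term Y vs w f (rev (map Cinv zs)) js)))]; [| | | | |exact H].
  - intros ks Hk. cbn beta. unfold prod_term. rewrite (zfac_rev_inv zs ks ss); auto; try lia.
    + ring.
    + unfold nondeg in D. inversion_clear D; auto.
  - intros ks Hk. rewrite length_rev, zsub_length; lia.
  - intros js Hj. rewrite zsub_length; rewrite length_rev; lia.
  - intros ks Hk. rewrite rev_involutive. apply zsub_zsub. lia.
  - intros js Hj. rewrite zsub_zsub; [apply rev_involutive|]. rewrite length_rev; lia.
Qed.

Section Convergence.
Variables (V : VAData) (rV : SL2 (va_sp V)).
Hypothesis HM : is_mobius_MOSVA V rV.
Variables (M : ModData V) (rW : SL2 (m_sp M)).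
Hypothesis HW : is_mobius_module V rV M rW.
Notation A := (va_sp V).
Notation W := (m_sp M).
Notation YV := (va_Y V).
Notation YW := (m_Y M).
Notation homV := (hom (va_gr V)).
Notation homW := (hom (m_gr M)).
Notation L1V := (L1 rV).
Notation YoM := (Yo V rV M).
Let HVs : is_vspace A := V_vspace V rV HM.
Let HVg : is_grading (va_gr V) := V_grading V rV HM.
Let HWs : is_vspace W := W_vspace V rV M rW HW.
Let HWg : is_grading (m_gr M) := W_grading V rV M rW HW.

Lemma W_rat_assoc : rat_assoc (va_Y V) YW (m_gr M).
Proof. apply HW. Qed.

(* [<w', Y^o(u_n,z_n) ... Y^o(u_1,z_1) w>]: the first vector acts first. *)
Fixpoint revYo (us : list A) (ks : list Z) (w : W) : W :=
  match us, ks with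
  | u :: us', k :: ks' => revYo us' ks' (YoM u w k)
  | _, _ => w
  end.

Definition prodo_term us w (f : W -> Cplx) (zs : list Cplx) (ks : list Z) : Cplx :=
  Cmul (f (revYo us ks w)) (zfac zs ks).

Definition itero_term u1 u2 w (f : W -> Cplx) (zs : list Cplx) (ks : list Z) : Cplx :=
  match zs, ks with
  | [z1; z2], [k; m] =>
      Cmul (f (YoM (opp_Y V u1 u2 k) w m))
           (Cmul (Cpowz (Csub z1 z2) (- k - 1)%Z) (Cpowz z2 (- m - 1)%Z))
  | _, _ => C0
  end.

(** A presentation of Y^o(u, x) as a finite sum of c x^(-s-2) Y_W(v, 1/x), recorded as triples ((c,
    v), s). *)
Definition Yo_list (u : A) (L : list ((Cplx * A) * Z)) : Prop :=
  forall f w p, is_linfun f ->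
    f (YoM u w p)
    = Csum L (fun q => Cmul (fst (fst q)) (f (YW (snd (fst q)) w (snd q - p)%Z))).

Lemma Yo_list_exists u : exists L, Yo_list u L.
Proof.
  destruct (Yo_bound_exists V rV HM [u]) as (S & K & B).
  rewrite Forall_cons_iff in B. destruct B as (B & _).
  exists (map (fun q => (Cmul (Csign (fst q)) (invfact (snd q)),
      Nat.iter (snd q) L1V (gproj (va_gr V) (fst q) u),
      (2 * fst q - Z.of_nat (snd q) - 2)%Z)) (list_prod S (seq 0 K))).
  intros f w p Hf. rewrite (Yo_eq V rV HM M rW HW f u w p S K) by auto.
  rewrite Csum_map, Csum_prod. apply Csum_ext. intros n _. apply Csum_ext. intros m _.
  cbn [fst snd].
  replace (2 * n - Z.of_nat m - 2 - p)%Z with (2 * n - p - Z.of_nat m - 2)%Z by lia. reflexivity.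
Qed.

(** Multiplies out a product of such presentations. The vectors are appended at the end, because the
    first opposite operator acts first and so stands rightmost in the product of Y_W; the shifts
    keep the original order. *)
Fixpoint expand (Ls : list (list ((Cplx * A) * Z))) : list (Cplx * list A * list Z) :=
  match Ls with
  | [] => [(C1, [], [])]
  | L :: Ls' => map (fun p => (Cmul (fst (fst (fst p))) (fst (fst (snd p))),
                               snd (fst (snd p)) ++ [snd (fst (fst p))],
                               snd (fst p) :: snd (snd p))) (list_prod L (expand Ls'))
  end.

Lemma expand_length Ls e : In e (expand Ls) ->
  length (snd (fst e)) = length Ls /\ length (snd e) = length Ls.
Proof.
  revert e; induction Ls as [|L Ls IH]; intros e; simpl.
  - intros [<-|[]]; auto.
  - intros H. apply in_map_iff in H as ([q e'] & <- & H). apply in_prod_iff in H as [_ H].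
    destruct (IH e' H) as [H1 H2]. simpl. rewrite length_app, H1, H2. simpl. lia.
Qed.

Lemma revYo_expand us Ls ks w f : Forall2 Yo_list us Ls -> length ks = length us -> is_linfun f ->
  f (revYo us ks w) = Csum (expand Ls) (fun e =>
    Cmul (fst (fst e)) (f (opprod YW (snd (fst e)) (rev (zsub (snd e) ks)) w))).
Proof.
  intros H. revert ks w. induction H as [|u L us Ls HL HLs IH]; intros [|k ks] w Hk Hf;
    try discriminate.
  - simpl. ring.
  - injection Hk as Hk. simpl revYo. rewrite IH by auto. cbn [expand].
    rewrite Csum_map, Csum_prod, Csum_swap. apply Csum_ext. intros e He.
    destruct (expand_length Ls e He) as [E1 E2]. apply Forall2_length in HLs.
    cbn [fst snd].
    assert (Hlin : is_linfun (fun x => f (opprod YW (snd (fst e)) (rev (zsub (snd e) ks)) x))).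
    { apply is_linfun_comp; auto. apply opprod_lin, (YW_lin_r V rV M rW HW). }
    rewrite (HL _ w k Hlin), <- Csum_scal. apply Csum_ext. intros q _.
    change (zsub (snd q :: snd e) (k :: ks)) with ((snd q - k)%Z :: zsub (snd e) ks).
    cbn [rev]. rewrite opprod_snoc; [ring|].
    rewrite length_rev, zsub_length; lia.
Qed.

Lemma prodo_series us w f : gdual (m_gr M) f ->
  rational_series (length us) norm_chain (prodo_term us w f).
Proof.
  intros Hf. apply rational_series_ratsum; [apply norm_chain_nondeg|].
  assert (exists Ls, Forall2 Yo_list us Ls) as [Ls HLs].
  { induction us as [|u us [Ls IH]]; [exists []; constructor|].
    destruct (Yo_list_exists u) as [L HL]. exists (L :: Ls). constructor; auto. }
  assert (EL := Forall2_length HLs).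
  destruct (ratsum_Csum (length us) norm_chain (expand Ls) (fun e zs ks =>
     Cmul (fst (fst e)) (Cmul (f (opprod YW (snd (fst e)) (rev (zsub (snd e) ks)) w)) (zfac zs ks))))
    as [F HF].
  - intros e He. destruct (expand_length Ls e He) as [E1 E2].
    destruct (W_rat_assoc f Hf) as [H _]. specialize (H (snd (fst e)) w).
    rewrite E1, <- EL in H.
    apply (rational_series_ratsum _ _ _ norm_chain_nondeg) in H as (R & HR1 & HR2).
    eexists. apply ratsum_scal. instantiate (1 := fun zs => Cmul (zmono zs (snd e)) (R (rev (map Cinv zs)))).
    split.
    + apply ratfun_mul; [|apply ratfun_rev_inv; auto].
      rewrite EL, <- E2. apply ratfun_zmono.
    + intros zs L Hz. rewrite <- L. apply prod_term_transfer.
      * apply norm_chain_nondeg; auto.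
      * lia.
      * rewrite L. apply HR2; [rewrite length_rev, length_map; auto|].
        apply norm_chain_rev_inv; auto.
  - exists F. eapply ratsum_ext; [|exact HF]. intros zs ks L Hz Lk. cbn beta.
    unfold prodo_term. rewrite (revYo_expand us Ls ks w f HLs) by (auto; apply Hf).
    transitivity (Cmul (zfac zs ks) (Csum (expand Ls) (fun e =>
     Cmul (fst (fst e)) (f (opprod YW (snd (fst e)) (rev (zsub (snd e) ks)) w)))));
      [|ring].
    rewrite <- Csum_scal. apply Csum_ext. intros; ring.
Qed.

Lemma W_compat v2 v1 w f : gdual (m_gr M) f ->
  compat (prod_term YW [v2; v1] w f) (iter_term YV YW v2 v1 w f).
Proof.
  intros Hf. destruct (W_rat_assoc f Hf) as (H1 & H2 & H3). split.
  - apply (rational_series_ratsum _ _ _ iter_region_nondeg), H2.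
  - intros z1 z2 Hz.
    specialize (H1 [v2; v1] w). apply (rational_series_ratsum _ _ _ norm_chain_nondeg) in H1 as (F & _ & HF).
    specialize (H2 v2 v1 w). apply (rational_series_ratsum _ _ _ iter_region_nondeg) in H2 as (G & _ & HG).
    assert (SF := HF [z1; z2] eq_refl (assoc_region_chain _ _ Hz)).
    assert (SG := HG [z1; z2] eq_refl (assoc_region_iter _ _ Hz)).
    exists (F [z1; z2]). split; auto.
    rewrite (H3 v2 v1 w z1 z2 _ _ Hz SF SG). exact SG.
Qed.

(** The two equations on exponents say that the monomial z_1^(Q-s-2) z_2^(-S-2-Q) from re-expanding
    the iterate equals the monomial z_1^(-s1-2) z_2^(-s2-2) from the product. A common sum for Y_W
    at (1/z_2, 1/z_1) therefore gives a common sum here. *)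
Lemma compat_transfer v2 v1 w f (K0 s S Q s1 s2 : Z) : gdual (m_gr M) f ->
  (Q - s = - s1)%Z -> (S + Q = s2)%Z ->
  (forall k m, (K0 <= k \/ k + m <> s)%Z -> f (YW (YV v2 v1 k) w m) = C0) ->
  compat
    (fun zs ks => match ks with
      | [k1; k2] => Cmul (f (YW v2 (YW v1 w (s1 - k1)%Z) (s2 - k2)%Z)) (zfac zs ks)
      | _ => C0 end)
    (fun zs ks => match zs, ks with
      | [z1; z2], [k; m] =>
        Cmul (if Z.eq_dec (k + m) S then
          Csum (seq 0 (Z.to_nat (K0 - k))) (fun r => Cmul (gbin Q r)
            (f (YW (YV v2 v1 (k + Z.of_nat r)%Z) w (s - (k + Z.of_nat r))%Z))) else C0)
        (Cmul (Cpowz (Csub z1 z2) (- k - 1)%Z) (Cpowz z2 (- m - 1)%Z))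
      | _, _ => C0 end).
Proof.
  intros Hf E1 E2 HB. destruct (W_compat v2 v1 w f Hf) as [[R [HR HS]] HC].
  assert (X : forall z1 z2 r, iter_region [z1; z2] ->
     abs_sum_to 2 (iter_term YV YW v2 v1 w f [Cinv z2; Cinv z1]) r ->
     abs_sum_to 2 (fun ks => match ks with
      | [k; m] =>
        Cmul (if Z.eq_dec (k + m) S then
          Csum (seq 0 (Z.to_nat (K0 - k))) (fun r => Cmul (gbin Q r)
            (f (YW (YV v2 v1 (k + Z.of_nat r)%Z) w (s - (k + Z.of_nat r))%Z))) else C0)
        (Cmul (Cpowz (Csub z1 z2) (- k - 1)%Z) (Cpowz z2 (- m - 1)%Z))
      | _ => C0 end) (Cmul (zmono [z1; z2] [s1; s2]) r)).
  { intros z1 z2 r Hz Hr.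
    replace (zmono [z1; z2] [s1; s2])
      with (Cmul (Cpowz z1 (Q - s - 2)) (Cpowz z2 (- S - 2 - Q))).
    - apply (iter_series_expand (fun k m => f (YW (YV v2 v1 k) w m)) K0 s S Q z1 z2 r Hz HB).
      eapply asum_ext; [|exact Hr].
      intros [|k [|m [|]]]; try discriminate. reflexivity.
    - unfold zmono. simpl. rewrite E1. replace (- S - 2 - Q)%Z with (- s2 - 2)%Z by lia. ring. }
  split.
  - exists (fun zs => Cmul (zmono zs [s1; s2]) (R (rev (map Cinv zs)))). split.
    + apply ratfun_mul; [apply (ratfun_zmono [s1; s2])|apply ratfun_rev_inv; auto].
    + intros [|z1 [|z2 [|]]] L Hz; try discriminate.
      apply (X z1 z2); auto. apply (HS [Cinv z2; Cinv z1]); auto.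
      apply iter_region_inv; auto.
  - intros z1 z2 Hz. assert (Iz := assoc_region_iter _ _ Hz).
    destruct (HC _ _ (assoc_region_inv _ _ Hz)) as (r & S1 & S2).
    exists (Cmul (zmono [z1; z2] [s1; s2]) r). split; [|apply (X z1 z2); auto].
    assert (T := prod_term_transfer YW [v2; v1] w f [z1; z2] [s1; s2] r
       (iter_region_nondeg _ Iz) eq_refl S1).
    eapply asum_ext; [|exact T].
    intros [|k [|m [|]]]; try discriminate. reflexivity.
Qed.

(** If h = h' + e with e an integer, only modes that change the degree by - e can reach degree h'.
    If h - h' is not an integer, every coefficient vanishes and e = 0 will do. *)
Lemma hom_matrix_weight f h h' w : is_linfun f -> homW h w ->
  exists e : Z, forall a x m, homV a x -> (e + a - m - 1 <> 0)%Z ->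
    f (gproj (m_gr M) h' (YW x w m)) = C0.
Proof.
  intros Hf Hw.
  assert (N : forall a x m, homV a x -> h' <> Cadd h (ZC (a - m - 1)) ->
      f (gproj (m_gr M) h' (YW x w m)) = C0).
  { intros a x m Hx Hn.
    rewrite (hom_neq Cplx W (m_gr M) HWg (Cadd h (ZC (a - m - 1)))).
    - apply (linfun_0 W); auto.
    - apply (YW_hom V rV HM M rW HW); auto.
    - auto. }
  destruct (classic (exists e, h = Cadd h' (ZC e))) as [[e He]|Ne].
  - exists e. intros a x m Hx Hn. apply (N a); auto. intros E. apply Hn.
    apply ZC_inj. transitivity (Csub (Cadd h (ZC (a - m - 1))) h').
    + rewrite He. replace (e + a - m - 1)%Z with (e + (a - m - 1))%Z by lia.
      rewrite ZC_add. ring.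
    + rewrite <- E. rewrite ZC_0. ring.
  - exists 0%Z. intros a x m Hx _. apply (N a); auto. intros E. apply Ne.
    exists (- (a - m - 1))%Z. rewrite E, ZC_opp. ring.
Qed.

Lemma gdual_gproj f h : is_linfun f -> gdual (m_gr M) (fun w => f (gproj (m_gr M) h w)).
Proof.
  intros Hf. split.
  - apply is_linfun_comp; auto. apply gproj_lin; auto.
  - exists [h]. intros n w Hn. rewrite (gproj_neq Cplx W _ HWg).
    + apply (linfun_0 W); auto.
    + intros ->. apply Hn. left; auto.
Qed.

Lemma compat_hom n1 n2 h h' u1 u2 w f : is_linfun f ->
  homV n1 u1 -> homV n2 u2 -> homW h w ->
  compat (prodo_term [u1; u2] w (fun x => f (gproj (m_gr M) h' x)))
         (itero_term u1 u2 w (fun x => f (gproj (m_gr M) h' x))).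
Proof.
  intros Hf0 H1 H2 Hw.
  destruct (hom_matrix_weight f h h' w Hf0 Hw) as [e He].
  assert (Hgf := gdual_gproj f h' Hf0).
  set (f' := fun x => f (gproj (m_gr M) h' x)) in *. assert (Hf := proj1 Hgf).
  destruct (V_bounded V rV HM) as [N HN].
  destruct (L1_iter_trunc V rV HM u1) as [K1 HK1], (L1_iter_trunc V rV HM u2) as [K2 HK2].
  set (K := (K1 + K2)%nat).
  assert (HK1' : Nat.iter K L1V u1 = vzero) by (apply HK1; lia).
  assert (HK2' : Nat.iter K L1V u2 = vzero) by (apply HK2; lia).
  (* For k >= K0 the mode has weight n_1 + n_2 - i - l - k - 1 < N, whatever i and l are; this is
     the uniform truncation. *)
  set (K0 := (n1 + n2 - N)%Z).
  assert (Hh : forall i l k, homV (n1 + n2 - Z.of_nat i - Z.of_nat l - k - 1)%Z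
      (YV (Nat.iter i L1V u2) (Nat.iter l L1V u1) k)).
  { intros i l k.
    replace (n1 + n2 - Z.of_nat i - Z.of_nat l - k - 1)%Z
      with (n2 - Z.of_nat i + (n1 - Z.of_nat l) - k - 1)%Z by lia.
    apply (Y_hom V rV HM); apply (L1_iter_hom V rV HM); auto. }
  assert (HK0 : forall i l k, (K0 <= k)%Z -> YV (Nat.iter i L1V u2) (Nat.iter l L1V u1) k = vzero).
  { intros i l k Hk. apply (HN _ _ (Hh i l k)). lia. }
  (* [S] and [s i l] are the lines k + m = const on which the weight condition lets the opposite
     iterate and the iterate of Y_W be nonzero. [Q i] is the merged binomial exponent 2 n_2 - 2 - i
     - (k + m) on the line [S]. *)
  set (S := (n1 + n2 - 2 - e)%Z).
  set (s := fun i l : nat => (e + n1 + n2 - Z.of_nat i - Z.of_nat l - 2)%Z).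
  set (Q := fun i : nat => (n2 - n1 - Z.of_nat i + e)%Z).
  assert (HB : forall i l k m, (K0 <= k \/ k + m <> s i l)%Z ->
     f' (YW (YV (Nat.iter i L1V u2) (Nat.iter l L1V u1) k) w m) = C0).
  { intros i l k m [Hk|Hk].
    - rewrite HK0, (YW_0_l V rV HM M rW HW) by auto. apply (linfun_0 W); auto.
    - apply (He _ _ m (Hh i l k)). unfold s in Hk. lia. }
  set (c := fun i l : nat => Cmul (Csign (n1 + n2)) (Cmul (invfact i) (invfact l))).
  (* L(1)^l u_1 and L(1)^i u_2 enter Y^o with mode shifts 2 n_1 - l - 2 and 2 n_2 - i - 2: these are
     the two shifts of the product. *)
  assert (G := compat_Csum (seq 0 K) _ _ (fun i _ => compat_Csum (seq 0 K) _ _ (fun l _ =>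
     compat_scal (c i l) _ _ (compat_transfer (Nat.iter i L1V u2) (Nat.iter l L1V u1) w f'
       K0 (s i l) S (Q i) (2 * n1 - Z.of_nat l - 2) (2 * n2 - Z.of_nat i - 2) Hgf
       ltac:(unfold Q, s; lia) ltac:(unfold Q, S; lia) (HB i l))))).
  revert G. apply compat_ext.
  - intros z1 z2 k m. unfold prodo_term. simpl revYo.
    rewrite (Yo_hom_eq V rV HM M rW HW f' n2 u2 _ m K) by auto.
    transitivity (Cmul (zfac [z1; z2] [k; m])
       (Csum (seq 0 K) (fun i => Cmul (Cmul (Csign n2) (invfact i))
        (f' (YW (Nat.iter i L1V u2) (YoM u1 w k) (2 * n2 - m - Z.of_nat i - 2)%Z))))); [|ring].
    rewrite <- Csum_scal. apply Csum_ext. intros i _.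
    assert (Hfi : is_linfun (fun x => f' (YW (Nat.iter i L1V u2) x (2 * n2 - m - Z.of_nat i - 2)%Z))).
    { apply (is_linfun_comp (fun x => YW (Nat.iter i L1V u2) x (2 * n2 - m - Z.of_nat i - 2)%Z)); auto.
      apply (YW_lin_r V rV M rW HW). }
    rewrite (Yo_hom_eq V rV HM M rW HW _ n1 u1 w k K Hfi) by auto.
    transitivity (Cmul (Cmul (zfac [z1; z2] [k; m]) (Cmul (Csign n2) (invfact i)))
      (Csum (seq 0 K) (fun l => Cmul (Cmul (Csign n1) (invfact l))
       (f' (YW (Nat.iter i L1V u2) (YW (Nat.iter l L1V u1) w (2 * n1 - k - Z.of_nat l - 2)%Z)
           (2 * n2 - m - Z.of_nat i - 2)%Z))))); [|ring].
    rewrite <- Csum_scal. apply Csum_ext. intros l _. unfold c. rewrite Csign_add.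
    replace (2 * n1 - Z.of_nat l - 2 - k)%Z with (2 * n1 - k - Z.of_nat l - 2)%Z by lia.
    replace (2 * n2 - Z.of_nat i - 2 - m)%Z with (2 * n2 - m - Z.of_nat i - 2)%Z by lia.
    ring.
  - intros z1 z2 k m. unfold itero_term.
    rewrite (Yo_opp_Y_eq V rV HM M rW HW n1 n2 u1 u2 K K0 H1 H2 HK1' HK2' HK0 f' w k m Hf).
    set (z := Cmul (Cpowz (Csub z1 z2) (- k - 1)) (Cpowz z2 (- m - 1))).
    match goal with |- _ = Cmul (Cmul ?a ?b) _ => transitivity (Cmul (Cmul z a) b); [|ring] end.
    rewrite <- Csum_scal. apply Csum_ext. intros i _.
    rewrite <- Csum_scal. apply Csum_ext. intros l _.
    unfold c.
    match goal with |- _ = Cmul _ ?b => transitivity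
      (Cmul (Cmul z (Csign (n1 + n2))) b); [|ring] end.
    match goal with |- Cmul _ (Cmul ?a _) = Cmul _ ?b =>
      enough (EE : b = Cmul (Cmul (invfact i) (invfact l)) a) by (rewrite EE; ring) end.
    destruct (Z.eq_dec (k + m) S) as [E|E].
    + rewrite <- Csum_scal. apply Csum_ext. intros r _.
      replace (2 * n2 - k - 2 - Z.of_nat i - m)%Z with (Q i) by (unfold Q, S in *; lia).
      replace (2 * n1 + 2 * n2 - 2 * k - m - Z.of_nat i - Z.of_nat l - Z.of_nat r - 4)%Z
        with (s i l - (k + Z.of_nat r))%Z by (unfold s, S in *; lia).
      ring.
    + rewrite Csum_0; [ring|]. intros r _. rewrite HB; [ring|].
      right. unfold s, S in *. lia.
Qed.

Lemma fsum_add (f1 f2 : nat -> A) :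
  (exists N, forall j, (N <= j)%nat -> f1 j = vzero) ->
  (exists N, forall j, (N <= j)%nat -> f2 j = vzero) ->
  fsum (fun j => vadd (f1 j) (f2 j)) = vadd (fsum f1) (fsum f2).
Proof.
  intros [N1 H1] [N2 H2].
  rewrite (fsum_eq A HVs f1 (N1 + N2)) by (intros; apply H1; lia).
  rewrite (fsum_eq A HVs f2 (N1 + N2)) by (intros; apply H2; lia).
  rewrite (fsum_eq A HVs _ (N1 + N2)).
  - apply vsum_add; auto.
  - intros j Hj. rewrite H1, H2 by lia. apply vadd_0l; auto.
Qed.

Lemma opp_Y_finite u v k : exists N, forall j, (N <= j)%nat ->
  vscal (Cmul (Csign (k + Z.of_nat j + 1)%Z) (invfact j))
          (Nat.iter j (va_D V) (YV v u (k + Z.of_nat j)%Z)) = vzero.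
Proof.
  destruct (Y_trunc V rV HM v u) as [K HK]. exists (Z.to_nat (K - k)). intros j Hj.
  rewrite HK by lia. rewrite (lin_0 A A) by (auto; apply is_lin_iter, (D_lin V rV HM)).
  apply vscal_vzero; auto.
Qed.

Lemma opp_Y_add_l x y v k : opp_Y V (vadd x y) v k = vadd (opp_Y V x v k) (opp_Y V y v k).
Proof.
  unfold opp_Y. rewrite <- fsum_add by apply opp_Y_finite.
  f_equal. apply functional_extensionality. intros j.
  rewrite (Y_add_r V rV HM), (proj1 (is_lin_iter _ j (D_lin V rV HM))). apply vscal_addr; auto.
Qed.

Lemma opp_Y_add_r u x y k : opp_Y V u (vadd x y) k = vadd (opp_Y V u x k) (opp_Y V u y k).
Proof.
  unfold opp_Y. rewrite <- fsum_add by apply opp_Y_finite.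
  f_equal. apply functional_extensionality. intros j.
  rewrite (Y_add_l V rV HM), (proj1 (is_lin_iter _ j (D_lin V rV HM))). apply vscal_addr; auto.
Qed.

Lemma gdual_decomp f : gdual (m_gr M) f ->
  exists S, NoDup S /\ forall x, f x = Csum S (fun h => f (gproj (m_gr M) h x)).
Proof.
  intros [Hf [S HS]]. exists (nodup eq_dec_classic S). split; [apply NoDup_nodup|]. intros x.
  rewrite (gsupp_sum Cplx W _ HWg x) at 1. rewrite (linfun_vsum W) by auto.
  apply Csum_support; [apply gsupp_nodup; auto|apply NoDup_nodup| |].
  - intros h _ Hh. apply HS. intros Hi. apply Hh, nodup_In, Hi.
  - intros h _ Hh. rewrite (gsupp_out Cplx W HWs _ HWg h x Hh). apply (linfun_0 W); auto.
Qed.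

(** The functional is a finite sum of its restrictions to single degrees, and both series are
    additive in u_1, u_2 and w, so the homogeneous case suffices. *)
Lemma compat_Yo u1 u2 w f : gdual (m_gr M) f ->
  compat (prodo_term [u1; u2] w f) (itero_term u1 u2 w f).
Proof.
  intros Hgf. destruct (gdual_decomp f Hgf) as (S & _ & HS).
  assert (Hf := proj1 Hgf).
  enough (G : forall h, compat (prodo_term [u1; u2] w (fun x => f (gproj (m_gr M) h x)))
         (itero_term u1 u2 w (fun x => f (gproj (m_gr M) h x)))).
  { assert (G' := compat_Csum S _ _ (fun h _ => G h)). revert G'. apply compat_ext.
    - intros z1 z2 k m. unfold prodo_term. rewrite HS.
      match goal with |- _ = Cmul ?a ?b => transitivity (Cmul b a); [|ring] end.
      rewrite <- Csum_scal. apply Csum_ext. intros; ring.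
    - intros z1 z2 k m. unfold itero_term. rewrite (HS (YoM _ w m)).
      match goal with |- _ = Cmul ?a ?b => transitivity (Cmul b a); [|ring] end.
      rewrite <- Csum_scal. apply Csum_ext. intros; ring. }
  intros h'. assert (Hf' := proj1 (gdual_gproj f h' Hf)).
  set (f' := fun x => f (gproj (m_gr M) h' x)) in *.
  assert (Lr := Yo_linfun_r V rV HM M rW HW).
  assert (Ll := Yo_linfun_l V rV HM M rW HW).
  revert u1. apply (hom_ind Z A HVs (va_gr V) HVg 0%Z).
  2:{ intros x y Hx Hy. assert (G := compat_add _ _ _ _ Hx Hy). revert G. apply compat_ext.
      - intros z1 z2 k m. unfold prodo_term. simpl revYo.
        rewrite (proj1 (Ll _ w k (Lr f' u2 m Hf'))). ring.
      - intros z1 z2 k m. unfold itero_term.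
        rewrite opp_Y_add_l, (proj1 (Ll f' w m Hf')). ring. }
  intros n1 u1 H1. revert u2. apply (hom_ind Z A HVs (va_gr V) HVg 0%Z).
  2:{ intros x y Hx Hy. assert (G := compat_add _ _ _ _ Hx Hy). revert G. apply compat_ext.
      - intros z1 z2 k m. unfold prodo_term. simpl revYo.
        rewrite (proj1 (Ll f' _ m Hf')). ring.
      - intros z1 z2 k m. unfold itero_term.
        rewrite opp_Y_add_r, (proj1 (Ll f' w m Hf')). ring. }
  intros n2 u2 H2. revert w. apply (hom_ind Cplx W HWs (m_gr M) HWg C0).
  2:{ intros x y Hx Hy. assert (G := compat_add _ _ _ _ Hx Hy). revert G. apply compat_ext.
      - intros z1 z2 k m. unfold prodo_term. simpl revYo.
        rewrite (proj1 (Lr _ u1 k (Lr f' u2 m Hf'))). ring.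
      - intros z1 z2 k m. unfold itero_term.
        rewrite (proj1 (Lr f' _ m Hf')). ring. }
  intros h w Hw. apply (compat_hom n1 n2 h); auto.
Qed.

End Convergence.

(** * The graded dual *)

Section GradedDual.
Variables (I : Type) (W : VSpace) (g : Grading I W).

Lemma gdual_0 : gdual g (fun _ => C0).
Proof. split; [split; intros; ring|]. exists []; auto. Qed.

Lemma gdual_add f h : gdual g f -> gdual g h -> gdual g (fun w => Cadd (f w) (h w)).
Proof.
  intros [[A B] [S HS]] [[A' B'] [S' HS']]. split.
  - split; intros; [rewrite A, A'|rewrite B, B']; ring.
  - exists (S ++ S'). intros n v Hn.
    rewrite HS, HS' by (intros Hi; apply Hn, in_app_iff; auto). ring.
Qed.

Lemma gdual_scal c f : gdual g f -> gdual g (fun w => Cmul c (f w)).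
Proof.
  intros [[A B] [S HS]]. split.
  - split; intros; [rewrite A|rewrite B]; ring.
  - exists S. intros n v Hn. rewrite HS by auto. ring.
Qed.

(** Functionals are bundled with a proof of finite support; proof irrelevance keeps equality
    extensional. *)
Definition dual : VSpace := {|
  vcar := { f : W -> Cplx | gdual g f };
  vzero := exist _ _ gdual_0;
  vadd t1 t2 := exist _ _ (gdual_add _ _ (proj2_sig t1) (proj2_sig t2));
  vscal c t := exist _ _ (gdual_scal c _ (proj2_sig t)) |}.

Definition dual_eval (t : dual) : W -> Cplx := proj1_sig t.

Lemma dual_ext (t1 t2 : dual) : (forall w, dual_eval t1 w = dual_eval t2 w) -> t1 = t2.
Proof.
  destruct t1 as [f1 H1], t2 as [f2 H2]. unfold dual_eval; simpl. intros E.
  apply functional_extensionality in E. subst. f_equal. apply proof_irrelevance.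
Qed.

Lemma dual_vspace : is_vspace dual.
Proof. repeat split; intros; apply dual_ext; intros w; unfold dual_eval; simpl; ring. Qed.

Lemma dual_eval_linfun t : is_linfun (dual_eval t).
Proof. apply (proj2_sig t). Qed.

Lemma dual_eval_sub (t1 t2 : dual) w :
  dual_eval (vsub t1 t2) w = Csub (dual_eval t1 w) (dual_eval t2 w).
Proof. unfold dual_eval; simpl. ring. Qed.

Lemma dual_eval_vsum {X} (l : list X) (F : X -> dual) w :
  dual_eval (vsum l F) w = Csum l (fun x => dual_eval (F x) w).
Proof. induction l as [|x l IH]; [reflexivity|]. simpl. rewrite <- IH. reflexivity. Qed.

Lemma dual_eval_iter (N : dual -> dual) (N' : W -> W) :
  (forall t w, dual_eval (N t) w = dual_eval t (N' w)) ->
  forall m t w, dual_eval (Nat.iter m N t) w = dual_eval t (Nat.iter m N' w).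
Proof.
  intros H m. induction m as [|m IH]; intros t w; auto.
  change (Nat.iter (S m) N t) with (N (Nat.iter m N t)).
  rewrite H, IH, Nat.iter_succ_r. reflexivity.
Qed.

End GradedDual.
Arguments dual {I W} g.
Arguments dual_eval {I W g} t w.

(** A functional that vanishes on the common kernel of finitely many others is a combination of
    them. With evaluations as the others, this replaces a dimension count in showing that W_[n]
    fills its double dual. *)
Lemma linfun_span {X : VSpace} {B} (HX : is_vspace X) (e : B -> X -> Cplx) (bs : list B)
  (F : X -> Cplx) : (forall b, is_linfun (e b)) -> is_linfun F ->
  (forall x, (forall b, In b bs -> e b x = C0) -> F x = C0) ->
  exists ps : list (Cplx * B), forall x, F x = Csum ps (fun p => Cmul (fst p) (e (snd p) x)).
Proof.
  intros He. revert F. induction bs as [|b bs IH]; intros F HF H.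
  - exists []. intros x. simpl. apply H. intros ? [].
  - destruct (classic (exists x, (forall b', In b' bs -> e b' x = C0) /\ e b x <> C0))
      as [(x & Hx & Hbx)|N].
    + set (c := Cmul (F x) (Cinv (e b x))).
      destruct (IH (fun y => Csub (F y) (Cmul c (e b y)))) as [ps Hps].
      * split; intros; [rewrite (proj1 HF), (proj1 (He b))|rewrite (proj2 HF), (proj2 (He b))]; ring.
      * intros y Hy. set (q := Cmul (e b y) (Cinv (e b x))).
        assert (E : F (vsub y (vscal q x)) = C0).
        { apply H. intros b' [<-|Hb']; rewrite (linfun_sub X) by auto; rewrite (proj2 (He _)).
          - unfold q. field. auto.
          - rewrite Hx, Hy by auto. ring. }
        rewrite (linfun_sub X), (proj2 HF) in E by auto. rewrite <- E. unfold c, q. ring.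
      * exists ((c, b) :: ps). intros y. cbn [Csum fold_right fst snd].
        fold (Csum ps (fun p => Cmul (fst p) (e (snd p) y))). rewrite <- Hps. ring.
    + apply IH; auto. intros x Hx. apply H. intros b' [<-|Hb']; auto.
      apply NNPP. intros Hn. apply N. exists x; auto.
Qed.

Section Contragredient.
Variables (V : VAData) (rV : SL2 (va_sp V)).
Hypothesis HM : is_mobius_MOSVA V rV.
Variables (M : ModData V) (rW : SL2 (m_sp M)).
Hypothesis HW : is_mobius_module V rV M rW.
Hypothesis HR : grading_restricted M.
Notation A := (va_sp V).
Notation W := (m_sp M).
Notation homW := (hom (m_gr M)).
Notation YoM := (Yo V rV M).
Notation T := (dual (m_gr M)).
Notation eval := (@dual_eval Cplx W (m_gr M)).
Let HVs : is_vspace A := V_vspace V rV HM.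
Let HWs : is_vspace W := W_vspace V rV M rW HW.
Let HWg : is_grading (m_gr M) := W_grading V rV M rW HW.

Lemma gdual_support (t : T) :
  exists S, NoDup S /\ forall w, eval t w = Csum S (fun h => eval t (gproj (m_gr M) h w)).
Proof. apply (gdual_decomp V rV M rW HW), (proj2_sig t). Qed.

Definition dual_grading : Grading Cplx T := {|
  gproj n t := exist _ _ (gdual_gproj V rV M rW HW _ n (dual_eval_linfun _ _ _ t));
  gsupp t := proj1_sig (constructive_indefinite_description _ (gdual_support t)) |}.

Definition dual_Y (u : A) (t : T) (k : Z) : T :=
  exist _ _ (Yo_gdual V rV HM M rW HW _ u k (proj2_sig t)).

Lemma gdual_L1 (t : T) : gdual (m_gr M) (fun w => eval t (L1 rW w)).
Proof.
  apply (gdual_comp V rV M rW HW) with (c := Copp C1).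
  - apply (proj2_sig t).
  - apply (W_L1_lin V rV M rW HW).
  - apply (W_L1_hom V rV M rW HW).
Qed.

Lemma gdual_L0 (t : T) : gdual (m_gr M) (fun w => eval t (L0 rW w)).
Proof.
  apply (gdual_comp V rV M rW HW) with (c := C0).
  - apply (proj2_sig t).
  - apply (W_L0_lin V rV M rW HW).
  - intros h w Hw. replace (Cadd h C0) with h by ring. apply (W_L0_hom V rV M rW HW), Hw.
Qed.

Lemma gdual_Lm1 (t : T) : gdual (m_gr M) (fun w => eval t (Lm1 rW w)).
Proof.
  apply (gdual_comp V rV M rW HW) with (c := C1).
  - apply (proj2_sig t).
  - apply (W_Lm1_lin V rV M rW HW).
  - apply (W_Lm1_hom V rV M rW HW).
Qed.

Definition dual_sl2 : SL2 T := {|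
  Lm1 t := exist _ _ (gdual_L1 t);
  L0 t := exist _ _ (gdual_L0 t);
  L1 t := exist _ _ (gdual_Lm1 t) |}.

Definition dual_mod : ModData (opp_VA V) :=
  Build_ModData (opp_VA V) T dual_grading dual_Y (Lm1 dual_sl2).

Lemma dual_gsupp (t : T) : NoDup (gsupp dual_grading t) /\
  forall w, eval t w = Csum (gsupp dual_grading t) (fun h => eval t (gproj (m_gr M) h w)).
Proof. simpl. destruct constructive_indefinite_description; auto. Qed.

Lemma eval_linfun (t : T) : is_linfun (eval t).
Proof. apply dual_eval_linfun. Qed.

Lemma dual_is_grading : is_grading dual_grading.
Proof.
  repeat split.
  - intros t1 t2. apply dual_ext. intros w. reflexivity.
  - intros c t. apply dual_ext. intros w. reflexivity.
  - intros n t. apply dual_ext. intros w. unfold dual_eval; simpl.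
    fold (eval t). f_equal. apply (gproj_hom Cplx W _ HWg).
  - intros n m t N. apply dual_ext. intros w. unfold dual_eval; simpl.
    rewrite (gproj_neq Cplx W _ HWg) by auto. apply (linfun_0 W HWs), eval_linfun.
  - apply dual_gsupp.
  - apply dual_ext. intros w. rewrite dual_eval_vsum. apply dual_gsupp.
Qed.

Lemma W_gproj_d n w : gproj (m_gr M) n (m_d M w) = vscal n (gproj (m_gr M) n w).
Proof. apply (gproj_degop Cplx W HWs _ HWg (fun z => z)). Qed.

Lemma eval_degop (t : T) w : eval (m_d dual_mod t) w = eval t (m_d M w).
Proof.
  unfold m_d at 1. unfold degop; simpl. rewrite dual_eval_vsum.
  destruct (dual_gsupp t) as [_ E]. rewrite E. apply Csum_ext. intros n _.
  rewrite W_gproj_d. symmetry.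
  apply (eval_linfun t).
Qed.

Lemma dual_is_bilin : is_bilin_op dual_Y.
Proof.
  split; intros; split; intros; apply dual_ext; intros w0; unfold dual_eval; simpl;
    try reflexivity.
  - apply (Yo_add_l V rV HM M rW HW), eval_linfun.
  - apply (Yo_scal_l V rV HM M rW HW), eval_linfun.
Qed.

(** Y^s(v, x) 1 = e^{xD} Y(1, -x) v = e^{xD} v, whose linear coefficient is D v. *)
Lemma opp_D v : va_D (opp_VA V) v = va_D V v.
Proof.
  unfold va_D at 1; simpl. unfold opp_Y.
  assert (D0 : forall j, Nat.iter j (va_D V) vzero = vzero)
    by (intros j; apply (lin_0 A A); auto; apply is_lin_iter, (D_lin V rV HM)).
  rewrite (fsum_eq A HVs _ 2).
  - cbn [vsum seq fold_right]. rewrite !(V_Y_one_l V rV HM). cbn [Nat.iter Nat.add].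
    change (Z.of_nat 0) with 0%Z. change (Z.of_nat 1) with 1%Z.
    destruct (Z.eq_dec (-2 + 0) (-1)); [lia|]. destruct (Z.eq_dec (-2 + 1) (-1)); [|lia].
    rewrite vscal_vzero, vadd_0l, vadd_0r by auto. simpl Nat.iter.
    rewrite <- (vscal_1 A HVs (va_D V v)) at 2. f_equal.
    unfold Csign. simpl. apply Cplx_ext; simpl; field.
  - intros j Hj. rewrite (V_Y_one_l V rV HM). destruct Z.eq_dec; [lia|].
    rewrite D0. apply vscal_vzero; auto.
Qed.

Lemma eval_opprod us ks (t : T) w :
  eval (opprod dual_Y us ks t) w = eval t (revYo V rV M us ks w).
Proof.
  revert ks w. induction us as [|u us IH]; intros [|k ks] w; auto.
  simpl. rewrite <- IH. reflexivity.
Qed.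

Lemma double_dual_eval (F : T -> Cplx) : gdual dual_grading F ->
  exists w, forall t, F t = eval t w.
Proof.
  intros [HF [S HS]].
  assert (HT := dual_vspace Cplx W (m_gr M)).
  assert (P : forall n, exists w, forall t, F (gproj dual_grading n t) = eval t w).
  { intros n. destruct (HR n) as [bs Hbs].
    destruct (linfun_span HT (fun b (t : T) => eval t (gproj (m_gr M) n b)) bs
       (fun t => F (gproj dual_grading n t))) as [ps Hps].
    - intros b. split; intros; reflexivity.
    - apply is_linfun_comp; auto. apply gproj_lin, dual_is_grading.
    - intros t Ht. replace (gproj dual_grading n t) with (vzero : T).
      + apply (linfun_0 T); auto.
      + apply dual_ext. intros w. unfold dual_eval at 2; simpl. fold (eval t).
        destruct (Hbs _ (gproj_hom Cplx W _ HWg n w)) as (cs & _ & E).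
        rewrite <- (gproj_hom Cplx W _ HWg n w), E.
        rewrite (lin_vsum W W), (linfun_vsum W) by (auto using eval_linfun; apply gproj_lin; auto).
        rewrite Csum_0; [reflexivity|]. intros [c b] Hin.
        rewrite (proj2 (gproj_lin Cplx W _ HWg n)), (proj2 (eval_linfun t)). simpl.
        rewrite Ht by (apply in_combine_r in Hin; auto). ring.
    - exists (vsum ps (fun p => vscal (fst p) (gproj (m_gr M) n (snd p)))). intros t.
      rewrite Hps, (linfun_vsum W) by auto using eval_linfun. apply Csum_ext. intros p _.
      symmetry. apply (eval_linfun t). }
  assert (Q : exists w, forall t, Csum (nodup eq_dec_classic S) (fun n => F (gproj dual_grading n t)) = eval t w).
  { induction (nodup eq_dec_classic S) as [|n l [w Hw]].
    - exists vzero. intros t. symmetry. apply (linfun_0 W HWs), eval_linfun.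
    - destruct (P n) as [w' Hw']. exists (vadd w' w). intros t.
      rewrite (proj1 (eval_linfun t)), <- Hw, <- Hw'. reflexivity. }
  destruct Q as [w Hw]. exists w. intros t. rewrite <- Hw.
  rewrite (gsupp_sum Cplx T _ dual_is_grading t) at 1. rewrite (linfun_vsum T) by auto.
  apply Csum_support; [apply gsupp_nodup, dual_is_grading|apply NoDup_nodup| |].
  - intros h _ Hh. apply HS. intros Hi. apply Hh, nodup_In, Hi.
  - intros h _ Hh. rewrite (gsupp_out Cplx T HT _ dual_is_grading h t Hh). apply (linfun_0 T); auto.
Qed.

Lemma dual_rat_assoc : rat_assoc (opp_Y V) dual_Y dual_grading.
Proof.
  intros F HF. destruct (double_dual_eval F HF) as [w Hw].
  assert (EP : forall us t, prod_term dual_Y us t F = prodo_term V rV M us w (eval t)).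
  { intros us t. apply functional_extensionality; intros zs.
    apply functional_extensionality; intros ks. unfold prod_term, prodo_term.
    rewrite Hw, eval_opprod. reflexivity. }
  assert (EI : forall u1 u2 t, iter_term (opp_Y V) dual_Y u1 u2 t F = itero_term V rV M u1 u2 w (eval t)).
  { intros u1 u2 t. apply functional_extensionality; intros zs.
    apply functional_extensionality; intros ks. unfold iter_term, itero_term.
    destruct zs as [|z1 [|z2 [|]]]; auto. destruct ks as [|k [|m [|]]]; auto.
    rewrite Hw. reflexivity. }
  split; [|split].
  - intros us t. rewrite EP. apply (prodo_series V rV HM M rW HW), (proj2_sig t).
  - intros u1 u2 t. rewrite EI.
    apply (rational_series_ratsum _ _ _ iter_region_nondeg).
    apply (compat_Yo V rV HM M rW HW u1 u2 w (eval t) (proj2_sig t)).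
  - intros u1 u2 t z1 z2 s1 s2 Hz H1 H2. rewrite EP in H1. rewrite EI in H2.
    destruct (compat_Yo V rV HM M rW HW u1 u2 w (eval t) (proj2_sig t)) as [_ H].
    destruct (H z1 z2 Hz) as (s & S1 & S2).
    rewrite (asum_unique _ _ _ _ H1 S1). apply (asum_unique _ _ _ _ S2 H2).
Qed.

Lemma dual_left_module : is_left_module (opp_VA V) dual_mod.
Proof.
  split; [apply dual_vspace|]. split; [apply dual_is_grading|]. split; [apply dual_is_bilin|].
  split.
  { split; intros; apply dual_ext; intros w; reflexivity. }
  split.
  { assert (H := HW). destruct H as [(_ & _ & _ & _ & [N H] & _) _]. exists N. intros m t Hm.
    apply dual_ext. intros w. unfold dual_eval; simpl. rewrite H by auto.
    apply (linfun_0 W HWs), eval_linfun. }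
  split.
  (* Transposed: the degree m part of [L(1) w] is determined by the degree m + 1 part of [w],
     because [L(1)] lowers degrees by one. *)
  { intros m t Ht. apply dual_ext. intros w. unfold dual_eval; simpl. fold (eval t).
    rewrite <- Ht. unfold dual_eval; simpl. fold (eval t). f_equal.
    revert w. apply (hom_ind Cplx W HWs (m_gr M) HWg C0).
    - intros n w Hw. assert (H1 := W_L1_hom V rV M rW HW n w Hw).
      destruct (eq_dec_classic n (Cadd m C1)) as [->|N].
      + rewrite Hw. reflexivity.
      + rewrite (hom_neq Cplx W (m_gr M) HWg n (Cadd m C1) w) by (auto; congruence).
        rewrite (lin_0 W W HWs HWs (L1 rW)) by apply (W_L1_lin V rV M rW HW).
        rewrite (hom_neq Cplx W (m_gr M) HWg (Csub n C1) m (L1 rW w)); auto.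
        * apply (lin_0 W W HWs HWs), (gproj_lin Cplx W _ HWg).
        * intros E. apply N. rewrite E. ring.
    - intros x y Hx Hy.
      rewrite (proj1 (gproj_lin Cplx W _ HWg (Cadd m C1))), !(proj1 (W_L1_lin V rV M rW HW)),
        !(proj1 (gproj_lin Cplx W _ HWg m)), Hx, Hy. reflexivity. }
  split.
  { intros u t k. apply dual_ext. intros w.
    assert (E := Yo_d V rV HM M rW HW (eval t) u w k (eval_linfun t)).
    transitivity (Csub (eval t (YoM u (m_d M w) k)) (eval t (m_d M (YoM u w k)))); [|exact E].
    rewrite <- (eval_degop t (YoM u w k)).
    change (eval t (YoM u (m_d M w) k)) with (eval (dual_Y u t k) (m_d M w)).
    rewrite <- eval_degop.
    rewrite dual_eval_sub. reflexivity. }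
  split.
  { intros t k. apply dual_ext. intros w.
    assert (E := Yo_one V rV HM M rW HW (eval t) w k (eval_linfun t)).
    unfold dual_eval at 1; simpl. fold (eval t). rewrite E.
    destruct (Z.eq_dec k (-1)); auto. apply (linfun_0 W HWs), eval_linfun. }
  split.
  { intros u t k. rewrite opp_D. apply dual_ext. intros w.
    apply (Yo_D V rV HM M rW HW (eval t)), eval_linfun. }
  split.
  { intros u t k. apply dual_ext. intros w. rewrite dual_eval_sub.
    apply (Yo_L1 V rV HM M rW HW (eval t)), eval_linfun. }
  apply dual_rat_assoc.
Qed.

(** * Nilpotency and sl(2) on the graded dual *)

(** A finite spanning set provides one exponent for all of W_[n]. The dual requires this uniformity:
    a power of the transpose kills a functional only if the functional vanishes on the whole image
    of that power. *)
Lemma W_nilpotent_uniform n : exists m, forall q w, (m <= q)%nat -> homW n w ->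
  Nat.iter q (fun x => vsub (L0 rW x) (vscal n x)) w = vzero.
Proof.
  set (N := fun x => vsub (L0 rW x) (vscal n x)).
  assert (NL : forall q, is_lin (Nat.iter q N)).
  { intros q. apply is_lin_iter, (W_L0_shift_lin V rV M rW HW). }
  assert (ge : forall m q w, (m <= q)%nat -> Nat.iter m N w = vzero -> Nat.iter q N w = vzero).
  { intros m q w L E. replace q with (q - m + m)%nat by lia. rewrite Nat.iter_add, E.
    apply (lin_0 W W); auto. }
  destruct (HR n) as [bs Hbs].
  assert (B : exists m, forall b, In b bs -> Nat.iter m N (gproj (m_gr M) n b) = vzero).
  { clear Hbs. induction bs as [|b bs [m Hm]]; [exists 0%nat; intros ? []|].
    destruct (W_gen_eigen V rV M rW HW n (gproj (m_gr M) n b)) as [m' Hm'];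
      [apply gproj_hom; auto|].
    exists (Nat.max m m'). intros b' [<-|Hb'].
    - apply (ge m'); [lia|exact Hm'].
    - apply (ge m); [lia|auto]. }
  destruct B as [m Hm]. exists m. intros q w Hq Hw.
  destruct (Hbs w Hw) as (cs & _ & E). rewrite <- Hw, E.
  rewrite (lin_vsum W W), (lin_vsum W W) by (auto; apply gproj_lin; auto).
  apply vsum_0; auto. intros [c b] Hin.
  rewrite (proj2 (gproj_lin Cplx W _ HWg n)), (proj2 (NL q)). simpl.
  rewrite (ge m q) by (auto; apply Hm; apply in_combine_r in Hin; auto).
  apply vscal_vzero; auto.
Qed.

Lemma eval_L0_iter c m (t : T) w :
  eval (Nat.iter m (fun x => vsub (L0 dual_sl2 x) (vscal c x)) t) w
  = eval t (Nat.iter m (fun x => vsub (L0 rW x) (vscal c x)) w).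
Proof.
  apply (dual_eval_iter Cplx W (m_gr M) (fun x => vsub (L0 dual_sl2 x) (vscal c x))
     (fun x => vsub (L0 rW x) (vscal c x))).
  intros t' w'. rewrite dual_eval_sub, (linfun_sub W) by apply eval_linfun.
  rewrite (proj2 (eval_linfun t')). reflexivity.
Qed.

(** A functional meets finitely many degrees, so the uniform exponents combine into one. On the
    degree n component, [m_d] acts by the scalar n. *)
Lemma dual_nilpotent (t : T) :
  exists m, Nat.iter m (fun x => vsub (L0 dual_sl2 x) (m_d dual_mod x)) t = vzero.
Proof.
  destruct (dual_gsupp t) as [_ E].
  assert (B : exists m, forall n w, In n (gsupp dual_grading t) -> homW n w ->
     Nat.iter m (fun x => vsub (L0 rW x) (vscal n x)) w = vzero).
  { clear E. induction (gsupp dual_grading t) as [|n l [m Hm]]; [exists 0%nat; intros ? ? []|].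
    destruct (W_nilpotent_uniform n) as [m' Hm']. exists (m + m')%nat.
    intros n' w [<-|Hn] Hw; [apply Hm'; auto; lia|].
    rewrite Nat.add_comm, Nat.iter_add, Hm by auto.
    apply (lin_0 W W); auto. apply is_lin_iter, (W_L0_shift_lin V rV M rW HW). }
  destruct B as [m Hm]. exists m. apply dual_ext. intros w.
  rewrite (dual_eval_iter Cplx W (m_gr M) (fun x => vsub (L0 dual_sl2 x) (m_d dual_mod x))
     (fun x => vsub (L0 rW x) (m_d M x))).
  2:{ intros t' w'. rewrite dual_eval_sub, (linfun_sub W) by apply eval_linfun.
      f_equal. apply eval_degop. }
  rewrite E. apply Csum_0. intros n Hn.
  replace (gproj (m_gr M) n (Nat.iter m (fun x => vsub (L0 rW x) (m_d M x)) w))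
    with (Nat.iter m (fun x => vsub (L0 rW x) (vscal n x)) (gproj (m_gr M) n w)).
  - rewrite Hm; [apply (linfun_0 W HWs), eval_linfun|auto|apply gproj_hom; auto].
  - clear Hm. induction m as [|m IH]; auto. simpl.
    rewrite (lin_sub W W) by (apply gproj_lin; auto).
    rewrite W_gproj_d, (W_gproj_L0 V rV M rW HW), <- IH.
    reflexivity.
Qed.

(** Transposition reverses products while the definition exchanges [L(1)] and [L(-1)]; the two
    effects cancel in every bracket. *)
Lemma dual_is_sl2 : is_sl2 dual_sl2.
Proof.
  destruct (W_sl2 V rV M rW HW) as (A1 & A2 & A3 & E1 & E2 & E3).
  split; [|split; [|split; [|split; [|split]]]].
  - split; intros; apply dual_ext; intros w; reflexivity.
  - split; intros; apply dual_ext; intros w; reflexivity.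
  - split; intros; apply dual_ext; intros w; reflexivity.
  - intros t. apply dual_ext. intros w. rewrite dual_eval_sub.
    transitivity (Cmul (Copp C1) (eval t (vsub (L0 rW (Lm1 rW w)) (Lm1 rW (L0 rW w)))));
      [|rewrite E2; reflexivity].
    rewrite (linfun_sub W) by apply eval_linfun.
    change (Csub (eval t (Lm1 rW (L0 rW w))) (eval t (L0 rW (Lm1 rW w)))
      = Cmul (Copp C1) (Csub (eval t (L0 rW (Lm1 rW w))) (eval t (Lm1 rW (L0 rW w))))). ring.
  - intros t. apply dual_ext. intros w. rewrite dual_eval_sub.
    transitivity (Copp (eval t (vsub (L0 rW (L1 rW w)) (L1 rW (L0 rW w))))).
    + rewrite (linfun_sub W) by apply eval_linfun.
      change (Csub (eval t (L1 rW (L0 rW w))) (eval t (L0 rW (L1 rW w)))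
        = Copp (Csub (eval t (L0 rW (L1 rW w))) (eval t (L1 rW (L0 rW w))))). ring.
    + rewrite E1, (proj2 (eval_linfun t)).
      change (Copp (Cmul (Copp C1) (eval t (L1 rW w))) = eval t (L1 rW w)). ring.
  - intros t. apply dual_ext. intros w. rewrite dual_eval_sub.
    transitivity (eval t (vsub (Lm1 rW (L1 rW w)) (L1 rW (Lm1 rW w)))).
    + rewrite (linfun_sub W) by apply eval_linfun. unfold dual_eval; simpl. reflexivity.
    + rewrite E3, (proj2 (eval_linfun t)). reflexivity.
Qed.

Lemma dual_mobius_module : is_mobius_module (opp_VA V) rV dual_mod dual_sl2.
Proof.
  split; [apply dual_left_module|]. split; [apply dual_is_sl2|]. split; [reflexivity|].
  split.
  { intros u t k. apply dual_ext. intros w. rewrite dual_eval_sub.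
    apply (Yo_L0 V rV HM M rW HW (eval t)), eval_linfun. }
  split.
  { intros u t k. apply dual_ext. intros w. rewrite dual_eval_sub.
    apply (Yo_Lm1 V rV HM M rW HW (eval t)), eval_linfun. }
  split.
  { intros n t Ht. destruct (W_nilpotent_uniform n) as [m Hm]. exists m.
    apply dual_ext. intros w. rewrite eval_L0_iter.
    rewrite <- Ht. unfold dual_eval at 1; simpl. fold (eval t).
    rewrite (W_gproj_L0_iter V rV M rW HW), Hm by (auto; apply gproj_hom; auto).
    apply (linfun_0 W HWs), eval_linfun. }
  split; [|apply dual_nilpotent].
  intros t. apply dual_ext. intros w.
  rewrite eval_degop. unfold dual_eval at 1; simpl.
  fold (eval (m_d dual_mod t)). rewrite eval_degop, <- (W_L0_d V rV M rW HW). reflexivity.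
Qed.

End Contragredient.

Theorem mainTheorem18 (V : VAData) (rV : SL2 (va_sp V)) (M : ModData V)
    (rW : SL2 (m_sp M)) :
  is_mobius_MOSVA V rV ->
  is_mobius_module V rV M rW ->
  grading_restricted M ->
  exists (T : VSpace) (gT : Grading Cplx T) (YT : va_sp V -> T -> Z -> T)
         (rT : SL2 T) (iota : T -> (m_sp M -> Cplx)),
    (* T is (a copy of) the graded dual W', via iota *)
    (forall t1 t2, iota t1 = iota t2 -> t1 = t2) /\
    (forall f, gdual (m_gr M) f <-> exists t, iota t = f) /\
    (forall t1 t2 w, iota (vadd t1 t2) w = Cadd (iota t1 w) (iota t2 w)) /\
    (forall c t w, iota (vscal c t) w = Cmul c (iota t w)) /\
    (* W'_[n] = W_[n]^* *)
    (forall n t w, iota (gproj gT n t) w = iota t (gproj (m_gr M) n w)) /\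
    (* <Y_W'(u,x) w', w> = <w', Y_W^o(u,x) w> *)
    (forall u t k w, iota (YT u t k) w = iota t (Yo V rV M u w k)) /\
    (* <L_W'(j) w', w> = <w', L_W(-j) w> *)
    (forall t w, iota (Lm1 rT t) w = iota t (L1 rW w)) /\
    (forall t w, iota (L0 rT t) w = iota t (L0 rW w)) /\
    (forall t w, iota (L1 rT t) w = iota t (Lm1 rW w)) /\
    is_mobius_module (opp_VA V) rV
      (Build_ModData (opp_VA V) T gT YT (Lm1 rT)) rT.
Proof.
  intros HM HW HR.
  exists (dual (m_gr M)), (dual_grading V rV M rW HW), (dual_Y V rV HM M rW HW),
    (dual_sl2 V rV M rW HW), dual_eval.
  split; [|split; [|do 7 (split; [reflexivity|])]].
  - intros t1 t2 E. apply dual_ext. intros w. rewrite E. reflexivity.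
  - intros f. split.
    + intros H. exists (exist _ f H). reflexivity.
    + intros [t <-]. apply (proj2_sig t).
  - apply (dual_mobius_module V rV HM M rW HW HR).
Qed.
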